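(* Let $A$ be a C*-algebra of stable rank one. Two countably generated Hilbert C*-modules over $A$ are Cuntz equivalent if, and only if, they are isomorphic. In other words, the Cuntz semigroup in this case is just the semigroup of isomorphism classes of countably generated Hilbert $A$-modules. Furthermore, the order structure arises from inclusion of modules: for countably generated Hilbert $A$-modules $X$ and $Y$, $[X]\le[Y]$ if and only if $X$ is isomorphic to a subobject of $Y$.
   Context: A C*-algebra $A$ has stable rank one if the invertible elements are dense in $A$ (if $A$ is unital) or in the C*-algebra $A+\mathbb{C}1$ obtained by adjoining a unit (if $A$ is not unital). Hilbert $A$-modules are right Hilbert C*-modules over $A$. A subobject of a Hilbert $A$-module is a countably generated closed submodule with the inherited $A$-valued inner product; isomorphism means bijective $A$-module map preserving the $A$-valued inner product. Compact endomorphisms of $Y$ are the elements of the norm-closed linear span of the maps $\xi\mapsto\eta\langle\zeta,\xi\rangle$, $\eta,\zeta\in Y$. A subobject $X$ of $Y$ is compactly contained in $Y$ if there is a compact self-adjoint endomorphism of $Y$ equal to the identity on $X$. For countably generated Hilbert $A$-modules $X,Y$, $[X]\le[Y]$ means that every compactly contained subobject of $X$ is isomorphic to a compactly contained subobject of $Y$; $X$ and $Y$ are Cuntz equivalent, $[X]=[Y]$, if $[X]\le[Y]$ and $[Y]\le[X]$. The Cuntz semigroup $\mathrm{Cu}(A)$ is the set of Cuntz equivalence classes $[X]$ of countably generated Hilbert $A$-modules with this order and the addition $[X]+[Y]=[X\oplus Y]$. *)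

(* Defs.v *)
From HB Require Import structures.
From mathcomp Require Import all_boot all_order all_algebra.
From mathcomp Require Import complex.
From mathcomp Require Import boolp classical_sets functions.
From mathcomp Require Import reals topology normedtype.

Set Implicit Arguments.
Unset Strict Implicit.
Unset Printing Implicit Defensive.

Import Order.TTheory GRing.Theory Num.Theory.
Import numFieldNormedType.Exports.

Local Open Scope classical_set_scope.
Local Open Scope ring_scope.
Local Open Scope complex_scope.

(* A C*-algebra need not be unital, so its product is not a GRing structure.
   Norms of a normed module over R[i] take values in R[i]. *)
HB.mixin Record CompleteNormedModule_isCstarAlgebra (R : realType) A
    of CompleteNormedModule R[i] A := {
  cmul : A -> A -> A;
  cstar : A -> A;
  cmulA : forall a b c, cmul a (cmul b c) = cmul (cmul a b) c;
  cmulDl : forall a b c, cmul (a + b) c = cmul a c + cmul b c;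
  cmulDr : forall a b c, cmul a (b + c) = cmul a b + cmul a c;
  cmulZl : forall (k : R[i]) a b, cmul (k *: a) b = k *: cmul a b;
  cmulZr : forall (k : R[i]) a b, cmul a (k *: b) = k *: cmul a b;
  cnormM : forall a b, `|cmul a b| <= `|a| * `|b|;
  cstarK : forall a, cstar (cstar a) = a;
  cstarD : forall a b, cstar (a + b) = cstar a + cstar b;
  cstarZ : forall (k : R[i]) a, cstar (k *: a) = (k^*)%R *: cstar a;
  cstarM : forall a b, cstar (cmul a b) = cmul (cstar b) (cstar a);
  cnorm_star : forall a, `|cmul (cstar a) a| = `|a| ^+ 2
}.

#[short(type="cstarAlgType")]
HB.structure Definition CstarAlgebra (R : realType) :=
  { A of CompleteNormedModule_isCstarAlgebra R A & CompleteNormedModule R[i] A }.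

Section StableRankOne.
Variables (R : realType) (A : cstarAlgType R).

Definition cpositive (a : A) := exists b : A, a = cmul (cstar b) b.

Definition is_cunit (e : A) := forall a : A, cmul e a = a /\ cmul a e = a.

Definition cinvertible (e a : A) :=
  exists b : A, cmul a b = e /\ cmul b a = e.

(* A + C1 is the space of pairs (a, k), standing for a + k1. *)
Definition unitz_mul (x y : A * R[i]) : A * R[i] :=
  (cmul x.1 y.1 + y.2 *: x.1 + x.2 *: y.1, x.2 * y.2).

Definition unitz_one : A * R[i] := (0, 1).

Definition unitz_invertible (x : A * R[i]) :=
  exists y, unitz_mul x y = unitz_one /\ unitz_mul y x = unitz_one.

(* The norm of left multiplication by a + k1 on A; when A is not unital, it is
   the C*-norm of A + C1. *)
Definition unitz_norm (x : A * R[i]) : R :=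
  sup [set complex.Re `|cmul x.1 c + x.2 *: c|
      | c in [set c : A | `|c| <= 1]].

Definition stable_rank_one :=
  (forall e : A, is_cunit e -> dense [set a : A | cinvertible e a]) /\
  (~ (exists e : A, is_cunit e) ->
   forall (x : A * R[i]) (eps : R), 0 < eps ->
   exists2 y, unitz_invertible y & unitz_norm (x - y) < eps).

End StableRankOne.

(* The inner product is linear in its second variable. Definiteness follows
   from hnormE, and completeness for the norm |<x, x>|^(1/2) is that of the
   underlying normed module. *)
HB.mixin Record CompleteNormedModule_isHilbertModule (R : realType)
    (A : cstarAlgType R) X of CompleteNormedModule R[i] X := {
  hact : X -> A -> X;
  inner : X -> X -> A;
  hactDl : forall x y a, hact (x + y) a = hact x a + hact y a;
  hactDr : forall x a b, hact x (a + b) = hact x a + hact x b;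
  hactZl : forall (k : R[i]) x a, hact (k *: x) a = k *: hact x a;
  hactZr : forall (k : R[i]) x a, hact x (k *: a) = k *: hact x a;
  hactM : forall x a b, hact x (cmul a b) = hact (hact x a) b;
  innerDr : forall x y z, inner x (y + z) = inner x y + inner x z;
  innerZr : forall (k : R[i]) x y, inner x (k *: y) = k *: inner x y;
  inner_hact : forall x y a, inner x (hact y a) = cmul (inner x y) a;
  inner_star : forall x y, cstar (inner x y) = inner y x;
  inner_ge0 : forall x, cpositive (inner x x);
  hnormE : forall x, `|x| ^+ 2 = `|inner x x|
}.

#[short(type="hilbertModType")]
HB.structure Definition HilbertModule (R : realType) (A : cstarAlgType R) :=
  { X of CompleteNormedModule_isHilbertModule R A X
       & CompleteNormedModule R[i] X }.

Section Subobjects.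
Variables (R : realType) (A : cstarAlgType R).
Implicit Types X Y Z W : hilbertModType A.

Definition closed_submodule X (S : set X) :=
  [/\ S 0,
      (forall x y, S x -> S y -> S (x + y)),
      (forall (k : R[i]) x, S x -> S (k *: x)),
      (forall x (a : A), S x -> S (hact x a))
    & closed S].

Definition countably_generated X (S : set X) :=
  exists2 g : nat -> X, (forall n, S (g n)) &
    forall T : set X, closed_submodule T -> (forall n, T (g n)) -> S `<=` T.

Definition subobject X (S : set X) :=
  closed_submodule S /\ countably_generated S.

(* S and T are closed submodules of X and Y; the values of f outside S are
   irrelevant. *)
Definition sub_isomorphic X Y (S : set X) (T : set Y) :=
  exists f : X -> Y,
    [/\ set_bij S T f,
        (forall x y, S x -> S y -> f (x + y) = f x + f y),
        (forall (k : R[i]) x, S x -> f (k *: x) = k *: f x),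
        (forall x (a : A), S x -> f (hact x a) = hact (f x) a)
      & (forall x y, S x -> S y -> inner (f x) (f y) = inner x y :> A)].

Definition isomorphic X Y := sub_isomorphic [set: X] [set: Y].

Definition module_endomorphism Y (t : Y -> Y) :=
  [/\ (forall x y, t (x + y) = t x + t y),
      (forall (k : R[i]) x, t (k *: x) = k *: t x)
    & (forall x (a : A), t (hact x a) = hact (t x) a)].

Definition rank_one Y (eta zeta : Y) : Y -> Y :=
  fun xi => hact eta (inner zeta xi : A).

(* The last inequality says that the operator norm of the difference is at
   most eps. *)
Definition compact_endomorphism Y (t : Y -> Y) :=
  module_endomorphism t /\
  forall eps : R, 0 < eps ->
  exists (n : nat) (k : 'I_n -> R[i]) (eta zeta : 'I_n -> Y),
  forall x, `|t x - \sum_(i < n) k i *: rank_one (eta i) (zeta i) x|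
            <= eps%:C * `|x|.

Definition self_adjoint Y (t : Y -> Y) :=
  forall x y, inner (t x) y = inner x (t y) :> A.

Definition compactly_contained Y (S : set Y) :=
  subobject S /\
  exists t : Y -> Y,
    [/\ compact_endomorphism t, self_adjoint t & forall x, S x -> t x = x].

Definition cuntz_le X Y :=
  forall S : set X, compactly_contained S ->
  exists2 T : set Y, compactly_contained T & sub_isomorphic S T.

Definition cuntz_equiv X Y := cuntz_le X Y /\ cuntz_le Y X.

Definition cg_module X := countably_generated [set: X].

(* W is the direct sum of X and Y, with inner product
   <(x, y), (x', y')> = <x, x'> + <y, y'>, transported along a bijection.
   The norm of W is thus not that of the normed module X * Y. *)
Definition direct_sum X Y W :=
  exists f : X * Y -> W,
    [/\ set_bij setT setT f,
        (forall p q, f (p + q) = f p + f q),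
        (forall (k : R[i]) p, f (k *: p) = k *: f p),
        (forall p (a : A), f (hact p.1 a, hact p.2 a) = hact (f p) a)
      & (forall p q,
          inner (f p) (f q) = inner p.1 q.1 + inner p.2 q.2 :> A)].

End Subobjects.

Section CuntzSemigroup.
Variables (R : realType) (A : cstarAlgType R).

(* hilbertModType A lives in too large a universe for "set". *)
Definition class_of_modules := hilbertModType A -> Prop.

Section Classes.
Variable rel : hilbertModType A -> hilbertModType A -> Prop.

Definition module_class (X : hilbertModType A) : class_of_modules :=
  fun Y => cg_module Y /\ rel X Y.

Definition module_classes (c : class_of_modules) :=
  exists2 X : hilbertModType A, cg_module X & c = module_class X.

(* The modules whose class is [X (+) Y] for some representatives X of c and
   Y of d. *)
Definition class_add (c d : class_of_modules) : class_of_modules :=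
  fun Z => exists X Y W : hilbertModType A,
    [/\ c X, d Y, direct_sum X Y W & module_class W Z].

End Classes.

Definition Cu := module_classes (@cuntz_equiv R A).
Definition Cu_add := class_add (@cuntz_equiv R A).

Definition iso_classes := module_classes (@isomorphic R A).
Definition iso_add := class_add (@isomorphic R A).

End CuntzSemigroup.

Arguments Cu {R} A c.
Arguments iso_classes {R} A c.

(* Main.v *)
(* An isometry between Hilbert modules is a map preserving inner products.  The
   key fact is that, in stable rank one, two isometries [phi], [psi] of a
   Hilbert module S into Y are approximately unitarily equivalent.  If [theta]
   is a finite rank operator of S that almost fixes given vectors, then
   [T = psi theta phi^*] is a finite rank operator of Y.  Stable rank one makes T
   a norm limit of invertible operators: rank one operators are added one at a
   time, and [1 + eta G zeta^*] is invertible as soon as [G^-1 + <zeta, eta>] is.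
   The unitary part u of an invertible operator near T satisfies
   [u phi x ~ psi x], because [T^* T phi x ~ phi x].

   A countably generated X is the closed union of an increasing sequence of
   compactly contained subobjects, cut out by thresholds of a strictly positive
   compact operator.  If [X] <= [Y], each of them embeds in Y, and the embeddings
   can be corrected by unitaries of Y so as to converge: X embeds in Y.  If also
   [Y] <= [X], a two-sided intertwining of the two embeddings produces an
   isomorphism.

   The order structure of the C*-algebra, which the axioms only give through the
   elements [b^* b], is derived from Kaplansky's argument, carried out for
   adjointable operators of Hilbert modules. *)
Require Import Defs.
From HB Require Import structures.
From mathcomp Require Import all_boot all_order all_algebra.
From mathcomp Require Import complex.
From mathcomp Require Import boolp classical_sets functions.
From mathcomp Require Import reals topology normedtype.
From mathcomp Require Import ring lra.

Set Implicit Arguments.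
Unset Strict Implicit.
Unset Printing Implicit Defensive.

Import Order.TTheory GRing.Theory Num.Theory.
Import numFieldNormedType.Exports.

Local Open Scope classical_set_scope.
Local Open Scope ring_scope.
Local Open Scope complex_scope.

(** * Real-valued norms and operators on Hilbert modules *)

Section RealNorm.
Variables (R : realType) (V : completeNormedModType R[i]).
Implicit Types (x y z : V) (r : R) (S : set V).

(** Isometries between Hilbert modules need not be adjointable, as their ranges need not be
    complemented. So [psi theta phi^*] is at first only formal; it becomes an operator because
    [theta] is a finite sum of rank one operators, whose vectors can be moved by [phi] and [psi].
    The same device carries compact operators from one module to another, which gives the converse
    implications.

    Stable rank one speaks of [A + C1], but enters only through left multiplications on [A], seen as
    a Hilbert module over itself: each [1 + m] is near an invertible operator.

    There is no spectral calculus. Positivity of a self-adjoint [T] means [nrm (t - T) <= t] for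
    some [t], roots come from an iteration and inverses from Neumann series. The Cauchy-Schwarz
    inequality itself depends on the order of [A], so the order is built before it, with bounds on
    adjoints carried along by hand and a crude polarization estimate for limits. *)

Definition nrm x : R := complex.Re `|x|.

Lemma nrmE x : (nrm x)%:C = `|x|.
Proof. by rewrite /nrm RRe_real// ger0_real. Qed.

Lemma nrm_ge0 x : 0 <= nrm x.
Proof. by rewrite -ler0c nrmE. Qed.

Lemma nrmD x y : nrm (x + y) <= nrm x + nrm y.
Proof. by rewrite -lecR rmorphD /= !nrmE ler_normD. Qed.

Lemma nrmN x : nrm (- x) = nrm x.
Proof. by rewrite /nrm normrN. Qed.

Lemma nrmB x y : nrm (x - y) <= nrm x + nrm y.
Proof. by rewrite -(nrmN y) nrmD. Qed.

Lemma nrmC x y : nrm (x - y) = nrm (y - x).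
Proof. by rewrite -nrmN opprB. Qed.

Lemma nrm_tri x y z : nrm (x - z) <= nrm (x - y) + nrm (y - z).
Proof. by rewrite -[x - z](subrKA y) nrmD. Qed.

Lemma nrm0 : nrm (0 : V) = 0.
Proof. by rewrite /nrm normr0. Qed.

Lemma nrm_eq0 x : nrm x = 0 -> x = 0.
Proof.
by move=> x0; apply/eqP; rewrite -normr_eq0 -nrmE x0 eqxx.
Qed.

Lemma nrm_le0 x : nrm x <= 0 -> x = 0.
Proof.
by move=> x0; apply: nrm_eq0; apply/eqP; rewrite eq_le x0 nrm_ge0.
Qed.

Lemma nrmZc (k : R[i]) x : nrm (k *: x) = complex.Re `|k| * nrm x.
Proof.
apply: (@complexI R); rewrite rmorphM nrmE normrZ -(nrmE x); congr (_ * _).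
Qed.

Lemma nrmZ r x : nrm (r%:C *: x) = `|r| * nrm x.
Proof. by rewrite nrmZc normc_def/= expr0n/= addr0 sqrtr_sqr. Qed.

Lemma nrmZp r x : 0 <= r -> nrm (r%:C *: x) = r * nrm x.
Proof. by move=> r0; rewrite nrmZ ger0_norm. Qed.

Lemma nrm_eps x : (forall e, 0 < e -> nrm x <= e) -> x = 0.
Proof.
move=> H; apply: nrm_le0; apply/ler_addgt0Pl => e e0.
by rewrite addr0 H.
Qed.

Definition tends (u : nat -> V) x := forall e : R, 0 < e ->
  exists N, forall n, (N <= n)%N -> nrm (u n - x) <= e.

Lemma ball_nrm x r y : ball x (r%:C) y = (nrm (x - y) < r) :> Prop.
Proof. by rewrite -ball_normE /ball_ /= -nrmE ltcR. Qed.

Lemma closed_nrm S : closed S <->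
  forall x, (forall e, 0 < e -> exists2 s, S s & nrm (x - s) < e) -> S x.
Proof.
split=> [cS x H | H].
  rewrite (closure_id S).1//; move=> B /nbhs_ballP[e /= e0 eB].
  have eE : e = (complex.Re e)%:C by rewrite RRe_real// gtr0_real.
  have [|s Ss xs] := H (complex.Re e); first by rewrite -ltcR -eE.
  by exists s; split=> //; apply: eB; rewrite eE ball_nrm.
rewrite closure_id; apply/seteqP; split; first exact: subset_closure.
move=> x cx; apply: H => e e0.
have [|s [Ss bs]] := cx (ball x e%:C); first by apply: nbhsx_ballx; rewrite ltcR.
by exists s => //; move: bs; rewrite ball_nrm.
Qed.

Lemma tends_cauchy (u : nat -> V) :
  (forall e : R, 0 < e -> exists N, forall m n, (N <= m)%N -> (N <= n)%N ->
     nrm (u m - u n) <= e) ->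
  exists x, tends u x.
Proof.
move=> H.
have : cvg (u @ \oo).
  apply: cauchy_cvg; apply: cauchy_exP => e e0.
  have eE : e = (complex.Re e)%:C by rewrite RRe_real// gtr0_real.
  have e0' : 0 < complex.Re e by rewrite -ltcR -eE.
  have [|N HN] := H (complex.Re e / 2); first by rewrite divr_gt0.
  exists (u N); exists N => // n /= Nn.
  have := HN N n (leqnn N) Nn; rewrite eE ball_nrm => /le_lt_trans; apply.
  by lra.
move=> /cvg_ex[x ux]; exists x => e e0.
have [|N _ HN] := ux (ball x e%:C); first by apply: nbhsx_ballx; rewrite ltcR.
exists N => n Nn; have := HN n Nn; rewrite /= ball_nrm nrmC; exact: ltW.
Qed.

Lemma tends_uniq (u : nat -> V) x y : tends u x -> tends u y -> x = y.
Proof.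
move=> ux uy; apply/eqP; rewrite -subr_eq0; apply/eqP/nrm_eps => e e0.
have e2 : 0 < e / 2 by lra.
have [N HN] := ux _ e2; have [M HM] := uy _ e2.
have := nrm_tri x (u (maxn N M)) y.
have := HN _ (leq_maxl N M); have := HM _ (leq_maxr N M).
by rewrite (nrmC x (u _)); lra.
Qed.

Lemma tends_le (u : nat -> V) x (c : R) N :
  tends u x -> (forall n, (N <= n)%N -> nrm (u n) <= c) -> nrm x <= c.
Proof.
move=> ux uc; apply/ler_addgt0Pr => e e0.
have [M HM] := ux _ e0.
have := HM _ (leq_maxr N M); have := uc _ (leq_maxl N M).
have := nrm_tri 0 (u (maxn N M)) x; rewrite !sub0r !nrmN; lra.
Qed.

Lemma tendsD (u v : nat -> V) x y :
  tends u x -> tends v y -> tends (fun n => u n + v n) (x + y).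
Proof.
move=> ux vy e e0.
have e2 : 0 < e / 2 by lra.
have [N HN] := ux _ e2; have [M HM] := vy _ e2.
exists (maxn N M) => n; rewrite geq_max => /andP[/HN + /HM].
by have := nrmD (u n - x) (v n - y); rewrite addrACA -opprD; lra.
Qed.

Lemma tends_cst x : tends (fun=> x) x.
Proof. by move=> e e0; exists 0%N => n _; rewrite subrr nrm0 ltW. Qed.

End RealNorm.

Lemma tends_lip (R : realType) (V W : completeNormedModType R[i])
    (f : V -> W) (c : R) (u : nat -> V) x :
  0 <= c -> (forall y, nrm (f y - f x) <= c * nrm (y - x)) ->
  tends u x -> tends (fun n => f (u n)) (f x).
Proof.
move=> c0 fc ux e e0.
have [|N HN] := ux (e / (c + 1)); first by rewrite divr_gt0//; lra.
exists N => n /HN H; apply: le_trans (fc _) _.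
have c1 : 0 < c + 1 by lra.
rewrite ler_pdivlMr// in H.
have := nrm_ge0 (u n - x); nra.
Qed.

Section CstarBasics.
Variables (R : realType) (A : cstarAlgType R).
Implicit Types a b c : A.

Lemma cmul0l a : cmul 0 a = 0 :> A.
Proof. by have := cmulZl 0 0 a; rewrite !scale0r. Qed.

Lemma cmulNl a b : cmul (- a) b = - cmul a b.
Proof. by rewrite -scaleN1r cmulZl scaleN1r. Qed.

Lemma cstar0 : cstar 0 = 0 :> A.
Proof. by have := cstarZ 0 (0 : A); rewrite rmorph0 !scale0r. Qed.

Lemma cstarN a : cstar (- a) = - cstar a.
Proof. by rewrite -scaleN1r cstarZ rmorphN1 scaleN1r. Qed.

Lemma nrmM a b : nrm (cmul a b) <= nrm a * nrm b.
Proof. by rewrite -lecR rmorphM/= !nrmE cnormM. Qed.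

Lemma nrm_starM a : nrm (cmul (cstar a) a) = nrm a ^+ 2.
Proof. by apply: (@complexI R); rewrite rmorphXn nrmE cnorm_star -nrmE. Qed.

Lemma nrm_star a : nrm (cstar a) = nrm a.
Proof.
suff H b : nrm b <= nrm (cstar b).
  by apply/eqP; rewrite eq_le H -{2}(cstarK a) H.
have := nrm_starM b; have := nrmM (cstar b) b.
have := nrm_ge0 b; have := nrm_ge0 (cstar b).
move=> s0; rewrite le_eqVlt => /orP[/eqP <-//|b0] H1 H2.
by rewrite -(ler_pM2r b0) -expr2 -H2.
Qed.

Lemma nrm_Mstar a : nrm (cmul a (cstar a)) = nrm a ^+ 2.
Proof. by rewrite -{1}(cstarK a) nrm_starM nrm_star. Qed.

End CstarBasics.

Section HilbertBasics.
Variables (R : realType) (A : cstarAlgType R) (X : hilbertModType A).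
Implicit Types (x y z : X) (a b : A).

Local Notation "<< x , y >>" := (inner x y : A).

Lemma inner0r x : << x, 0 >> = 0.
Proof. by have := innerZr 0 x 0; rewrite !scale0r. Qed.

Lemma innerNr x y : << x, - y >> = - << x, y >>.
Proof. by rewrite -scaleN1r innerZr scaleN1r. Qed.

Lemma innerBr x y z : << x, y - z >> = << x, y >> - << x, z >>.
Proof. by rewrite innerDr innerNr. Qed.

Lemma innerDl x y z : << x + y, z >> = << x, z >> + << y, z >>.
Proof. by rewrite -[LHS]inner_star innerDr cstarD !inner_star. Qed.

Lemma innerZl (k : R[i]) x y : << k *: x, y >> = (k^*)%R *: << x, y >>.
Proof. by rewrite -[LHS]inner_star innerZr cstarZ inner_star. Qed.

Lemma innerRl (r : R) x y : << r%:C *: x, y >> = r%:C *: << x, y >>.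
Proof. by rewrite innerZl; congr (_ *: _); apply/CrealP; rewrite complex_real. Qed.

Lemma inner0l x : << 0, x >> = 0.
Proof. by rewrite -inner_star inner0r cstar0. Qed.

Lemma innerNl x y : << - x, y >> = - << x, y >>.
Proof. by rewrite -[LHS]inner_star innerNr cstarN inner_star. Qed.

Lemma innerBl x y z : << x - y, z >> = << x, z >> - << y, z >>.
Proof. by rewrite innerDl innerNl. Qed.

Lemma inner_hactl x y a : << hact x a, y >> = cmul (cstar a) << x, y >>.
Proof. by rewrite -[LHS]inner_star inner_hact cstarM inner_star. Qed.

Lemma nrm_inner x : nrm << x, x >> = nrm x ^+ 2.
Proof. by apply: (@complexI R); rewrite rmorphXn nrmE -hnormE -nrmE. Qed.

Lemma inner_inj x y : (forall z, << z, x >> = << z, y >>) -> x = y.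
Proof.
move=> H; apply/eqP; rewrite -subr_eq0; apply/eqP/nrm_eq0/eqP.
by rewrite -sqrf_eq0 -nrm_inner innerBr H subrr nrm0.
Qed.

Lemma hact0l a : hact (0 : X) a = 0.
Proof. by have := hactZl 0 (0 : X) a; rewrite !scale0r. Qed.

Lemma hact0r x : hact x 0 = 0.
Proof. by have := hactZr 0 x 0; rewrite !scale0r. Qed.

Lemma hactNl x a : hact (- x) a = - hact x a.
Proof. by rewrite -scaleN1r hactZl scaleN1r. Qed.

Lemma hactNr x a : hact x (- a) = - hact x a.
Proof. by rewrite -scaleN1r hactZr scaleN1r. Qed.

Lemma hactBl x y a : hact (x - y) a = hact x a - hact y a.
Proof. by rewrite hactDl hactNl. Qed.

Lemma nrm_hact x a : nrm (hact x a) <= nrm x * nrm a.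
Proof.
rewrite -(ler_pXn2r (ltn0Sn 1)) ?nnegrE ?mulr_ge0 ?nrm_ge0//.
rewrite -nrm_inner inner_hactl inner_hact exprMn.
apply: le_trans (nrmM _ _) _; rewrite nrm_star.
have := nrmM << x, x >> a; rewrite nrm_inner.
have := nrm_ge0 a; nra.
Qed.

End HilbertBasics.

Notation "<< x , y >>" := (inner x y) : ring_scope.

(** * The star-algebra of adjointable operators *)

Section Operators.
Variables (R : realType) (A : cstarAlgType R) (X : hilbertModType A).
Implicit Types (x y z : X).

Definition is_adj (f g : X -> X) := forall x y, << f x, y >> = << x, g y >> :> A.
Definition bdf (f : X -> X) (M : R) := forall x, nrm (f x) <= M * nrm x.

Lemma is_adjC f g : is_adj f g -> is_adj g f.
Proof. by move=> fg x y; rewrite -[LHS]inner_star -fg inner_star. Qed.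

Lemma is_adj_uniq f g g' : is_adj f g -> is_adj f g' -> g = g'.
Proof. by move=> H H'; apply/funext => y; apply: inner_inj => z; rewrite -H H'. Qed.

Lemma bdf_le f M M' : M <= M' -> bdf f M -> bdf f M'.
Proof. by move=> MM' H x; apply: le_trans (H x) _; rewrite ler_wpM2r// nrm_ge0. Qed.

(** Linearity is a consequence of having an adjoint ([lopD], [lopZ], [lop_hact]). A bound for the
    adjoint is included because the Cauchy-Schwarz inequality, which yields [bd_star], comes only
    later. The adjoint is existential, so that operators are equal as soon as they are equal as
    functions. *)
Record lop := Lop { lfun :> X -> X;
  lopP : exists g M, [/\ is_adj lfun g, bdf lfun M & bdf g M] }.

HB.instance Definition _ := gen_eqMixin lop.
HB.instance Definition _ := gen_choiceMixin lop.

Implicit Types S T U : lop.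

Lemma lop_eq S T : (forall x, S x = T x) -> S = T.
Proof.
case: S T => [f Hf] [g Hg] /= /funext fg; case: _ / fg Hg => Hg.
by congr Lop; exact: Prop_irrelevance.
Qed.

Definition starf T : X -> X := projT1 (cid (lopP T)).

Lemma starfP T : is_adj T (starf T).
Proof. by rewrite /starf; case: cid => g /= [M []]. Qed.

Lemma bdf_both f g M M' : is_adj f g -> bdf f M -> bdf g M' ->
  exists g M, [/\ is_adj f g, bdf f M & bdf g M].
Proof.
move=> fg fM gM; exists g, (Num.max M M'); split=> //.
  by apply: bdf_le fM; rewrite le_max lexx.
by apply: bdf_le gM; rewrite le_max lexx orbT.
Qed.

Lemma starf_bd T : exists g M, [/\ is_adj (starf T) g, bdf (starf T) M & bdf g M].
Proof.
rewrite /starf; case: cid => g /= [M [Tg TM gM]].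
by exists T, M; split=> //; exact: is_adjC.
Qed.

Definition star T := Lop (starf_bd T).

Lemma starP T x y : << T x, y >> = << x, star T y >> :> A.
Proof. exact: starfP. Qed.

Lemma starP' T x y : << x, T y >> = << star T x, y >> :> A.
Proof. by rewrite -inner_star starP inner_star. Qed.

Lemma star_uniq T S : is_adj T S -> star T = S.
Proof. by move=> H; apply: lop_eq => x; rewrite (is_adj_uniq H (@starfP T)). Qed.

Lemma starK T : star (star T) = T.
Proof. by apply: star_uniq => x y; rewrite starP'. Qed.

Lemma lopD T x y : T (x + y) = T x + T y.
Proof. by apply: inner_inj => z; rewrite !(innerDr, starP'). Qed.

Lemma lopZ T (k : R[i]) x : T (k *: x) = k *: T x.
Proof. by apply: inner_inj => z; rewrite !(innerZr, starP'). Qed.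

Lemma lop_hact T x a : T (hact x a) = hact (T x) a.
Proof. by apply: inner_inj => z; rewrite starP' !inner_hact -starP'. Qed.

Lemma lop0x T : T 0 = 0.
Proof. by have := lopZ T 0 0; rewrite !scale0r. Qed.

Lemma lopN T x : T (- x) = - T x.
Proof. by rewrite -scaleN1r lopZ scaleN1r. Qed.

Lemma lopB T x y : T (x - y) = T x - T y.
Proof. by rewrite lopD lopN. Qed.

Lemma lop_bd T : exists2 M, 0 <= M & bdf T M.
Proof.
case: (lopP T) => g [M [_ H _]]; exists (Num.max M 0); first by rewrite le_max lexx orbT.
by apply: bdf_le H; rewrite le_max lexx.
Qed.

Lemma mk_lop f g M M' : is_adj f g -> bdf f M -> bdf g M' -> exists T : lop, T = f :> (X -> X).
Proof.
by move=> fg fM gM; exists (Lop (bdf_both fg fM gM)).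
Qed.

Fact lop0_subproof : exists g M, [/\ is_adj (fun=> 0) g, bdf (fun=> 0) M & bdf g M].
Proof.
exists (fun=> 0), 0; split=> [x y|x|x]; rewrite ?inner0l ?inner0r//.
all: by rewrite mul0r nrm0.
Qed.
Definition lop0 := Lop lop0_subproof.

Fact lop1_subproof : exists g M, [/\ is_adj id g, bdf id M & bdf g M].
Proof. by exists id, 1; split=> [x y|x|x]; rewrite ?mul1r. Qed.
Definition lop1 := Lop lop1_subproof.

Lemma bdfD f g M N : bdf f M -> bdf g N -> bdf (fun x => f x + g x) (M + N).
Proof.
move=> fM gN x; rewrite mulrDl; apply: le_trans (nrmD _ _) _.
by apply: lerD; [apply: fM | apply: gN].
Qed.

Lemma bdfN f M : bdf f M -> bdf (fun x => - f x) M.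
Proof. by move=> fM x; rewrite nrmN. Qed.

Lemma bdfM f g M N : 0 <= M -> bdf f M -> bdf g N -> bdf (fun x => f (g x)) (M * N).
Proof.
move=> M0 fM gN x; apply: le_trans (fM _) _.
by rewrite -mulrA ler_wpM2l.
Qed.

Lemma bdfZ (k : R[i]) f M : bdf f M -> bdf (fun x => k *: f x) (complex.Re `|k| * M).
Proof.
move=> fM x; rewrite nrmZc -mulrA ler_wpM2l// -ler0c RRe_real//; exact: ger0_real.
Qed.

Fact lopD_subproof S T :
  exists g M, [/\ is_adj (fun x => S x + T x) g, bdf (fun x => S x + T x) M & bdf g M].
Proof.
have [M _ HM] := lop_bd S; have [N _ HN] := lop_bd T.
have [M' _ HM'] := lop_bd (star S); have [N' _ HN'] := lop_bd (star T).
apply: (bdf_both _ (bdfD HM HN) (bdfD HM' HN')) => x y.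
by rewrite innerDl innerDr !starP.
Qed.
Definition ladd S T := Lop (lopD_subproof S T).

Fact lopN_subproof T :
  exists g M, [/\ is_adj (fun x => - T x) g, bdf (fun x => - T x) M & bdf g M].
Proof.
have [M _ HM] := lop_bd T; have [M' _ HM'] := lop_bd (star T).
apply: (bdf_both _ (bdfN HM) (bdfN HM')) => x y.
by rewrite innerNl innerNr !starP.
Qed.
Definition lopp T := Lop (lopN_subproof T).

Fact lopM_subproof S T :
  exists g M, [/\ is_adj (fun x => S (T x)) g, bdf (fun x => S (T x)) M & bdf g M].
Proof.
have [M M0 HM] := lop_bd S; have [N N0 HN] := lop_bd T.
have [M' M0' HM'] := lop_bd (star S); have [N' N0' HN'] := lop_bd (star T).
apply: (bdf_both _ (bdfM M0 HM HN) (bdfM N0' HN' HM')) => x y.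
by rewrite !starP.
Qed.
Definition lmul S T := Lop (lopM_subproof S T).

Fact lopZ_subproof k T :
  exists g M, [/\ is_adj (fun x => k *: T x) g, bdf (fun x => k *: T x) M & bdf g M].
Proof.
have [M _ HM] := lop_bd T; have [M' _ HM'] := lop_bd (star T).
apply: (bdf_both _ (bdfZ k HM) (bdfZ (k^*)%R HM')) => x y.
by rewrite innerZl innerZr !starP.
Qed.
Definition lscale k T := Lop (lopZ_subproof k T).

Fact laddA : associative ladd.
Proof. by move=> S T U; apply: lop_eq => x /=; rewrite addrA. Qed.
Fact laddC : commutative ladd.
Proof. by move=> S T; apply: lop_eq => x /=; rewrite addrC. Qed.
Fact ladd0 : left_id lop0 ladd.
Proof. by move=> S; apply: lop_eq => x /=; rewrite add0r. Qed.
Fact laddN : left_inverse lop0 lopp ladd.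
Proof. by move=> S; apply: lop_eq => x /=; rewrite addNr. Qed.
HB.instance Definition _ := GRing.isZmodule.Build lop laddA laddC ladd0 laddN.

Fact lmulA : associative lmul. Proof. by move=> S T U; apply: lop_eq. Qed.
Fact lmul1l : left_id lop1 lmul. Proof. by move=> S; apply: lop_eq. Qed.
Fact lmul1r : right_id lop1 lmul. Proof. by move=> S; apply: lop_eq. Qed.
Fact lmulDl : left_distributive lmul +%R.
Proof. by move=> S T U; apply: lop_eq. Qed.
Fact lmulDr : right_distributive lmul +%R.
Proof. by move=> S T U; apply: lop_eq => x /=; rewrite lopD. Qed.
HB.instance Definition _ :=
  GRing.Zmodule_isPzRing.Build lop lmulA lmul1l lmul1r lmulDl lmulDr.

Fact lscaleA a b T : lscale a (lscale b T) = lscale (a * b) T.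
Proof. by apply: lop_eq => x /=; rewrite scalerA. Qed.
Fact lscale1 : left_id 1 lscale.
Proof. by move=> T; apply: lop_eq => x /=; rewrite scale1r. Qed.
Fact lscaleDr : right_distributive lscale +%R.
Proof. by move=> k S T; apply: lop_eq => x /=; rewrite scalerDr. Qed.
Fact lscaleDl T : {morph lscale^~ T : a b / a + b}.
Proof. by move=> a b; apply: lop_eq => x /=; rewrite scalerDl. Qed.
HB.instance Definition _ := GRing.Zmodule_isLmodule.Build R[i] lop
  lscaleA lscale1 lscaleDr lscaleDl.

Lemma lopDE S T x : (S + T) x = S x + T x. Proof. by []. Qed.
Lemma lopNE T x : (- T) x = - T x. Proof. by []. Qed.
Lemma lopBE S T x : (S - T) x = S x - T x. Proof. by []. Qed.
Lemma lopME S T x : (S * T) x = S (T x). Proof. by []. Qed.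
Lemma lopZE (k : R[i]) T x : (k *: T) x = k *: T x. Proof. by []. Qed.
Lemma lop1E x : (1 : lop) x = x. Proof. by []. Qed.
Lemma lop0E x : (0 : lop) x = 0. Proof. by []. Qed.
Definition lopE := (lopDE, lopNE, lopME, lopZE, lop1E, lop0E).

Lemma lscalAl (k : R[i]) S T : (k *: S) * T = k *: (S * T).
Proof. by apply: lop_eq. Qed.
Lemma lscalAr (k : R[i]) S T : S * (k *: T) = k *: (S * T).
Proof. by apply: lop_eq => x; rewrite !lopE lopZ. Qed.

Lemma starD S T : star (S + T) = star S + star T.
Proof. by apply: star_uniq => x y; rewrite !lopE innerDl innerDr !starP. Qed.
Lemma starN T : star (- T) = - star T.
Proof. by apply: star_uniq => x y; rewrite !lopE innerNl innerNr !starP. Qed.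
Lemma starB S T : star (S - T) = star S - star T.
Proof. by rewrite starD starN. Qed.
Lemma starM S T : star (S * T) = star T * star S.
Proof. by apply: star_uniq => x y; rewrite !lopE !starP. Qed.
Lemma starZ (k : R[i]) T : star (k *: T) = (k^*)%R *: star T.
Proof. by apply: star_uniq => x y; rewrite !lopE innerZl innerZr !starP. Qed.
Lemma starR (r : R) T : star (r%:C *: T) = r%:C *: star T.
Proof. by apply: star_uniq => x y; rewrite !lopE innerRl innerZr !starP. Qed.
Lemma star1 : star 1 = 1. Proof. by apply: star_uniq. Qed.
Lemma star0 : star 0 = 0.
Proof. by apply: star_uniq => x y; rewrite !lopE inner0l inner0r. Qed.

Definition bd T (M : R) := bdf T M.

Lemma bd_le T M M' : M <= M' -> bd T M -> bd T M'.
Proof. exact: bdf_le. Qed.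
Lemma bdD S T M N : bd S M -> bd T N -> bd (S + T) (M + N).
Proof. exact: bdfD. Qed.
Lemma bdN T M : bd T M -> bd (- T) M.
Proof. exact: bdfN. Qed.
Lemma bdB S T M N : bd S M -> bd T N -> bd (S - T) (M + N).
Proof. by move=> SM /bdN; exact: bdD. Qed.
Lemma bdC S T M : bd (S - T) M -> bd (T - S) M.
Proof. by move=> /bdN; rewrite opprB. Qed.
Lemma bdM S T M N : 0 <= M -> bd S M -> bd T N -> bd (S * T) (M * N).
Proof. exact: bdfM. Qed.
Lemma bdR (r : R) T M : 0 <= r -> bd T M -> bd (r%:C *: T) (r * M).
Proof. by move=> r0 TM x; rewrite lopE nrmZp// -mulrA ler_wpM2l. Qed.
Lemma bd1 : bd 1 1.
Proof. by move=> x; rewrite mul1r. Qed.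
Lemma bd0 M : 0 <= M -> bd 0 M.
Proof. by move=> M0 x; rewrite lopE nrm0 mulr_ge0// nrm_ge0. Qed.

Lemma bd_eq0 T : bd T 0 -> T = 0.
Proof. by move=> H; apply: lop_eq => x; apply: nrm_le0; rewrite (le_trans (H x))// mul0r. Qed.

Lemma star_starM0 T : star T * T = 0 -> T = 0.
Proof.
move=> T0; apply: lop_eq => x; apply: nrm_eq0; apply/eqP.
by rewrite -sqrf_eq0 -nrm_inner starP -lopME T0 lopE inner0r nrm0.
Qed.

Lemma nrm_isom T : star T * T = 1 -> forall x, nrm (T x) = nrm x.
Proof.
move=> T1 x; apply/eqP; rewrite -(eqrXn2 (ltn0Sn 1)) ?nrm_ge0//.
by rewrite -!nrm_inner starP -lopME T1.
Qed.

End Operators.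

Arguments bd {R A X}.

Section InnerBound.
Variables (R : realType) (A : cstarAlgType R) (X : hilbertModType A).
Implicit Types (x y z : X).

Lemma nrm_polar x y : nrm (<< x, y >> + << y, x >> : A) <=
  2 * nrm x ^+ 2 + 2 * nrm y ^+ 2 + 2 * nrm x * nrm y.
Proof.
have -> : << x, y >> + << y, x >> = << x + y, x + y >> - << x, x >> - << y, y >> :> A.
  rewrite innerDl !innerDr -[LHS](addKr (<< x, x >> + << y, y >>)) addrC -[RHS]addrA -opprD.
  by congr (_ - _); rewrite -!addrA; congr (_ + _); rewrite [LHS]addrC -!addrA.
apply: le_trans (nrmB _ _) _.
have := nrmB (<< x + y, x + y >> : A) << x, x >>.
by rewrite !nrm_inner; have := nrmD x y; have := nrm_ge0 (x + y); nra.
Qed.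

Lemma nrm_i (V : completeNormedModType R[i]) (v : V) : nrm ('i%C *: v) = nrm v.
Proof. by rewrite nrmZc normc_def/= expr0n/= expr1n add0r sqrtr1 mul1r. Qed.

Lemma inner_ix x y : << 'i%C *: x, y >> + << y, 'i%C *: x >> =
  'i%C *: (<< y, x >> - << x, y >>) :> A.
Proof.
rewrite innerZl innerZr scalerBr [RHS]addrC -scaleNr; congr (_ *: _ + _).
by rewrite complexiE conjCi.
Qed.

(* A crude bound by polarization: the constant 1 needs positivity, see
   [inner_cs]. *)
Lemma inner_bd6 x y : nrm (<< x, y >> : A) <= 6 * nrm x * nrm y.
Proof.
(* On the unit ball, the sum and the difference of [<<u, v>>] and [<<v, u>>] both have norm at most
   2 + 2 + 2, and [<<u, v>>] is half of their sum. *)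
have H1 (u v : X) : nrm u <= 1 -> nrm v <= 1 -> nrm (<< u, v >> : A) <= 6.
  move=> u1 v1; have u0 := nrm_ge0 u; have v0 := nrm_ge0 v.
  have := nrm_polar u v; have := nrm_polar ('i%C *: u) v.
  rewrite inner_ix !nrm_i (nrmC << v, u >>) => H2 H3.
  have := nrmD (<< u, v >> + << v, u >> : A) (<< u, v >> - << v, u >>).
  rewrite addrACA subrr addr0.
  have -> : << u, v >> + << u, v >> = (2 : R)%:C *: << u, v >> :> A.
    by rewrite -mulr2n -scaler_nat; congr (_ *: _); rewrite -[LHS](rmorphMn (real_complex R)).
  rewrite nrmZp//; nra.
have [/nrm_eq0->|x0] := eqVneq (nrm x) 0; first by rewrite inner0l !nrm0 mulr0 mul0r.
have [/nrm_eq0->|y0] := eqVneq (nrm y) 0; first by rewrite inner0r !nrm0 mulr0.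
have xp : 0 < nrm x by rewrite lt_def x0 nrm_ge0.
have yp : 0 < nrm y by rewrite lt_def y0 nrm_ge0.
have /= := H1 ((nrm x)^-1%:C *: x) ((nrm y)^-1%:C *: y).
rewrite innerRl innerZr !nrmZp ?invr_ge0 ?nrm_ge0 ?mulVf// => /(_ (lexx _) (lexx _)).
by rewrite !ler_pdivrMl// => /le_trans; apply; rewrite le_eqVlt; apply/orP; left; apply/eqP; ring.
Qed.

Lemma tends_innerl (u : nat -> X) x y : tends u x -> tends (fun n => << u n, y >> : A) << x, y >>.
Proof.
apply: (@tends_lip _ _ _ (fun x => << x, y >> : A) (6 * nrm y)).
  by rewrite mulr_ge0// nrm_ge0.
by move=> z; rewrite -innerBl; apply: le_trans (inner_bd6 _ _) _; rewrite mulrAC.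
Qed.

Lemma tends_innerr (u : nat -> X) x y : tends u x -> tends (fun n => << y, u n >> : A) << y, x >>.
Proof.
apply: (@tends_lip _ _ _ (fun x => << y, x >> : A) (6 * nrm y)).
  by rewrite mulr_ge0// nrm_ge0.
by move=> z; rewrite -innerBr; exact: inner_bd6.
Qed.

End InnerBound.

Lemma ndseq_cauchy (R : realType) (r : nat -> R) c :
  (forall n, r n <= r n.+1) -> (forall n, r n <= c) ->
  forall e, 0 < e -> exists N, forall m n, (N <= m)%N -> (m <= n)%N -> r n - r m <= e.
Proof.
move=> ri rc e e0.
have rmono m n : (m <= n)%N -> r m <= r n.
  by move=> /subnK <-; elim: (n - m)%N => // k IH; apply: le_trans IH (ri _).
have hs : has_sup (range r).
  split; first by exists (r 0%N), 0%N.
  by exists c => _ [n _ <-].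
have [_ [N _ <-] HN] := sup_adherent e0 hs.
exists N => m n Nm mn.
have : r n <= sup (range r) by apply: ub_le_sup; [case: hs|exists n].
by have := rmono _ _ Nm; lra.
Qed.

Section Limits.
Variables (R : realType) (A : cstarAlgType R) (X : hilbertModType A).
Implicit Types (S T U : lop X).

Definition ltends (T : nat -> lop X) U := forall e : R, 0 < e ->
  exists N, forall n, (N <= n)%N -> bd (T n - U) e.

Lemma ltends_pt (T : nat -> lop X) U x : ltends T U -> tends (fun n => T n x) (U x).
Proof.
move=> TU e e0.
have [|N HN] := TU (e / (nrm x + 1)).
  by rewrite divr_gt0//; have := nrm_ge0 x; lra.
exists N => n /HN /(_ x); rewrite !lopE => /le_trans; apply.
by have := nrm_ge0 x => n0; rewrite mulrAC ler_pdivrMr; nra.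
Qed.

(** Telescoping majorizes [T n - T m] by [r n - r m], and [r] converges. The adjoints are controlled
    separately because their limit has to serve as the adjoint of [U]. *)
Lemma lop_lim (T : nat -> lop X) (r : nat -> R) c :
  (forall n, r n <= r n.+1) -> (forall n, r n <= c) ->
  (forall n, bd (T n.+1 - T n) (r n.+1 - r n)) ->
  (forall n, bd (star (T n.+1) - star (T n)) (r n.+1 - r n)) ->
  exists U, ltends T U /\ ltends (fun n => star (T n)) (star U).
Proof.
move=> ri rc HT HTs.
have rcau := ndseq_cauchy ri rc.
have tele (S : nat -> lop X) : (forall n, bd (S n.+1 - S n) (r n.+1 - r n)) ->
    forall m n, (m <= n)%N -> bd (S n - S m) (r n - r m).
  move=> HS m n /subnK <-; elim: (n - m)%N => [|k IH].
    by rewrite !add0n !subrr; exact: bd0.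
  rewrite addSn -(subrKA (S (k + m)%N)) -(subrKA (r (k + m)%N)).
  exact: bdD.
have lim (S : nat -> lop X) : (forall n, bd (S n.+1 - S n) (r n.+1 - r n)) ->
    exists f : X -> X, forall e, 0 < e -> exists N, forall n, (N <= n)%N ->
      bdf (fun x => S n x - f x) e.
  move=> HS.
  have cx x : exists y, tends (fun n => S n x) y.
    apply: tends_cauchy => e e0; have nx := nrm_ge0 x.
    have [|N HN] := rcau (e / (nrm x + 1)); first by rewrite divr_gt0//; lra.
    exists N => m n Nm Nn.
    wlog mn : m n Nm Nn / (m <= n)%N.
      move=> W; case/orP: (leq_total m n) => [/W|/W]; first exact.
      by rewrite nrmC; apply.
    rewrite nrmC -lopNE -lopDE; apply: le_trans (tele _ HS _ _ mn x) _.
    apply: le_trans (_ : e / (nrm x + 1) * nrm x <= _); first by rewrite ler_wpM2r// HN.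
    by rewrite mulrAC ler_pdivrMr; nra.
  have [f Hf] := choice cx.
  exists f => e e0; have [N HN] := rcau e e0.
  exists N => n Nn x; rewrite nrmC.
  have tt : tends (fun k => S k x - S n x) (f x - S n x).
    by apply: tendsD (Hf x) _; exact: tends_cst.
  apply: (tends_le tt (N := n)) => k nk.
  apply: le_trans (tele _ HS _ _ nk x) _.
  by rewrite ler_wpM2r ?nrm_ge0// HN.
have [f Hf] := lim _ HT; have [g Hg] := lim _ HTs.
have pt (S : nat -> X -> X) (h : X -> X) : (forall e, 0 < e -> exists N, forall n, (N <= n)%N ->
      bdf (fun x => S n x - h x) e) -> forall x, tends (fun n => S n x) (h x).
  move=> H x e e0; have nx := nrm_ge0 x.
  have [|N HN] := H (e / (nrm x + 1)); first by rewrite divr_gt0//; lra.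
  exists N => n /HN /(_ x) /le_trans; apply.
  by rewrite mulrAC ler_pdivrMr; nra.
have adjfg : is_adj f g.
  move=> x y; apply: (@tends_uniq _ _ (fun n => << T n x, y >> : A)).
    exact/tends_innerl/(pt (fun n => T n) f Hf).
  have -> : (fun n => << T n x, y >> : A) = (fun n => << x, star (T n) y >>).
    by apply/funext => n; rewrite starP.
  exact/tends_innerr/(pt (fun n => star (T n)) g Hg).
have bdl (S : nat -> lop X) h : (forall e, 0 < e -> exists N, forall n, (N <= n)%N ->
    bdf (fun x => S n x - h x) e) -> exists M, bdf h M.
  move=> H; have [|N HN] := H 1; first by [].
  have [M M0 HM] := lop_bd (S N); exists (M + 1) => x.
  have := nrm_tri (h x) (S N x) 0; rewrite !subr0 nrmC.
  by have := HM x; have := HN N (leqnn N) x; lra.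
have [M HM] := bdl _ _ Hf; have [M' HM'] := bdl _ _ Hg.
pose U := Lop (bdf_both adjfg HM HM').
have sU : star U = g :> (X -> X) by apply: is_adj_uniq (@starfP _ _ _ U) adjfg.
exists U; split=> e e0; first exact: Hf.
have [N HN] := Hg e e0; exists N => n Nn x; rewrite !lopE sU; exact: HN.
Qed.

End Limits.

(** * Square roots and positive operators *)

Section RealScalars.
Variables (R : realType) (V : lmodType R[i]).
Implicit Types (s t : R) (u : V).

Lemma realCD s t u : (s + t)%:C *: u = s%:C *: u + t%:C *: u.
Proof. by rewrite rmorphD scalerDl. Qed.

Lemma realCM s t u : s%:C *: (t%:C *: u) = (s * t)%:C *: u.
Proof. by rewrite rmorphM scalerA. Qed.

Lemma real1 u : (1 : R)%:C *: u = u.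
Proof. exact: scale1r. Qed.

Lemma real0 u : (0 : R)%:C *: u = 0.
Proof. exact: scale0r. Qed.

Lemma real2 u : (2 : R)%:C *: u = u + u.
Proof. by rewrite -[2]/(1 + 1) realCD real1. Qed.

Lemma half2 u : (2^-1 : R)%:C *: (u + u) = u.
Proof. by rewrite -real2 realCM mulVf ?pnatr_eq0// real1. Qed.

End RealScalars.

Section LimitOps.
Variables (R : realType) (A : cstarAlgType R) (X : hilbertModType A).
Implicit Types (S T U V : lop X) (F G : nat -> lop X).

Lemma ltends_cst U : ltends (fun=> U) U.
Proof. by move=> e e0; exists 0%N => n _; rewrite subrr; apply/bd0/ltW. Qed.

Lemma ltends_uniq F U V : ltends F U -> ltends F V -> U = V.
Proof.
move=> FU FV; apply: lop_eq => x.
exact: tends_uniq (ltends_pt x FU) (ltends_pt x FV).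
Qed.

Lemma ltends_shift F U : ltends F U -> ltends (fun n => F n.+1) U.
Proof. by move=> FU e /FU[N HN]; exists N => n Nn; apply/HN/leqW. Qed.

Lemma ltendsD F G U V : ltends F U -> ltends G V -> ltends (fun n => F n + G n) (U + V).
Proof.
move=> FU GV e e0; have e2 : 0 < e / 2 by lra.
have [N HN] := FU _ e2; have [M HM] := GV _ e2.
exists (maxn N M) => n; rewrite geq_max => /andP[/HN H /HM H'].
by rewrite opprD addrACA [e]splitr; exact: bdD.
Qed.

Lemma ltendsM F G U V : ltends F U -> ltends G V -> ltends (fun n => F n * G n) (U * V).
Proof.
move=> FU GV e e0; have [a a0 Ua] := lop_bd U; have [b b0 Vb] := lop_bd V.
pose d := Num.min 1 (e / (1 + a + b)).
have d0 : 0 < d by rewrite lt_min ltr01 divr_gt0//; lra.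
have d1 : d <= 1 by rewrite ge_min lexx.
have de : d * (1 + a + b) <= e.
  by rewrite -ler_pdivlMr ?ge_min ?lexx ?orbT//; lra.
have [N HN] := FU _ d0; have [M HM] := GV _ d0.
exists (maxn N M) => n; rewrite geq_max => /andP[/HN H /HM H'].
have -> : F n * G n - U * V = (F n - U) * (G n - V) + ((F n - U) * V + U * (G n - V)).
  by rewrite mulrBr addrA subrK mulrBl mulrBr addrA subrK.
apply: bd_le (bdD (bdM (ltW d0) H H') (bdD (bdM (ltW d0) H Vb) (bdM a0 Ua H'))).
by apply: le_trans de; nra.
Qed.

Lemma ltendsZ (k : R[i]) F U : ltends F U -> ltends (fun n => k *: F n) (k *: U).
Proof.
move=> /(ltendsM (ltends_cst (k *: (1 : lop X)))); rewrite lscalAl mul1r.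
by under eq_fun do rewrite lscalAl mul1r.
Qed.

Lemma ltends_bd F U M : ltends F U -> (forall n, bd (F n) M) -> bd U M.
Proof. by move=> FU FM x; apply: (tends_le (N := 0) (ltends_pt x FU)) => n _; exact: FM. Qed.

End LimitOps.

Section Positive.
Variables (R : realType) (A : cstarAlgType R) (X : hilbertModType A).
Implicit Types (S T U V h : lop X) (s t : R).

(** For self-adjoint [T] this says that the spectrum of [T] lies in [[0, 2t]]. In this form
    positivity passes to sums and to norm limits at once. *)
Definition pos t T := [/\ star T = T, 0 < t & bd (t%:C *: (1 : lop X) - T) t].

Lemma pos_le s t T : s <= t -> pos s T -> pos t T.
Proof.
move=> st [Ts s0 H]; split=> //; first exact: lt_le_trans st.
rewrite -[t](subrK s) [in X in bd X]realCD -addrA.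
apply: bdD => //; rewrite -[X in bd _ X]mulr1; apply: bdR (@bd1 _ _ _).
by rewrite subr_ge0.
Qed.

Lemma posD s t S T : pos s S -> pos t T -> pos (s + t) (S + T).
Proof.
move=> [Ss s0 HS] [Ts t0 HT]; split; [by rewrite starD Ss Ts|exact: addr_gt0|].
by rewrite realCD opprD addrACA; exact: bdD.
Qed.

Lemma posZ r t T : 0 < r -> pos t T -> pos (r * t) (r%:C *: T).
Proof.
move=> r0 [Ts t0 HT]; split; [by rewrite starR Ts|exact: mulr_gt0|].
by rewrite -realCM -scalerBr; apply: bdR => //; exact: ltW.
Qed.

Lemma pos0 : pos 1 0.
Proof. by split; rewrite ?star0// subr0 real1; exact: bd1. Qed.

(** The vector [s w + T w] lies within [t * nrm w] of [(s + t) w]. This stands in for the bound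
    [s^-1] on the inverse of [s + T]. *)
Lemma pos_exp s t T w : 0 <= s -> pos t T -> s * nrm w <= nrm (s%:C *: w + T w).
Proof.
move=> s0 [_ t0 /(_ w)]; rewrite !lopE => H.
have := nrm_tri 0 (s%:C *: w + T w) ((s + t)%:C *: w).
rewrite !sub0r !nrmN nrmZp; last by lra.
rewrite rmorphD scalerDl opprD addrACA subrr add0r -[T w - _]opprB nrmN; lra.
Qed.

(* The iterates of [y |-> (h + y^2) / 2], which tend to [1 - sqrt (1 - h)], are
   polynomials in [h] with nonnegative coefficients; the same iteration [sqc] at
   the scalar [h = 1] therefore dominates them. *)
Fixpoint sqy h n : lop X :=
  if n is m.+1 then (2^-1 : R)%:C *: (h + sqy h m * sqy h m) else 0.

Fixpoint sqc n : R := if n is m.+1 then 2^-1 * (1 + sqc m * sqc m) else 0.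

Lemma sqc01 n : 0 <= sqc n <= 1.
Proof. by elim: n => [|n /andP[]] /=; rewrite ?lexx ?ler01// => H H'; apply/andP; split; nra. Qed.

Lemma sqc_le n : sqc n <= sqc n.+1.
Proof. by have /andP[H H'] := sqc01 n; have := sqr_ge0 (1 - sqc n); rewrite /=; nra. Qed.

Lemma sqy_comm h U n : U * h = h * U -> U * sqy h n = sqy h n * U.
Proof.
move=> Uh; elim: n => [|n IH] /=; first by rewrite mul0r mulr0.
rewrite lscalAr lscalAl mulrDl mulrDr Uh; congr (_ *: (_ + _)).
by rewrite mulrA IH -mulrA IH mulrA.
Qed.

Lemma sqy_star h n : star h = h -> star (sqy h n) = sqy h n.
Proof.
by move=> hs; elim: n => [|n IH] /=; rewrite ?star0// starR starD starM IH hs.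
Qed.

Lemma sqy_bd h n : bd h 1 -> bd (sqy h n) (sqc n).
Proof.
move=> h1; elim: n => [|n IH] /=; first exact: bd0.
have /andP[H H'] := sqc01 n.
by apply: bdR; [lra|]; apply: bdD => //; exact: bdM.
Qed.

Lemma sqy_step h n : bd h 1 -> bd (sqy h n.+1 - sqy h n) (sqc n.+1 - sqc n).
Proof.
move=> h1; elim: n => [|n IH].
  rewrite /= !subr0; apply: bdR; first by lra.
  by rewrite !mulr0 !addr0.
(* The iterates commute, so the difference of their squares factors. The scalar iteration factors in
   the same way, and bounds multiply. *)
have -> : sqy h n.+2 - sqy h n.+1 =
    (2^-1 : R)%:C *: ((sqy h n.+1 - sqy h n) * (sqy h n.+1 + sqy h n)).
  rewrite [sqy h n.+2]/= {2}[sqy h n.+1]/= -scalerBr opprD addrACA subrr add0r.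
  rewrite mulrBl !mulrDr (_ : sqy h n.+1 * sqy h n = sqy h n * sqy h n.+1).
    by rewrite opprD addrA addrK.
  by apply/esym/sqy_comm/esym/sqy_comm.
have /andP[H H'] := sqc01 n; have /andP[J J'] := sqc01 n.+1.
have := sqc_le n => L.
have -> : sqc n.+2 - sqc n.+1 = 2^-1 * ((sqc n.+1 - sqc n) * (sqc n.+1 + sqc n)).
  have e2 : sqc n.+2 = 2^-1 * (1 + sqc n.+1 * sqc n.+1) by [].
  have e1 : sqc n.+1 = 2^-1 * (1 + sqc n * sqc n) by [].
  by move: (sqc n.+2) (sqc n.+1) (sqc n) e1 e2 => a b c; lra.
apply: bdR; first by lra.
by apply: bdM => //; [lra|]; apply: bdD; exact: sqy_bd.
Qed.

Lemma sqy_lim h : star h = h -> bd h 1 -> exists Y,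
  [/\ star Y = Y, ltends (sqy h) Y, bd Y 1, Y = (2^-1 : R)%:C *: (h + Y * Y) &
      forall U, U * h = h * U -> U * Y = Y * U].
Proof.
move=> hs h1.
have [||n|n|Y [HY HYs]] := lop_lim (T := sqy h) (r := sqc) (c := 1).
- exact: sqc_le.
- by move=> n; have /andP[] := sqc01 n.
- exact: sqy_step.
- by rewrite !sqy_star//; exact: sqy_step.
exists Y; split=> //.
- apply: ltends_uniq HYs _.
  by rewrite (_ : (fun n => _) = sqy h)//; apply/funext => n; exact: sqy_star.
- apply: ltends_bd HY _ => n; apply: bd_le (sqy_bd n h1).
  by have /andP[] := sqc01 n.
- apply: ltends_uniq (ltends_shift HY) _.
  by apply/ltendsZ/ltendsD; [exact: ltends_cst|exact: ltendsM].
- move=> U Uh; apply: ltends_uniq (ltendsM (ltends_cst U) HY) _.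
  rewrite (_ : (fun n => _) = (fun n => sqy h n * U)); last first.
    by apply/funext => n; exact: sqy_comm.
  exact: ltendsM HY (ltends_cst U).
Qed.

Lemma half_root h Y : Y = (2^-1 : R)%:C *: (h + Y * Y) -> (1 - Y) * (1 - Y) = 1 - h.
Proof.
move=> HY; have : Y + Y = h + Y * Y by rewrite {1 2}HY -scalerDr half2.
rewrite mulrBl !mulrBr !mul1r !mulr1 => /(canLR (addrK _)) <-.
by rewrite !opprD !opprK !addrA.
Qed.

(** [pos t T] says exactly that [h = 1 - T / t] is a contraction. The root is [sqrt t (1 - Y)], and
    its positivity is the bound 1 on [Y]. *)
Lemma pos_sqrt t T : pos t T -> exists S,
  [/\ pos (Num.sqrt t) S, S * S = T & forall U, U * T = T * U -> U * S = S * U].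
Proof.
move=> [Ts t0 HT].
pose h := 1 - t^-1%:C *: T.
have hs : star h = h by rewrite starB star1 starR Ts.
have h1 : bd h 1.
  rewrite (_ : h = t^-1%:C *: (t%:C *: (1 : lop X) - T)); last first.
    by rewrite scalerBr realCM mulVf ?gt_eqF// real1.
  rewrite -[X in bd _ X](@mulVf _ t) ?gt_eqF//; apply: bdR => //.
  by rewrite invr_ge0 ltW.
have [Y [Ys _ Y1 /half_root HY Yc]] := sqy_lim hs h1.
have st : 0 < Num.sqrt t by rewrite sqrtr_gt0.
exists ((Num.sqrt t)%:C *: (1 - Y)); split.
- split=> //; first by rewrite starR starB star1 Ys.
  rewrite -scalerBr opprB addrCA subrr addr0 -[X in bd _ X]mulr1.
  by apply: bdR => //; exact: ltW.
- rewrite lscalAl lscalAr realCM HY -expr2 sqr_sqrtr ?ltW// opprB addrCA subrr addr0.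
  by rewrite realCM mulfV ?gt_eqF// real1.
- move=> U UT; rewrite lscalAl lscalAr mulrBl mulrBr mul1r mulr1 Yc//.
  by rewrite mulrBl mulrBr mul1r mulr1 lscalAl lscalAr UT.
Qed.

(* [T] is the real part of [T + iS], a multiple of a unitary. *)
Lemma bd_sqr_sum S T : star T = T -> star S = S -> S * T = T * S ->
  forall M, 0 <= M -> S * S + T * T = (M ^+ 2)%:C *: (1 : lop X) -> bd T M.
Proof.
move=> Ts Ss ST M M0 H.
have ni : ('i%C : R[i]) * 'i%C = -1 by rewrite -expr2 sqr_i.
pose u := T + 'i%C *: S.
have us : star u = T - 'i%C *: S.
  by rewrite starD Ts starZ Ss; congr (_ + _); rewrite complexiE conjCi scaleNr.
have key v w : v = star w -> v * w = (M ^+ 2)%:C *: (1 : lop X) -> bd w M.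
  move=> -> vw x; rewrite -(ler_pXn2r (ltn0Sn 1)) ?nnegrE ?mulr_ge0 ?nrm_ge0//.
  rewrite -nrm_inner starP -lopME vw !lopE innerZr nrmZp ?sqr_ge0//.
  by rewrite nrm_inner exprMn.
have uu : star u * u = (M ^+ 2)%:C *: (1 : lop X).
  rewrite us /u mulrBl !mulrDr !lscalAl !lscalAr ST scalerA ni scaleN1r -H.
  by rewrite opprD opprK addrA addrK addrC.
have uu' : u * star u = (M ^+ 2)%:C *: (1 : lop X).
  rewrite us /u mulrDl !mulrBr !lscalAl !lscalAr ST scalerA ni scaleN1r opprK -H.
  by rewrite addrA subrK addrC.
have -> : T = (2^-1 : R)%:C *: (u + star u).
  by rewrite us addrACA subrr addr0 half2.
rewrite (_ : M = 2^-1 * (M + M)); last by field.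
apply: bdR => //; first by lra.
by apply: bdD; [exact: key uu|apply: key uu'; rewrite starK].
Qed.

(** The root [1 - Y] of [1 - h^2] commutes with [h], and the squares of the two sum to 1, so
    [bd_sqr_sum] bounds [1 - Y] by 1, and hence its square. This makes squares of self-adjoint
    operators positive. *)
Lemma bd_sqr_sub h : star h = h -> bd h 1 -> bd (1 - h * h) 1.
Proof.
move=> hs h1.
have [||Y [Ys _ _ /half_root HY Yc]] := @sqy_lim (h * h).
- by rewrite starM hs.
- by rewrite -[X in bd _ X]mulr1; exact: bdM.
have hY : h * (1 - Y) = (1 - Y) * h.
  by rewrite mulrBl mulrBr mul1r mulr1 Yc// mulrA.
have Y1 : bd (1 - Y) 1.
  apply: (@bd_sqr_sum h) => //; first by rewrite starB star1 Ys.
  by rewrite HY expr1n real1 addrC subrK.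
by rewrite -HY -[X in bd _ X]mulr1; exact: bdM.
Qed.

Lemma pos_sqr h M : star h = h -> 0 < M -> bd h M -> pos (M ^+ 2) (h * h).
Proof.
move=> hs M0 hM; split; [by rewrite starM hs|exact: exprn_gt0|].
have M1 : M != 0 by rewrite gt_eqF.
have H : bd (1 - (M^-1%:C *: h) * (M^-1%:C *: h)) 1.
  apply: bd_sqr_sub; first by rewrite starR hs.
  by rewrite -[X in bd _ X](mulVf M1); apply: bdR => //; rewrite invr_ge0 ltW.
have -> : (M ^+ 2)%:C *: (1 : lop X) - h * h =
   (M ^+ 2)%:C *: (1 - (M^-1%:C *: h) * (M^-1%:C *: h)).
  rewrite scalerBr lscalAl lscalAr !realCM.
  by rewrite (_ : _ * _ = 1 :> R) ?real1//; field.
by rewrite -[X in bd _ X]mulr1; apply: bdR => //; exact: sqr_ge0.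
Qed.

Definition positive T := exists t, pos t T.

Lemma positive_star T : positive T -> star T = T.
Proof. by case=> t []. Qed.

Lemma positiveD S T : positive S -> positive T -> positive (S + T).
Proof. by move=> [s HS] [t HT]; exists (s + t); exact: posD. Qed.

Lemma positiveZ r T : 0 <= r -> positive T -> positive (r%:C *: T).
Proof.
rewrite le_eqVlt => /orP[/eqP <- _|r0 [t HT]].
  by exists 1; rewrite real0; exact: pos0.
by exists (r * t); exact: posZ.
Qed.

Lemma lop_bdp T : exists2 M, 0 < M & bd T M.
Proof.
have [M M0 H] := lop_bd T; exists (M + 1); first by lra.
by apply: bd_le H; lra.
Qed.

Lemma positive_sqr h : star h = h -> positive (h * h).
Proof. by move=> hs; have [M M0 hM] := lop_bdp h; exists (M ^+ 2); exact: pos_sqr. Qed.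

Lemma positive1 : positive 1.
Proof. by rewrite -[1]mulr1; apply: positive_sqr; rewrite star1. Qed.

Lemma positive_sqrt T : positive T -> exists S,
  [/\ positive S, S * S = T & forall U, U * T = T * U -> U * S = S * U].
Proof. by move=> [t /pos_sqrt[S [H1 H2 H3]]]; exists S; split=> //; exists (Num.sqrt t). Qed.

Lemma positive_exp s T w : 0 <= s -> positive T -> s * nrm w <= nrm (s%:C *: w + T w).
Proof. by move=> s0 [t]; exact: pos_exp. Qed.

(** The roots [S] of [T] and [Q] of [N - T] commute and [S^2 + Q^2 = N], so [bd_sqr_sum] bounds [S]
    by [sqrt N]. *)
Lemma positive_mono T N : 0 <= N -> positive T -> positive (N%:C *: (1 : lop X) - T) -> bd T N.
Proof.
move=> N0 /positive_sqrt[S [/positive_star Ss ST Sc]].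
move=> /positive_sqrt[Q [/positive_star Qs QT Qc]].
have sN := sqrtr_ge0 N.
have : bd S (Num.sqrt N).
  apply: (@bd_sqr_sum Q) => //.
    apply/esym/Qc; rewrite mulrBl mulrBr lscalAl lscalAr mul1r mulr1.
    by rewrite -ST mulrA.
  by rewrite QT ST subrK sqr_sqrtr.
move=> SN; rewrite -ST -[N]sqr_sqrtr// expr2; exact: bdM.
Qed.

Lemma positive_anti T : positive T -> positive (- T) -> T = 0.
Proof.
move=> TP TN; apply: bd_eq0; apply: positive_mono => //.
by rewrite real0 sub0r.
Qed.

End Positive.

(** * Positivity of [star b * b] *)

Section Kaplansky.
Variables (R : realType) (A : cstarAlgType R) (X : hilbertModType A).
Implicit Types (S T U V h b c d : lop X) (s t : R).

Lemma positiveM S T : positive S -> positive T -> S * T = T * S -> positive (S * T).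
Proof.
move=> /positive_sqrt[P [/positive_star Ps PS Pc]].
move=> /positive_sqrt[Q [/positive_star Qs QT Qc]] ST.
have TP : T * P = P * T by apply: Pc.
have PQ : P * Q = Q * P by apply: Qc.
have -> : S * T = (P * Q) * (P * Q).
  by rewrite -PS -QT -!mulrA; congr (_ * _); rewrite !mulrA PQ.
by apply: positive_sqr; rewrite starM Ps Qs PQ.
Qed.

Lemma selfadj_cube0 d : star d = d -> d * d * d = 0 -> d = 0.
Proof.
move=> ds d3; apply: star_starM0; rewrite ds; apply: star_starM0.
by rewrite starM ds mulrA d3 mul0r.
Qed.

Lemma pos_contr t T : pos t T -> bd (1 - t^-1%:C *: T) 1.
Proof.
move=> [_ t0 HT]; rewrite (_ : 1 - _ = t^-1%:C *: (t%:C *: (1 : lop X) - T)).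
  rewrite -[X in bd _ X](@mulVf _ t) ?gt_eqF//; apply: bdR => //.
  by rewrite invr_ge0 ltW.
by rewrite scalerBr realCM mulVf ?gt_eqF// real1.
Qed.

Lemma le_natM0 (u v : R) : (forall n, n%:R * u <= v) -> u <= 0.
Proof.
move=> H; rewrite leNgt; apply/negP => u0.
have v0 : 0 <= v by have := H 0%N; rewrite mul0r.
have := archi_boundP (divr_ge0 v0 (ltW u0)).
by rewrite ltr_pdivrMr// ltNge H.
Qed.

(* Kaplansky's argument: [c c^*] is positive as well, and [c c^* c = - c d^2],
   so [c (1 + d^2/t)^k] stays bounded in [k], which forces [d = 0]. *)
Lemma starM_neg0 c d : star d = d -> star c * c = - (d * d) -> c = 0.
Proof.
move=> ds cd.
have Epos : positive (c * star c).
  (* Up to sign, [u] and [v] are twice the real and imaginary parts of [c], so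
     [c c^* + c^* c = (u^2 + v^2) / 2], where [c^* c = - d^2]. *)
  pose u := c + star c; pose v := 'i%C *: (c - star c).
  have us : star u = u by rewrite starD starK addrC.
  have vs : star v = v.
    rewrite starZ starB starK -opprB scalerN -scaleNr.
    by congr (_ *: _); rewrite complexiE conjCi opprK.
  have -> : c * star c = (2^-1 : R)%:C *: (u * u + v * v) + d * d.
    have -> : v * v = - ((c - star c) * (c - star c)).
      by rewrite lscalAl lscalAr scalerA -expr2 sqr_i scaleN1r.
    have -> : u * u - (c - star c) * (c - star c) =
        (c * star c + c * star c) + (star c * c + star c * c).
      rewrite /u !(mulrDl, mulrDr, mulNr, mulrN, opprK).
      move: (c * c) (c * star c) (star c * c) (star c * star c) => p q r s.
      rewrite [r + s]addrC addrACA [- r + s]addrC [p - q + _]addrACA -opprD opprB.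
      by rewrite [LHS]addrC [p + s + _]addrC addrACA addNr addr0 addrACA.
    by rewrite scalerDr !half2 cd subrK.
  apply: positiveD; last exact: positive_sqr.
  apply: positiveZ; first by rewrite invr_ge0.
  by apply: positiveD; exact: positive_sqr.
have [t Et] := Epos; have t0 : 0 < t by case: Et.
have G1 := pos_contr Et.
pose x := t^-1%:C *: (d * d); pose B := 1 + x.
pose G := 1 - t^-1%:C *: (c * star c).
have Gc k : G ^+ k * c = c * B ^+ k.
  elim: k => [|k IH]; first by rewrite !expr0 mul1r mulr1.
  rewrite exprSr -mulrA (_ : G * c = c * B) ?mulrA ?IH -?mulrA -?exprSr ?exprS//.
  rewrite /G /B mulrBl mul1r mulrDr mulr1 lscalAl lscalAr -mulrA cd mulrN.
  by rewrite scalerN opprK.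
have nc w : nrm (c w) = nrm (d w).
  apply/eqP; rewrite -(eqrXn2 (ltn0Sn 1)) ?nrm_ge0// -!nrm_inner !starP.
  by rewrite -!lopME cd ds lopNE innerNr nrmN.
have Gk k : bd (G ^+ k) 1.
  elim: k => [|k IH]; first by rewrite expr0; exact: bd1.
  by rewrite exprS -[X in bd _ X]mulr1; exact: bdM.
have dB k z : nrm (d ((B ^+ k) z)) <= nrm (d z).
  by rewrite -!nc -lopME -Gc lopME; have := Gk k (c z); rewrite mul1r.
have xpos : positive x.
  by apply: positiveZ; [rewrite invr_ge0 ltW|exact: positive_sqr].
have Bpos k : positive (B ^+ k).
  elim: k => [|k IH]; first by rewrite expr0; exact: positive1.
  rewrite exprS; apply: positiveM => //; last by rewrite -exprS -exprSr.
  by apply: positiveD => //; exact: positive1.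
have xB k : B ^+ k * x = x * B ^+ k.
  apply/esym/commrX; rewrite /GRing.comm /B.
  by rewrite mulrDr mulrDl mulr1 mul1r.
have B1 k : positive (B ^+ k - 1).
  elim: k => [|k IH]; first by rewrite expr0 subrr; exists 1; exact: pos0.
  by rewrite exprSr mulrDr mulr1 addrAC; apply: positiveD => //; exact: positiveM.
have dx : d * B = B * d.
  by rewrite mulrDr mulrDl mulr1 mul1r lscalAl lscalAr mulrA.
have dx0 z : d (x z) = 0.
  apply: nrm_le0; apply: (@le_natM0 _ (2 * nrm (d z))) => n.
  (* [Q] is at least [n], each [B^k - 1] being positive, while the geometric sum collapses:
     [Q (d x) = d B^n - d], of norm at most [2 * nrm (d z)] at [z]. Hence [n * nrm (d (x z))] is
     bounded in [n]. *)
  pose Q := \sum_(k < n) B ^+ k.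
  have [p ppos Qp] : exists2 p, positive p & Q = (n%:R : R)%:C *: (1 : lop X) + p.
    rewrite /Q; elim: (n) => [|m [p pp IH]].
      by exists 0; [exists 1; exact: pos0|rewrite big_ord0 real0 addr0].
    exists (p + (B ^+ m - 1)); first exact: positiveD.
    rewrite big_ord_recr/= IH -natr1 realCD real1 -!addrA; congr (_ + _).
    by rewrite addrCA; congr (_ + _); rewrite addrC subrK.
  have Qx : Q * (d * x) = d * B ^+ n - d.
    have -> : d * x = x * d by rewrite lscalAl lscalAr mulrA.
    have dBn : d * B ^+ n = B ^+ n * d by exact: commrX.
    rewrite dBn mulrA -[X in _ - X]mul1r -mulrBl; congr (_ * _).
    rewrite subrX1; have -> : B - 1 = x by rewrite addrC addKr.
    rewrite mulr_suml mulr_sumr; apply: eq_bigr => i _; exact: xB.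
  rewrite -lopME; apply: le_trans (positive_exp _ (ler0n _ n) ppos) _.
  have -> : (n%:R : R)%:C *: (d * x) z + p ((d * x) z) = (Q * (d * x)) z.
    by rewrite Qp.
  rewrite Qx lopBE; apply: le_trans (nrmB _ _) _.
  by rewrite mulr_natl mulr2n lerD2r dB.
have d3 : d * d * d = 0.
  apply: lop_eq => z; have := dx0 z; rewrite /x lopZE lopZ !lopME.
  by move/eqP; rewrite scaler_eq0 => /orP[|/eqP//]; rewrite eq_complex/= invr_eq0 gt_eqF.
have d0 := selfadj_cube0 ds d3.
by apply: star_starM0; rewrite cd d0 mulr0 oppr0.
Qed.

(** With [H = |a|], the operator [n = H - a] is twice the negative part of [a], and [(b n)^* (b n) =
    n a n = - n H n = - (n K)^2] for [K = sqrt H]. So [starM_neg0] gives [b n = 0], whence [n^3 = 0]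
    and [a = H]. *)
Lemma positive_starM b : positive (star b * b).
Proof.
set a := star b * b.
have as_ : star a = a by rewrite starM starK.
have [H [Hpos HH Hc]] := positive_sqrt (positive_sqr as_).
have Hs := positive_star Hpos.
have aH : a * H = H * a by apply: Hc; rewrite mulrA.
have [K [/positive_star Ks KK Kc]] := positive_sqrt Hpos.
have [n nE] : exists n, n = H - a by exists (H - a).
have ns : star n = n by rewrite nE starB Hs as_.
have nH : n * H = H * n by rewrite nE mulrBl mulrBr aH.
have nK : n * K = K * n by apply: Kc.
have nn : n * n = n * H + n * H.
  have np : n * (H + a) = 0 by rewrite nE mulrBl !mulrDr aH HH [H * a + _]addrC subrr.
  by rewrite -[RHS]subr0 -np -mulrDr -mulrBr opprD addrACA subrr add0r -nE.
have nnn : n * n * n = n * H * n + n * H * n by rewrite nn mulrDl.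
have nan : n * a * n = - (n * H * n).
  have -> : a = H - n by rewrite nE opprB addrC subrK.
  by rewrite mulrBr mulrBl nnn opprD addrA subrr add0r.
have c0 : b * n = 0.
  apply: (@starM_neg0 _ (n * K)); first by rewrite starM ns Ks nK.
  by rewrite starM ns !mulrA -(mulrA n) nan -KK mulrA -[n * K * K * n]mulrA -nK !mulrA.
have n0 : n = 0.
  apply: selfadj_cube0 => //; rewrite nnn -[n * H * n]opprK -nan.
  by rewrite -mulrA -(mulrA (star b)) c0 !mulr0 oppr0 addr0.
by have /eqP := n0; rewrite nE subr_eq0 => /eqP <-.
Qed.

End Kaplansky.

(** * Order and the Cauchy-Schwarz inequality *)

Section Compression.
Variables (R : realType) (A : cstarAlgType R) (X : hilbertModType A).
Implicit Types (S T : lop X).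

Lemma positive_conj S T : positive T -> positive (star S * T * S).
Proof.
move=> /positive_sqrt[Q [/positive_star Qs <- _]].
by rewrite -{1}Qs mulrA -mulrA -starM; exact: positive_starM.
Qed.

Lemma positive_inner T x : positive T -> cpositive (<< x, T x >> : A).
Proof.
move=> /positive_sqrt[Q [/positive_star Qs <- _]].
by rewrite lopME -{1}Qs -starP; exact: inner_ge0.
Qed.

Hypothesis cs : forall x y : X, nrm (<< x, y >> : A) <= nrm x * nrm y.

(** The root [Q] of [T] satisfies [nrm (Q x) ^+ 2 = nrm <<x, T x>>], so it is bounded by [sqrt N].
    Cauchy-Schwarz is kept as a hypothesis: it is immediate in the regular module, whose order then
    proves it for every module. *)
Lemma pos_compl0 T N : 0 < N -> positive T -> bd T N ->
  pos N T /\ pos N (N%:C *: (1 : lop X) - T).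
Proof.
move=> N0 Tp TN; have Ts := positive_star Tp.
have [Q [/positive_star Qs QT _]] := positive_sqrt Tp.
have QN : bd Q (Num.sqrt N).
  move=> x; rewrite -(ler_pXn2r (ltn0Sn 1)) ?nnegrE ?mulr_ge0 ?nrm_ge0 ?sqrtr_ge0//.
  rewrite -nrm_inner starP Qs -lopME QT exprMn (sqr_sqrtr (ltW N0)).
  by apply: le_trans (cs _ _) _; have := TN x; have := nrm_ge0 x; nra.
have TP : pos N T.
  rewrite -QT -[X in pos X _](@sqr_sqrtr _ N) ?ltW//.
  by apply: pos_sqr => //; rewrite sqrtr_gt0.
split=> //; split=> //; first by rewrite starB starR star1 Ts.
by rewrite opprB addrC subrK.
Qed.

End Compression.

(** * The algebra as a Hilbert module over itself *)

Definition reg (R : realType) (A : cstarAlgType R) : Type := A.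

Section Regular.
Variables (R : realType) (A : cstarAlgType R).

HB.instance Definition _ := CompleteNormedModule.copy (reg A) A.

Definition reg_act (x : reg A) (a : A) : reg A := cmul (x : A) a.
Definition reg_inner (x y : reg A) : A := cmul (cstar (x : A)) y.

Fact reg_actDl (x y : reg A) a : reg_act (x + y) a = reg_act x a + reg_act y a.
Proof. exact: (@cmulDl R A). Qed.
Fact reg_actDr (x : reg A) a b : reg_act x (a + b) = reg_act x a + reg_act x b.
Proof. exact: (@cmulDr R A). Qed.
Fact reg_actZl (k : R[i]) (x : reg A) a : reg_act (k *: x) a = k *: reg_act x a.
Proof. exact: (@cmulZl R A). Qed.
Fact reg_actZr (k : R[i]) (x : reg A) a : reg_act x (k *: a) = k *: reg_act x a.
Proof. exact: (@cmulZr R A). Qed.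
Fact reg_actM (x : reg A) a b : reg_act x (cmul a b) = reg_act (reg_act x a) b.
Proof. exact: (@cmulA R A). Qed.
Fact reg_innerDr (x y z : reg A) : reg_inner x (y + z) = reg_inner x y + reg_inner x z.
Proof. exact: (@cmulDr R A). Qed.
Fact reg_innerZr (k : R[i]) (x y : reg A) : reg_inner x (k *: y) = k *: reg_inner x y.
Proof. exact: (@cmulZr R A). Qed.
Fact reg_inner_act (x y : reg A) a : reg_inner x (reg_act y a) = cmul (reg_inner x y) a.
Proof. exact: (@cmulA R A). Qed.
Fact reg_inner_star (x y : reg A) : cstar (reg_inner x y) = reg_inner y x.
Proof. by rewrite /reg_inner cstarM cstarK. Qed.
Fact reg_inner_ge0 (x : reg A) : cpositive (reg_inner x x).
Proof. by exists x. Qed.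
Fact reg_normE (x : reg A) : `|x| ^+ 2 = `|reg_inner x x|.
Proof. by rewrite /reg_inner cnorm_star. Qed.

HB.instance Definition _ := CompleteNormedModule_isHilbertModule.Build R A (reg A)
  reg_actDl reg_actDr reg_actZl reg_actZr reg_actM reg_innerDr reg_innerZr
  reg_inner_act reg_inner_star reg_inner_ge0 reg_normE.

Implicit Types a b c : A.

Lemma reg_innerE (x y : reg A) : << x, y >> = cmul (cstar (x : A)) y.
Proof. by []. Qed.

Lemma reg_cs (x y : reg A) : nrm (<< x, y >> : A) <= nrm x * nrm y.
Proof. by rewrite reg_innerE; apply: le_trans (nrmM _ _) _; rewrite nrm_star. Qed.

Fact lml_subproof a : exists g M,
  [/\ is_adj (fun x : reg A => cmul a x : reg A) g,
      bdf (fun x : reg A => cmul a x : reg A) M & bdf g M].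
Proof.
exists (fun x : reg A => cmul (cstar a) x : reg A), (nrm a); split.
- by move=> x y; rewrite !reg_innerE cstarM cmulA.
- by move=> x; exact: nrmM.
- by move=> x; rewrite -(nrm_star a); exact: nrmM.
Qed.

(** The left regular representation, isometric by [lml_bd] and [nrm_lml]. It places [A] inside a
    unital algebra of operators to which the preceding theory of positivity applies. *)
Definition lml a : lop (reg A) := Lop (lml_subproof a).

Lemma lmlE a (x : reg A) : lml a x = cmul a x. Proof. by []. Qed.

Lemma lmlD a b : lml (a + b) = lml a + lml b.
Proof. by apply: lop_eq => x; exact: (@cmulDl R A). Qed.
Lemma lmlN a : lml (- a) = - lml a.
Proof. by apply: lop_eq => x; exact: cmulNl. Qed.
Lemma lmlB a b : lml (a - b) = lml a - lml b.
Proof. by rewrite lmlD lmlN. Qed.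
Lemma lmlZ k a : lml (k *: a) = k *: lml a.
Proof. by apply: lop_eq => x; exact: (@cmulZl R A). Qed.
Lemma lmlM a b : lml (cmul a b) = lml a * lml b.
Proof. by apply: lop_eq => x; rewrite lopME !lmlE cmulA. Qed.
Lemma star_lml a : star (lml a) = lml (cstar a).
Proof. by apply: star_uniq => x y; rewrite !reg_innerE !lmlE cstarM cmulA. Qed.
Lemma lml_bd a : bd (lml a) (nrm a).
Proof. by move=> x; exact: nrmM. Qed.

Lemma nrm_lml a N : 0 <= N -> bd (lml a) N -> nrm a <= N.
Proof.
move=> N0 /(_ (cstar a)); rewrite lmlE.
have -> : nrm (cmul a (cstar a) : reg A) = nrm a ^+ 2 by exact: nrm_Mstar.
have -> : nrm (cstar a : reg A) = nrm a by exact: nrm_star.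
have := nrm_ge0 a; rewrite le_eqVlt => /orP[/eqP <-//|a0].
by rewrite expr2 ler_pM2r.
Qed.

Lemma lml_inj a b : lml a = lml b -> a = b.
Proof.
move=> ab; apply/eqP; rewrite -subr_eq0; apply/eqP/nrm_le0/nrm_lml => //.
by rewrite lmlB ab subrr; exact: bd0.
Qed.

(** Sums of positive elements are easy in this form. [cpositive_apos] and [apos_cpositive] identify
    it with [cpositive]. *)
Definition apos a := positive (lml a).

Lemma apos_starM a : apos (cmul (cstar a) a).
Proof. by rewrite /apos lmlM -star_lml; exact: positive_starM. Qed.

Lemma aposD a b : apos a -> apos b -> apos (a + b).
Proof. by rewrite /apos lmlD; exact: positiveD. Qed.

(** From [a <= a + b <= N], with [N] slightly above [nrm (a + b)]: the slack [e] keeps [N] positive,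
    as [pos] demands. *)
Lemma apos_mono a b : apos a -> apos b -> nrm a <= nrm (a + b).
Proof.
move=> pa pb; apply/ler_addgt0Pr => e e0.
have N0 : 0 < nrm (a + b) + e by have := nrm_ge0 (a + b); lra.
have abN : bd (lml (a + b)) (nrm (a + b) + e).
  by apply: bd_le (@lml_bd _); rewrite lerDl ltW.
have [_ P] := pos_compl0 reg_cs N0 (aposD pa pb) abN.
apply: nrm_lml; first exact: ltW.
apply: positive_mono => //; first exact: ltW.
have : positive ((nrm (a + b) + e)%:C *: (1 : lop (reg A)) - lml (a + b) + lml b).
  by apply: positiveD => //; exists (nrm (a + b) + e).
by rewrite lmlD opprD addrA subrK.
Qed.

Lemma cpositive_apos a : cpositive a -> apos a.
Proof. by move=> [b ->]; exact: apos_starM. Qed.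

(** Since [sqc n.+1 - sqc n = (1 - sqc n)^2 / 2], small increments force [sqc n] to be near 1. *)
Lemma sqc_lim (e : R) : 0 < e -> exists N, forall n, (N <= n)%N -> 1 - sqc R n <= e.
Proof.
move=> e0; have r1 n : sqc R n <= 1 by have /andP[] := sqc01 R n.
have e20 : 0 < 2^-1 * e ^+ 2 by rewrite mulr_gt0 ?invr_gt0 ?exprn_gt0.
have [N HN] := ndseq_cauchy (@sqc_le R) r1 e20.
exists N => n Nn; have := HN n n.+1 Nn (leqnSn n).
have /andP[H H'] := sqc01 R n; rewrite /=; move: (sqc R n) H H' => r r0 rle1 H.
rewrite leNgt; apply/negP => H2; nra.
Qed.

(* The square root of [lml c] is again of the form [lml d]: up to scalars
   tending to 0, its approximants are left multiplications. *)
Lemma apos_cpositive c : apos c -> cpositive c.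
Proof.
move=> [t ct]; have [cs_ t0 _] := ct.
pose h := 1 - t^-1%:C *: lml c.
have hs : star h = h by rewrite starB star1 starR cs_.
have [Y [Ys HY _ /half_root YY _]] := sqy_lim hs (pos_contr ct).
have vex n : exists v, sqy h n = (sqc R n)%:C *: (1 : lop (reg A)) - lml v.
  elim: n => [|n [v IH]].
    exists 0; rewrite real0 sub0r; apply: lop_eq => x /=.
    by rewrite cmul0l oppr0.
  exists ((2^-1 : R)%:C *: (t^-1%:C *: c + (sqc R n)%:C *: (v + v) - cmul v v)).
  rewrite [LHS]/= IH lmlZ lmlB lmlD !lmlZ lmlD lmlM -realCM -scalerBr; congr (_ *: _).
  rewrite realCD real1 /h -!addrA; congr (_ + _).
  rewrite mulrBl !mulrBr !lscalAl !lscalAr !mul1r !mulr1 realCM scalerDr.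
  move: (_ *: lml c) ((_ * _)%:C *: _) (_ *: lml v) (lml v * lml v) => p q r s.
  by rewrite !opprD !opprK !addrA [- p + q]addrC.
have [v Hv] := choice vex.
have vE n : lml (v n) = (sqc R n)%:C *: (1 : lop (reg A)) - sqy h n.
  by rewrite Hv opprB addrC subrK.
have lv : ltends (fun n => lml (v n)) (1 - Y).
  have -> : (fun n => lml (v n)) = (fun n => (sqc R n)%:C *: (1 : lop (reg A)) + (-1) *: sqy h n).
    by apply/funext => n; rewrite vE scaleN1r.
  rewrite -[Y]scale1r -scaleNr; apply: ltendsD; last exact: ltendsZ.
  move=> e e0; have [N HN] := sqc_lim e0; exists N => n Nn; apply: bdC.
  rewrite -[X in bd (X - _)]real1 -scalerBl -rmorphB -[e]mulr1.
  apply: bd_le (bdR _ (@bd1 _ _ _)); first by rewrite ler_wpM2r// HN.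
  by rewrite subr_ge0; have /andP[] := sqc01 R n.
have [w wlim] : exists w : A, tends v w.
  apply: tends_cauchy => e e0.
  have e2 : 0 < e / 2 by lra.
  have [N HN] := lv _ e2; exists N => m n Nm Nn.
  apply: nrm_lml; first exact: ltW.
  rewrite lmlB -(subrKA (1 - Y)) [e]splitr.
  by apply: bdD; [exact: HN|apply: bdC; exact: HN].
have wY : 1 - Y = lml w.
  apply: ltends_uniq lv _ => e e0; have [N HN] := wlim e e0.
  by exists N => n Nn; rewrite -lmlB; apply: bd_le (lml_bd _); exact: HN.
exists ((Num.sqrt t)%:C *: w); apply: lml_inj.
rewrite lmlM -star_lml lmlZ starR -wY starB star1 Ys lscalAl lscalAr realCM YY.
rewrite -expr2 sqr_sqrtr ?ltW// /h opprB addrC subrK realCM mulfV ?gt_eqF//.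
by rewrite real1.
Qed.

Lemma cpositiveD a b : cpositive a -> cpositive b -> cpositive (a + b).
Proof.
move=> pa pb; apply: apos_cpositive.
by apply: aposD; exact: cpositive_apos.
Qed.

Lemma nrm_cpositive_mono a b : cpositive a -> cpositive b -> nrm a <= nrm (a + b).
Proof. by move=> /cpositive_apos pa /cpositive_apos; exact: apos_mono. Qed.

End Regular.

Section CauchySchwarz.
Variables (R : realType) (A : cstarAlgType R) (X : hilbertModType A).
Implicit Types (x y z : X).

Lemma cpositiveZ (r : R) (a : A) : 0 <= r -> cpositive a -> cpositive (r%:C *: a).
Proof.
by move=> r0 /cpositive_apos pa; apply: apos_cpositive; rewrite /apos lmlZ; exact: positiveZ.
Qed.

Lemma inner_comb x y (t : R) (a : A) :
  << t%:C *: y - hact x a, t%:C *: y - hact x a >> =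
  ((t ^+ 2)%:C *: << y, y >> - t%:C *: cmul << y, x >> a) -
  (t%:C *: cmul (cstar a) << x, y >> - cmul (cstar a) (cmul << x, x >> a)) :> A.
Proof.
rewrite innerBl !innerBr innerRl !innerZr realCM -expr2.
by rewrite innerRl !inner_hact !inner_hactl cmulA.
Qed.

(* For [a = <x, y>], [c = <x, x>] and [d = <y, y>] the element [v] is
   [<y t - x a, y t - x a>]. *)
Lemma complete_square (a c d v : A) (t : R) : 0 < t -> cpositive c -> nrm c <= t ->
  cpositive v ->
  v = ((t ^+ 2)%:C *: d - t%:C *: cmul (cstar a) a) -
      (t%:C *: cmul (cstar a) a - cmul (cstar a) (cmul c a)) ->
  nrm a ^+ 2 <= t * nrm d /\ nrm v <= t ^+ 2 * nrm d.
Proof.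
move=> t0 [b cb] ct vp vE.
pose p : A := t%:C *: cmul (cstar a) a - cmul (cstar a) (cmul c a).
have pp : cpositive p.
  have bt : bd (lml (cmul (cstar b) b)) t by apply: bd_le (lml_bd _); rewrite -cb.
  have [_ Pp] := pos_compl0 (@reg_cs _ A) t0 (apos_starM b) bt.
  apply: apos_cpositive; rewrite /apos /p lmlB lmlZ !lmlM -star_lml cb.
  have := positive_conj (lml a) (ex_intro _ t Pp).
  by rewrite mulrBr mulrBl lscalAr mulr1 lscalAl !mulrA.
have pa : cpositive (t%:C *: cmul (cstar a) a : A).
  by apply: cpositiveZ; [exact: ltW|exists a].
have E : v + (t%:C *: cmul (cstar a) a + p) = (t ^+ 2)%:C *: d.
  by rewrite vE -/p -[X in X + _]addrA -opprD subrK.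
split; last first.
  by have := nrm_cpositive_mono vp (cpositiveD pa pp); rewrite E nrmZp ?sqr_ge0.
have := nrm_cpositive_mono pa (cpositiveD pp vp).
rewrite addrA addrC E !nrmZp ?sqr_ge0 ?(ltW t0)// nrm_starM.
by rewrite [t ^+ 2]expr2 -mulrA ler_pM2l.
Qed.

Lemma inner_square x y : 0 < nrm x ->
  let v := (nrm x ^+ 2)%:C *: y - hact x (<< x, y >> : A) in
  nrm (<< x, y >> : A) ^+ 2 <= nrm x ^+ 2 * nrm (<< y, y >> : A) /\
  nrm (<< v, v >> : A) <= (nrm x ^+ 2) ^+ 2 * nrm (<< y, y >> : A).
Proof.
move=> x0 v; apply: (complete_square _ (inner_ge0 x) _ (inner_ge0 v)).
- exact: exprn_gt0.
- by rewrite nrm_inner.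
- by rewrite inner_comb -(inner_star x y).
Qed.

Lemma inner_cs x y : nrm (<< x, y >> : A) <= nrm x * nrm y.
Proof.
have := nrm_ge0 x; rewrite le_eqVlt => /orP[/eqP x0|x0].
  by rewrite (@nrm_eq0 _ _ x)// inner0l !nrm0 mul0r.
have [H1 _] := inner_square y x0.
by move: H1; rewrite nrm_inner -exprMn ler_pXn2r// nnegrE ?mulr_ge0 ?nrm_ge0.
Qed.

(** This is the positivity of the rank one operator [theta x x], with the sharp constant
    [nrm x ^+ 2]; see [theta_pos]. *)
Lemma nrm_sub_theta x y : 0 < nrm x ->
  nrm ((nrm x ^+ 2)%:C *: y - hact x (<< x, y >> : A)) <= nrm x ^+ 2 * nrm y.
Proof.
move=> x0; have t0 : 0 < nrm x ^+ 2 by exact: exprn_gt0.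
have [_ H2] := inner_square y x0.
move: H2; rewrite !nrm_inner -exprMn ler_pXn2r// nnegrE ?nrm_ge0//.
by rewrite mulr_ge0 ?nrm_ge0 ?ltW.
Qed.

Lemma bd_star (T : lop X) M : 0 <= M -> bd T M -> bd (star T) M.
Proof.
move=> M0 TM x; have := nrm_ge0 (star T x); rewrite le_eqVlt => /orP[/eqP <-|p].
  by rewrite mulr_ge0 ?nrm_ge0.
rewrite -(ler_pM2r p) -expr2 -nrm_inner -starP'; apply: le_trans (inner_cs _ _) _.
by have := TM (star T x); have := nrm_ge0 x; nra.
Qed.

Lemma pos_compl (T : lop X) N : 0 < N -> positive T -> bd T N ->
  pos N T /\ pos N (N%:C *: (1 : lop X) - T).
Proof. exact/pos_compl0/inner_cs. Qed.

End CauchySchwarz.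

(** * Rank one operators, Neumann series and resolvents *)

Section RankOne.
Variables (R : realType) (A : cstarAlgType R) (X : hilbertModType A).
Implicit Types (x y z : X) (S T U : lop X) (G : lop (reg A)).

Fact rk_bd_subproof x G y M : 0 <= M -> bd G M ->
  bdf (fun z => hact x (G (<< y, z >> : A) : A)) (nrm x * M * nrm y).
Proof.
move=> M0 GM z; apply: le_trans (nrm_hact _ _) _.
rewrite -!mulrA ler_wpM2l ?nrm_ge0//; apply: le_trans (GM _) _.
by rewrite ler_wpM2l//; exact: inner_cs.
Qed.

Fact rk_adj x G y : is_adj (fun z => hact x (G (<< y, z >> : A) : A))
  (fun z => hact y (star G (<< x, z >> : A) : A)).
Proof.
move=> u v; rewrite inner_hact inner_hactl -(inner_star y u).
by have := starP G (<< y, u >> : A) (<< x, v >> : A).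
Qed.

Fact rk_subproof x G y : exists g M, [/\ is_adj (fun z => hact x (G (<< y, z >> : A) : A)) g,
  bdf (fun z => hact x (G (<< y, z >> : A) : A)) M & bdf g M].
Proof.
have [M M0 GM] := lop_bd G.
exact: bdf_both (rk_adj x G y) (rk_bd_subproof x y M0 GM)
  (rk_bd_subproof y x M0 (bd_star M0 GM)).
Qed.

(** The operator [x G y^*]. The middle factor is an operator on [reg A] rather than an element of
    [A], so that it can be the identity or an inverse of the form used in [invertible_rank1]. *)
Definition rk x G y := Lop (rk_subproof x G y).

Lemma rkE x G y z : rk x G y z = hact x (G (<< y, z >> : A) : A).
Proof. by []. Qed.

Lemma rk_bd x G y M : 0 <= M -> bd G M -> bd (rk x G y) (nrm x * M * nrm y).
Proof. exact: rk_bd_subproof. Qed.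

Lemma star_rk x G y : star (rk x G y) = rk y (star G) x.
Proof. by apply: star_uniq; exact: rk_adj. Qed.

Lemma rkMl S x G y : S * rk x G y = rk (S x) G y.
Proof. by apply: lop_eq => z; rewrite lopME !rkE lop_hact. Qed.

Lemma rkB x G G' y : rk x (G - G') y = rk x G y - rk x G' y.
Proof. by apply: lop_eq => z; rewrite !lopE !rkE hactDr hactNr. Qed.

Definition theta x y := rk x 1 y.

Lemma thetaE x y z : theta x y z = hact x (<< y, z >> : A). Proof. by []. Qed.

Lemma theta_bd x y : bd (theta x y) (nrm x * nrm y).
Proof. by have := rk_bd x y ler01 (@bd1 _ _ _); rewrite mulr1. Qed.

Lemma star_theta x y : star (theta x y) = theta y x.
Proof. by rewrite star_rk star1. Qed.

Lemma theta_pos x t : 0 < t -> nrm x ^+ 2 <= t -> pos t (theta x x).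
Proof.
move=> t0 xt; have := nrm_ge0 x; rewrite le_eqVlt => /orP[/eqP x0|x0].
  have -> : theta x x = 0 by apply: lop_eq => z; rewrite thetaE (@nrm_eq0 _ _ x)// hact0l.
  split; rewrite ?star0 ?subr0// -[X in bd _ X]mulr1; apply: bdR (@bd1 _ _ _); exact: ltW.
apply: pos_le xt _; split; [exact: star_theta|exact: exprn_gt0|].
by move=> y; exact: nrm_sub_theta.
Qed.

Lemma positive_theta x : positive (theta x x).
Proof.
exists (nrm x ^+ 2 + 1); apply: theta_pos; last by rewrite lerDl.
by have := sqr_ge0 (nrm x); lra.
Qed.

Definition invertible T := exists S, T * S = 1 /\ S * T = 1.

Lemma invertibleM S T : invertible S -> invertible T -> invertible (S * T).
Proof.
move=> [S' [H1 H2]] [T' [H3 H4]]; exists (T' * S'); split.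
  by rewrite mulrA -(mulrA S) H3 mulr1.
by rewrite mulrA -(mulrA T') H2 mulr1.
Qed.

(** The convergence of the partial sums is part of the conclusion because [positive_inv] deduces
    from it that inverses preserve invariant closed submodules. *)
Lemma neumann D (d : R) : 0 <= d -> d < 1 -> bd (1 - D) d -> exists U : lop X,
  [/\ D * U = 1, U * D = 1, bd (U - 1) (d / (1 - d)) &
      ltends (fun n => \sum_(k < n) (1 - D) ^+ k) U].
Proof.
move=> d0 d1; have [K KE] : exists K, K = 1 - D by exists (1 - D).
rewrite -KE => Kd; have DE : D = 1 - K by rewrite KE opprB addrC subrK.
have d1' : 0 < 1 - d by lra.
have Xbd (L : lop X) k : bd L d -> bd (L ^+ k) (d ^+ k).
  move=> Ld; elim: k => [|k IH]; first by rewrite !expr0; exact: bd1.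
  by rewrite !exprS; exact: bdM.
have starX k : star (K ^+ k) = star K ^+ k.
  by elim: k => [|k IH]; rewrite ?expr0 ?star1// exprS exprSr starM IH.
pose T n : lop X := \sum_(k < n) K ^+ k.
have TS n : T n.+1 - T n = K ^+ n by rewrite /T big_ord_recr/= addrC addrK.
pose r n : R := \sum_(k < n) d ^+ k.
have rS n : r n.+1 - r n = d ^+ n by rewrite /r big_ord_recr/= addrC addrK.
have [||n|n|U [HU _]] := @lop_lim _ _ _ T r (1 - d)^-1.
- by move=> n; rewrite -subr_ge0 rS exprn_ge0.
- move=> n; have := subrX1 d n; rewrite -/(r n) => E.
  rewrite -[(1 - d)^-1]mul1r ler_pdivlMr//.
  by have := exprn_ge0 n d0; nra.
- by rewrite TS rS; exact: Xbd.
- by rewrite -starB TS rS starX; apply/Xbd/bd_star.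
have KT n : K * T n = T n.+1 - 1.
  rewrite /T big_ord_recl/= expr0 [X in _ = X - _]addrC addrK mulr_sumr.
  by apply: eq_bigr => i _; rewrite exprS.
have TK n : T n * K = T n.+1 - 1.
  rewrite /T big_ord_recl/= expr0 [X in _ = X - _]addrC addrK mulr_suml.
  by apply: eq_bigr => i _; rewrite exprSr.
have lim1 : ltends (fun n => T n.+1 - 1) (U - 1).
  by apply: ltendsD; [exact: ltends_shift|exact: ltends_cst].
have KU : K * U = U - 1.
  apply: ltends_uniq (ltendsM (ltends_cst K) HU) _.
  by rewrite (_ : (fun n => _) = (fun n => T n.+1 - 1))//; apply/funext.
have UK : U * K = U - 1.
  apply: ltends_uniq (ltendsM HU (ltends_cst K)) _.
  by rewrite (_ : (fun n => _) = (fun n => T n.+1 - 1))//; apply/funext.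
have DU : D * U = 1 by rewrite DE mulrBl mul1r KU opprB addrC subrK.
exists U; split=> //; first by rewrite DE mulrBr mulr1 UK opprB addrC subrK.
rewrite -KU; apply: bdM => // z.
have := nrm_tri (U z) (K (U z)) 0; rewrite !subr0.
have -> : U z - K (U z) = z.
  by rewrite -[RHS]lop1E -DU DE lopME lopBE lop1E.
by have := Kd (U z); rewrite ler_pdivlMl//; lra.
Qed.

Lemma closed_tends (S : set X) (u : nat -> X) x : closed S -> (forall n, S (u n)) ->
  tends u x -> S x.
Proof.
move=> /closed_nrm cS Su ux; apply: cS => e e0.
have [|N HN] := ux (e / 2); first by lra.
exists (u N) => //; rewrite nrmC; apply: le_lt_trans (HN _ (leqnn N)) _; lra.
Qed.

(** Divided by [s + t], the operator [s + H] differs from 1 by [(t - H) / (s + t)], of norm at most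
    [t / (s + t) < 1], so the Neumann series applies. The last clause keeps [G] inside the domain of
    an isometry that is defined on a submodule only. *)
Lemma positive_inv (H : lop X) (s : R) : 0 < s -> positive H -> exists G : lop X,
  [/\ (s%:C *: (1 : lop X) + H) * G = 1, G * (s%:C *: (1 : lop X) + H) = 1, bd G s^-1, star G = G &
     forall S : set X, closed_submodule S -> (forall x, S x -> S (H x)) ->
       forall x, S x -> S (G x)].
Proof.
move=> s0 Hp; have [t [Hs t0 HT]] := Hp.
have st : 0 < s + t by lra.
pose D := (s + t)^-1%:C *: (s%:C *: (1 : lop X) + H).
have KE : 1 - D = (s + t)^-1%:C *: (t%:C *: (1 : lop X) - H).
  rewrite -[X in X - _](@real1 _ (lop X)) -[X in X%:C *: _ - _](@mulVf _ (s + t)) ?gt_eqF//.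
  rewrite -realCM -scalerBr; congr (_ *: _); rewrite realCD opprD addrACA subrr add0r//.
have Kd : bd (1 - D) ((s + t)^-1 * t).
  by rewrite KE; apply: bdR => //; rewrite invr_ge0 ltW.
have [||U [DU UD _ HU]] := neumann _ _ Kd.
- by rewrite mulr_ge0 ?invr_ge0 ?ltW.
- by rewrite mulrC ltr_pdivrMr//; lra.
have E1 : (s%:C *: (1 : lop X) + H) * ((s + t)^-1%:C *: U) = 1.
  by rewrite -[RHS]DU lscalAr lscalAl.
have E2 : ((s + t)^-1%:C *: U) * (s%:C *: (1 : lop X) + H) = 1.
  by rewrite -[RHS]UD lscalAr lscalAl.
exists ((s + t)^-1%:C *: U); split=> //.
- move=> z; rewrite ler_pdivlMl//.
  apply: le_trans (positive_exp _ (ltW s0) Hp) _.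
  by have /= -> := congr1 (fun V : lop X => V z) E1.
- have : star ((s + t)^-1%:C *: U) * (s%:C *: (1 : lop X) + H) = 1.
    by rewrite -[RHS]star1 -[in RHS]E1 starM starD starR star1 Hs.
  move=> /(congr1 (fun V => V * ((s + t)^-1%:C *: U))).
  by rewrite -mulrA E1 mulr1 mul1r.
- move=> S cS HS; have [S0 SD SZ _ Scl] := cS; move=> x Sx; rewrite lopZE; apply: (SZ).
  apply: closed_tends (ltends_pt x HU) => // n; rewrite KE.
  have SK y : S y -> S (((s + t)^-1%:C *: (t%:C *: (1 : lop X) - H)) y).
    move=> Sy; rewrite !lopE; apply/SZ/SD; first exact: SZ.
    by rewrite -scaleN1r; apply/SZ/HS.
  elim: n => [|n IH]; first by rewrite big_ord0.
  rewrite big_ord_recr/=; apply: (SD) => //.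
  elim: (n : nat) => [|m IHm]; first by rewrite expr0.
  by rewrite exprS lopME; apply: SK.
Qed.

(** For [y = G g] the error is [e y]. As [<<y, g>> = e <<y, y>> + <<y, h y>>] dominates
    [<<y, g>> <<g, y>>], its norm is at most 1; it also dominates [e <<y, y>>], so
    [e * nrm y ^+ 2 <= 1]. *)
Lemma approx_unit (g : X) (h h' : lop X) (e : R) (G : lop X) : 0 < e ->
  positive h' -> h = theta g g + h' -> (e%:C *: (1 : lop X) + h) * G = 1 ->
  nrm (g - (h * G) g) ^+ 2 <= e.
Proof.
move=> e0 h'p hE hG; pose y := G g.
have gE : g = e%:C *: y + h y by rewrite -[LHS]lop1E -hG.
have -> : g - (h * G) g = e%:C *: y by rewrite {1}gE lopME addrK.
have hp : positive h by rewrite hE; apply: positiveD => //; exact: positive_theta.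
have yh : << y, h y >> = cmul << y, g >> << g, y >> + << y, h' y >> :> A.
  by rewrite hE lopDE innerDr thetaE inner_hact.
have yg : << y, g >> = e%:C *: << y, y >> + << y, h y >> :> A.
  by rewrite {1}gE innerDr innerZr.
have yy : cpositive (e%:C *: << y, y >> : A).
  by apply: cpositiveZ; [exact: ltW|exact: inner_ge0].
have := nrm_cpositive_mono yy (positive_inner y hp).
rewrite -yg nrmZp ?(ltW e0)// nrm_inner => H1.
have gy : cpositive (cmul << y, g >> << g, y >> : A).
  by exists << g, y >>; rewrite inner_star.
have := nrm_cpositive_mono gy (cpositiveD (positive_inner y h'p) yy).
rewrite addrA -yh addrC -yg -(inner_star g y) nrm_starM nrm_star => H2.
have := nrm_ge0 (<< g, y >> : A); rewrite -(inner_star g y) nrm_star in H1 *.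
rewrite nrmZp ?(ltW e0)// exprMn.
move: (nrm (<< g, y >> : A)) H1 H2 => a H1 H2 a0.
have a1 : a <= 1 by rewrite leNgt; apply/negP => a1; nra.
by have := sqr_ge0 (nrm y); nra.
Qed.

End RankOne.

(** * Stable rank one and approximate unitary equivalence *)

Section StableRankOne.
Variables (R : realType) (A : cstarAlgType R).
Hypothesis sr1 : stable_rank_one A.

Definition unitz_lop (p : A * R[i]) : lop (reg A) := lml p.1 + p.2 *: (1 : lop (reg A)).

Lemma unitz_lopM p q : unitz_lop (unitz_mul p q) = unitz_lop p * unitz_lop q.
Proof.
rewrite /unitz_lop /= !lmlD !lmlZ lmlM mulrDl !mulrDr !lscalAl !lscalAr mulr1 mul1r.
by rewrite scalerA mul1r !addrA.
Qed.

Lemma unitz_lop1 : unitz_lop (unitz_one A) = 1.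
Proof.
rewrite /unitz_lop /= scale1r; apply: lop_eq => x /=.
by rewrite cmul0l add0r.
Qed.

Lemma unitz_norm_bd p (e : R) : unitz_norm p < e -> bd (unitz_lop p) e.
Proof.
move=> pe c.
have c0 := nrm_ge0 c; have := c0; rewrite le_eqVlt => /orP[/eqP c00|cp].
  by rewrite (@nrm_eq0 _ _ c)// lop0x !nrm0 mulr0.
pose d : A := (nrm c)^-1%:C *: (c : A).
have d1 : nrm d = 1.
  by rewrite nrmZp ?invr_ge0//; exact: mulVf (lt0r_neq0 cp).
have H : nrm (unitz_lop p d) <= unitz_norm p.
  apply: ub_le_sup; last by exists d => //=; rewrite -nrmE d1.
  exists (nrm p.1 + complex.Re `|p.2|) => _ [b /= b1 <-].
  have b1' : nrm b <= 1 by rewrite -lecR nrmE.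
  apply: le_trans (nrmD _ _) _; apply: lerD.
    by apply: le_trans (nrmM _ _) _; rewrite ler_piMr// nrm_ge0.
  rewrite nrmZc ler_piMr//.
  by rewrite -ler0c RRe_real// ger0_real.
move: H; rewrite lopZ nrmZp ?invr_ge0// => H.
by rewrite -ler_pdivrMr// mulrC; exact: le_trans H (ltW pe).
Qed.

(** The unital and nonunital cases in one form, with invertibility read among operators on [reg A].
    In the unital case left multiplication by the unit is 1, so [1 + lml m] is itself a left
    multiplication. *)
Lemma sr1_approx (m : A) (e : R) : 0 < e -> exists2 N : lop (reg A),
  invertible N & bd (N - (1 + lml m)) e.
Proof.
move=> e0; have [sru srn] := sr1.
have [[u uu]|nu] := pselect (exists u : A, is_cunit u).
  have lu : lml u = 1 by apply: lop_eq => x; rewrite lmlE lop1E; case: (uu x).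
  have [||b [ub [b' [bb' b'b]]]] := sru u uu (ball (m + u) e%:C).
  - by exists (m + u); apply: ballxx; rewrite ltcR.
  - by apply: ball_open; rewrite ltcR.
  exists (lml b).
    by exists (lml b'); rewrite -!lmlM bb' b'b.
  rewrite -lu -lmlD -lmlB; apply: bd_le (lml_bd _).
  by move: ub; rewrite ball_nrm nrmC [m + u]addrC => /ltW.
have [y [y' [yy' y'y]] /unitz_norm_bd H] := srn nu (m, 1) e e0.
exists (unitz_lop y).
  by exists (unitz_lop y'); rewrite -!unitz_lopM yy' y'y unitz_lop1.
have -> : unitz_lop y - (1 + lml m) = - unitz_lop ((m, 1) - y).
  rewrite /unitz_lop /= lmlB scalerBl scale1r !opprD !opprK [RHS]addrACA addrC.
  by rewrite [- lml m + _]addrC -!addrA; congr (_ + _); rewrite addrC.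
exact: bdN.
Qed.

Variable X : hilbertModType A.
Implicit Types (x y z eta zeta : X) (S T U : lop X).

Lemma rkM x G y x' W y' :
  rk x G y * rk x' W y' = rk x (G * lml << y, x' >> * W) y' :> lop X.
Proof. by apply: lop_eq => z; rewrite lopME !rkE inner_hact. Qed.

(* [1 + eta G zeta^*] is invertible as soon as [G^-1 + <zeta, eta>] is, so it
   is enough to make the latter invertible by a small change of [G = 1]. *)
Lemma invertible_rank1 S eta zeta (e : R) : 0 < e -> invertible S ->
  exists2 S', invertible S' & bd (S' - (S + theta eta zeta)) e.
Proof.
move=> e0 [S1 [SS1 S1S]].
pose eta' := S1 eta; pose m : A := << zeta, eta' >>.
pose c := nrm eta * nrm zeta; have c0 : 0 <= c by rewrite mulr_ge0 ?nrm_ge0.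
(* [G - 1] will have norm at most [d / (1 - d) <= 2 d], which moves the rank one term by at most
   [2 d c]; the [+ 1] covers [c = 0]. *)
pose d := Num.min (1 / 2) (e / (2 * c + 1)).
have d0 : 0 < d by rewrite lt_min divr_gt0//= divr_gt0//; lra.
have d2 : d <= 1 / 2 by rewrite ge_min lexx.
have dc : d * (2 * c + 1) <= e.
  by rewrite -ler_pdivlMr ?ge_min ?lexx ?orbT//; lra.
have [N [W [NW WN]] HN] := sr1_approx m d0.
(* [D] is near 1, hence has an inverse [G] near 1, and [G^-1 + m] is the invertible [N]. *)
pose D := N - lml m.
have HD : bd (1 - D) d by apply: bdC; rewrite -addrA -opprD [lml m + 1]addrC.
have [||G [DG GD HG _]] := neumann _ _ HD; [exact: ltW|lra|].
have mE : lml m = N - D by rewrite opprB addrC subrK.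
have GmW : G * lml m * W = G - W.
  by rewrite mE mulrBr mulrBl GD mul1r -mulrA NW mulr1.
have WmG : W * lml m * G = G - W.
  by rewrite mE mulrBr mulrBl WN mul1r -mulrA DG mulr1.
exists (S * (1 + rk eta' G zeta)).
  apply: invertibleM; first by exists S1.
  (* The Sherman-Morrison formula, [W] being the inverse of [G^-1 + m]. *)
  exists (1 - rk eta' W zeta); split.
    rewrite mulrBr mulr1 mulrDl mul1r rkM -/m GmW -addrA -[RHS]addr0; congr (_ + _).
    by rewrite rkB [X in _ - X]addrC subrK subrr.
  rewrite mulrDr mulr1 mulrBl mul1r rkM -/m WmG -addrA -[RHS]addr0; congr (_ + _).
  by rewrite rkB opprB [X in _ + X]addrC subrK addNr.
rewrite mulrDr mulr1 opprD addrACA subrr add0r rkMl /eta' -lopME SS1 lop1E -rkB.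
apply: bd_le (rk_bd _ _ _ HG); last by rewrite divr_ge0; lra.
have : d / (1 - d) <= 2 * d by rewrite ler_pdivrMr; nra.
move=> H; rewrite mulrAC -/c; have := ler_wpM2l c0 H; nra.
Qed.

Lemma invertible_sum (s : seq (X * X)) (e : R) : 0 < e ->
  exists2 S', invertible S' & bd (S' - \sum_(p <- s) theta p.1 p.2) e.
Proof.
elim: s e => [|p s IH] e e0.
  (* The empty sum is 0, approximated by a nonzero scalar. *)
  exists (e%:C *: (1 : lop X)).
    exists (e^-1%:C *: (1 : lop X)); rewrite !lscalAl !mul1r !realCM mulfV ?mulVf ?gt_eqF//.
    by rewrite real1.
  by rewrite big_nil subr0 -[e in X in bd _ X]mulr1; exact: bdR (ltW e0) (@bd1 _ _ _).
have e2 : 0 < e / 2 by lra.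
have [S Si HS] := IH _ e2.
have [T Ti HT] := invertible_rank1 p.1 p.2 e2 Si.
exists T => //; rewrite big_cons.
have -> : T - (theta p.1 p.2 + \sum_(q <- s) theta q.1 q.2) =
  (T - (S + theta p.1 p.2)) + (S - \sum_(q <- s) theta q.1 q.2).
  by rewrite [S + _]addrC !opprD !addrA subrK.
by rewrite [e]splitr; exact: bdD.
Qed.

End StableRankOne.

(** * Polar decomposition of invertible operators *)

Section Polar.
Variables (R : realType) (A : cstarAlgType R) (X : hilbertModType A).
Implicit Types S T U : lop X.

Definition unitary U := star U * U = 1 /\ U * star U = 1.

Lemma unitary1 : unitary 1.
Proof. by split; rewrite star1 mul1r. Qed.

Lemma unitaryM U V : unitary U -> unitary V -> unitary (U * V).
Proof.
move=> [u1 u2] [v1 v2]; split; rewrite starM mulrA.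
  by rewrite -(mulrA (star V)) u1 mulr1.
by rewrite -(mulrA U) v2 mulr1.
Qed.

Lemma polar S : invertible S -> exists U Q,
  [/\ unitary U, positive Q, Q * Q = star S * S & S = U * Q].
Proof.
move=> [T [ST TS]].
have [Q [Qp QQ _]] := positive_sqrt (positive_starM S).
have Qs := positive_star Qp.
(* [V] inverts [Q^2] and commutes with [Q], so [Q V] inverts [Q] and the unitary part is
   [S (Q V)]. *)
have [V VE] : exists V, V = T * star T by exists (T * star T).
have VQ : V * (Q * Q) = 1.
  by rewrite QQ VE mulrA -(mulrA T) -starM ST star1 mulr1.
have QV : Q * Q * V = 1.
  by rewrite QQ VE mulrA -(mulrA (star S)) ST mulr1 -starM TS star1.
have E : V * Q = Q * V.
  by rewrite -[LHS]mulr1 -QV -[RHS]mul1r -VQ -!mulrA.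
have Vs : star V = V by rewrite VE starM starK.
have sQV : star (Q * V) = V * Q by rewrite starM Vs Qs.
exists (S * (Q * V)), Q; split=> //; last by rewrite -E -!mulrA VQ mulr1.
split; rewrite starM sQV.
  rewrite mulrA -(mulrA (V * Q)) -QQ.
  have -> : V * Q * (Q * Q) * (Q * V) = (V * (Q * Q)) * (Q * Q * V) by rewrite -!mulrA.
  by rewrite VQ QV mulr1.
have -> : S * (Q * V) * (V * Q * star S) = S * (Q * V * (V * Q)) * star S by rewrite -!mulrA.
have -> : Q * V * (V * Q) = V by rewrite E -{1}E -!mulrA (mulrA Q) QV mulr1.
by rewrite VE mulrA ST mul1r -starM ST star1.
Qed.

End Polar.

Section Isometries.
Variables (R : realType) (A : cstarAlgType R) (X Y : hilbertModType A).
Implicit Types (S : set X) (f : X -> Y).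

Definition isom_on S f :=
  [/\ (forall x y, S x -> S y -> f (x + y) = f x + f y),
      (forall (k : R[i]) x, S x -> f (k *: x) = k *: f x),
      (forall x (a : A), S x -> f (hact x a) = hact (f x) a)
    & (forall x y, S x -> S y -> inner (f x) (f y) = inner x y :> A)].

Lemma isom_nrm S f x : isom_on S f -> S x -> nrm (f x) = nrm x.
Proof.
move=> [_ _ _ fi] Sx; apply/eqP; rewrite -(eqrXn2 (ltn0Sn 1)) ?nrm_ge0//.
by rewrite -!nrm_inner fi.
Qed.

Lemma closed_submoduleN S x : closed_submodule S -> S x -> S (- x).
Proof. by move=> [_ _ SZ _ _] Sx; rewrite -scaleN1r; exact: SZ. Qed.

Lemma closed_submoduleB S x y : closed_submodule S -> S x -> S y -> S (x - y).
Proof. by move=> cS Sx Sy; case: (cS) => _ SD _ _ _; exact: SD Sx (closed_submoduleN cS Sy). Qed.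

Lemma isomN S f x : closed_submodule S -> isom_on S f -> S x -> f (- x) = - f x.
Proof. by move=> cS [_ fZ _ _] Sx; rewrite -scaleN1r fZ// scaleN1r. Qed.

Lemma isomB S f x y : closed_submodule S -> isom_on S f -> S x -> S y ->
  f (x - y) = f x - f y.
Proof.
move=> cS fS Sx Sy; case: (fS) => fD _ _ _.
by rewrite (fD _ _ Sx (closed_submoduleN cS Sy)) (isomN cS fS Sy).
Qed.

End Isometries.

Section KeyLemma.
Variables (R : realType) (A : cstarAlgType R) (X Y : hilbertModType A).
Hypothesis sr1 : stable_rank_one A.

Lemma lop_sumE (Z : hilbertModType A) (I : Type) (s : seq I) (F : I -> lop Z) z :
  (\sum_(i <- s) F i) z = \sum_(i <- s) F i z.
Proof. by elim: s => [|i s IH]; rewrite ?big_nil// !big_cons lopDE IH. Qed.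

Lemma star_sum (Z : hilbertModType A) (I : Type) (s : seq I) (F : I -> lop Z) :
  star (\sum_(i <- s) F i) = \sum_(i <- s) star (F i).
Proof. by elim: s => [|i s IH]; rewrite ?big_nil ?star0// !big_cons starD IH. Qed.

Lemma positive_sum_theta (Z : hilbertModType A) (s : seq Z) :
  positive (\sum_(x <- s) theta x x).
Proof.
elim: s => [|x s IH]; first by rewrite big_nil; exists 1; exact: pos0.
by rewrite big_cons; apply: positiveD => //; exact: positive_theta.
Qed.

(* A finite rank operator [theta] of norm at most 2 with [theta x] close to
   [x] on F turns the pair [phi], [psi] into the finite rank operator
   [T = psi theta phi^*]; [u] is the unitary part of an invertible [S] near
   [T]. As [S^* S] almost fixes [phi x], so does its square root. *)
Lemma isom_conj (S : set X) (phi psi : X -> Y) (F : seq X) (e : R) :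
  closed_submodule S -> isom_on S phi -> isom_on S psi ->
  (forall x, x \in F -> S x) -> 0 < e ->
  exists2 u : lop Y, unitary u &
    forall x, x \in F -> nrm (u (phi x) - psi x) <= e.
Proof.
move=> cS phiS psiS FS e0.
have [S0 SD SZ Sa _] := cS.
have sum_in (k : X -> X) (a : X -> A) : (forall x, x \in F -> S (k x)) ->
    S (\sum_(x <- F) hact (k x) (a x)).
  move=> Sk; rewrite big_seq; elim/big_ind: _ => // x xF; exact/Sa/Sk.
have sum_isom (f : X -> Y) (k : X -> X) (a : X -> A) : isom_on S f ->
    (forall x, x \in F -> S (k x)) ->
    f (\sum_(x <- F) hact (k x) (a x)) = \sum_(x <- F) hact (f (k x)) (a x).
  move=> fS; elim: (F) => [|x s IH] Sk.
    by rewrite !big_nil; case: fS => _ fZ _ _; have := fZ 0 0 S0; rewrite !scale0r.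
  have Ss y : y \in s -> S (k y) by move=> ys; apply: Sk; rewrite inE ys orbT.
  have Sx : S (k x) by apply: Sk; rewrite inE eqxx.
  have SS : S (\sum_(x <- s) hact (k x) (a x)).
    by rewrite big_seq; elim/big_ind: _ => // y ys; exact/Sa/Ss.
  rewrite !big_cons -IH//; case: fS => fD _ fa _.
  by rewrite fD// ?fa//; exact: Sa.
(* The errors at the end are [4 d], [d] and [d]. *)
pose d := e / 8; have d0 : 0 < d by rewrite divr_gt0.
have d20 : 0 < d ^+ 2 by exact: exprn_gt0.
pose h := \sum_(x <- F) theta x x : lop X.
have hp : positive h by exact: positive_sum_theta.
have [G [hG Gh Gb Gs GS]] := positive_inv d20 hp.
pose th := h * G.
have thE : th = 1 - (d ^+ 2)%:C *: G.
  by rewrite -hG mulrDl lscalAl mul1r addrC addKr.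
have ths : star th = th by rewrite thE starB star1 starR Gs.
have th2 : bd th 2.
  rewrite thE (_ : 2 = 1 + (d ^+ 2) * (d ^+ 2)^-1); last by rewrite mulfV ?gt_eqF.
  by apply: bdB (@bd1 _ _ _) (bdR (ltW d20) Gb).
have thF x : x \in F -> nrm (x - th x) <= d.
  move=> xF.
  have hx : h = theta x x + \sum_(y <- rem x F) theta y y.
    by rewrite /h (perm_big _ (perm_to_rem xF)) big_cons.
  have := approx_unit d20 (positive_sum_theta (rem x F)) hx hG.
  by rewrite ler_pXn2r ?nnegrE ?nrm_ge0// ltW.
have hS x : S x -> S (h x).
  by move=> Sx; rewrite lop_sumE; apply: sum_in.
have GFS x : x \in F -> S (G x) by move=> /FS Sx; exact: GS cS hS _ Sx.
have thzE z : th z = \sum_(x <- F) hact x (<< G x, z >> : A).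
  rewrite /th lopME lop_sumE; apply: eq_bigr => x _.
  by rewrite thetaE starP' Gs.
have thzE' z : th z = \sum_(x <- F) hact (G x) (<< x, z >> : A).
  rewrite -ths -Gs /th starM (positive_star hp) Gs lopME lop_sumE (big_morph G (lopD G) (lop0x G)).
  by apply: eq_bigr => x _; rewrite thetaE lop_hact.
(* This is [psi th phi^*], although [phi] may have no adjoint: [th z] is the sum of the
   [x <<G x, z>>], and each [G x] lies in [S], where [phi] is isometric. *)
pose T := \sum_(x <- F) theta (psi x) (phi (G x)) : lop Y.
have Tphi z : S z -> T (phi z) = psi (th z).
  move=> Sz; rewrite thzE sum_isom// lop_sumE big_seq [RHS]big_seq.
  apply: eq_bigr => x xF; rewrite thetaE; congr hact.
  by case: phiS => _ _ _ ->//; exact: GFS.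
have Tpsi z : S z -> star T (psi z) = phi (th z).
  move=> Sz; rewrite thzE' sum_isom// star_sum lop_sumE big_seq [RHS]big_seq.
  apply: eq_bigr => x xF; rewrite star_theta thetaE; congr hact.
  by case: psiS => _ _ _ ->//; exact: FS.
have [M M0 TM] := lop_bd T.
have [K K0 FK] : exists2 K : R, 0 <= K & forall x, x \in F -> nrm x <= K.
  elim: (F) => [|x s [K K0 IH]]; first by exists 0.
  exists (Num.max (nrm x) K); first by rewrite le_max K0 orbT.
  move=> y; rewrite inE => /orP[/eqP ->|/IH H]; first by rewrite le_max lexx.
  by rewrite le_max H orbT.
(* If [W] is within [q <= 1] of [T], then [nrm (W w) <= (M + 1) * nrm w], so [T^* T w] and [W^* W w]
   differ by at most [q (2 M + 1) * nrm w], which is below [q c]. *)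
pose c := (2 * M + 2) * (K + 1).
have c0 : 0 < c by rewrite mulr_gt0//; lra.
pose q := Num.min 1 (d / c).
have q0 : 0 < q by rewrite lt_min ltr01 divr_gt0.
have q1 : q <= 1 by rewrite ge_min lexx.
have qc : q * c <= d by rewrite -ler_pdivlMr// ge_min lexx orbT.
have [W Wi HW] := invertible_sum sr1 [seq (psi x, phi (G x)) | x <- F] q0.
rewrite big_map -/T in HW.
have [U [Q [Uu Qp QQ WE]]] := polar Wi.
exists U => // x xF.
have Sx := FS x xF.
have Sth : S (th x) by rewrite thzE; exact: sum_in.
pose w := phi x.
have nw : nrm w <= K by rewrite (isom_nrm phiS Sx); exact: FK.
have W1 : nrm (W w - T w) <= d.
  apply: le_trans (HW w) _; apply: le_trans qc.
  by rewrite ler_pM2l// /c; have := mulr_ge0 M0 K0; lra.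
have QW : nrm (w - Q w) <= 4 * d.
  (* [1 + Q] does not shrink norms and sends [w - Q w] to [w - Q^2 w = w - W^* W w]. *)
  have Q1 := positive_exp (w - Q w) ler01 Qp.
  rewrite mul1r real1 lopB in Q1.
  have E1 : w - Q w + (Q w - Q (Q w)) = w - star W (W w).
    by rewrite addrA subrK -!lopME QQ.
  rewrite E1 in Q1; apply: le_trans Q1 _.
  have T1 : nrm (w - star T (T w)) <= 3 * d.
    rewrite Tphi// Tpsi// /w -(isomB cS phiS)//; last by rewrite thzE'; exact: sum_in.
    rewrite (isom_nrm phiS); last first.
      by apply: closed_submoduleB => //; rewrite thzE'; exact: sum_in.
    have := nrm_tri x (th x) (th (th x)); rewrite -lopB.
    by have := th2 (x - th x); have := thF x xF; lra.
  have T2 : nrm (star T (T w) - star W (W w)) <= d.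
    have -> : star T (T w) - star W (W w) =
       star T (T w - W w) + star (T - W) (W w).
      by rewrite lopB starB lopBE addrA subrK.
    apply: le_trans (nrmD _ _) _.
    have B1 := bd_star M0 TM (T w - W w).
    have B2 := bd_star (ltW q0) (bdC HW) (W w).
    have B3 := HW w; rewrite lopBE in B3.
    have B4 := nrm_tri (W w) (T w) 0; rewrite !subr0 in B4.
    have B5 := TM w; have n0 := nrm_ge0 w.
    rewrite [nrm (T w - _)]nrmC in B1.
    apply: le_trans qc; rewrite /c.
    have B6 : nrm (W w) <= (M + 1) * nrm w by nra.
    have B7 : q * nrm (W w) <= q * ((M + 1) * nrm w) by rewrite ler_pM2l.
    have B8 : M * nrm (W w - T w) <= M * (q * nrm w) by rewrite ler_wpM2l.
    have B9 : q * ((2 * M + 2) * nrm w) <= q * ((2 * M + 2) * (K + 1)).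
      by rewrite ler_pM2l// ler_wpM2l//; lra.
    nra.
  by have := nrm_tri w (star T (T w)) (star W (W w)); lra.
have UQ : nrm (U w - W w) <= 4 * d.
  by rewrite WE lopME -lopB (nrm_isom Uu.1).
have Tx : nrm (T w - psi x) <= d.
  rewrite Tphi// -(isomB cS psiS)// (isom_nrm psiS); first by rewrite nrmC; exact: thF.
  exact: closed_submoduleB.
have := nrm_tri (U w) (W w) (psi x); have := nrm_tri (W w) (T w) (psi x).
have e8 : 8 * d = e by rewrite /d mulrC divfK ?pnatr_eq0.
rewrite -/w; clearbody d; lra.
Qed.

End KeyLemma.

(** * Exhaustion by compactly contained subobjects *)

Section Threshold.
Variables (R : realType) (A : cstarAlgType R) (X : hilbertModType A).
Implicit Types (h p q S T U : lop X) (s : R).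

Definition bicomm h T := forall U, U * h = h * U -> U * T = T * U.

Lemma bicommC h S T : bicomm h S -> bicomm h T -> S * T = T * S.
Proof. by move=> hS hT; apply: hT; apply/esym/hS. Qed.

Lemma bicommD h S T : bicomm h S -> bicomm h T -> bicomm h (S + T).
Proof. by move=> hS hT U hU; rewrite mulrDr mulrDl hS ?hT. Qed.

Lemma bicommN h T : bicomm h T -> bicomm h (- T).
Proof. by move=> hT U hU; rewrite mulrN mulNr hT. Qed.

Lemma bicommM h S T : bicomm h S -> bicomm h T -> bicomm h (S * T).
Proof. by move=> hS hT U hU; rewrite mulrA hS// -mulrA hT// mulrA. Qed.

Lemma bicommZ h k T : bicomm h T -> bicomm h (k *: T).
Proof. by move=> hT U hU; rewrite lscalAl lscalAr hT. Qed.

Lemma bicomm1 h : bicomm h 1.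
Proof. by move=> U _; rewrite mulr1 mul1r. Qed.

Lemma bicommxx h : bicomm h h.
Proof. by []. Qed.

Lemma bicomm_inv h T G : bicomm h T -> T * G = 1 -> G * T = 1 -> bicomm h G.
Proof.
move=> hT TG GT U hU.
by rewrite -[LHS]mul1r -GT -!mulrA (mulrA T) -hT// -!mulrA TG mulr1.
Qed.

(* [p] and [q] are twice the positive and negative parts of [h - s]. *)
Definition threshold h s p q H :=
  [/\ [/\ star p = p, star q = q & positive H],
      [/\ bicomm h p, bicomm h q & bicomm h H],
      p * q = 0, p + q = H + H &
      p - q = (h - s%:C *: (1 : lop X)) + (h - s%:C *: (1 : lop X))].

Lemma threshold_ex h s B : 0 <= s -> 0 <= B -> star h = h -> bd h B ->
  exists p q H, threshold h s p q H /\ bd q (2 * (B + s)).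
Proof.
move=> s0 B0 hs hB; have [w wE] : exists w, w = h - s%:C *: (1 : lop X) by exists (h - s%:C *: (1 : lop X)).
have ws : star w = w by rewrite wE starB starR star1 hs.
have hw : bicomm h w.
  rewrite wE; apply: bicommD; first exact: bicommxx.
  exact/bicommN/bicommZ/bicomm1.
have wB : bd w (B + s).
  rewrite wE; apply: bdB => //; rewrite -[X in bd _ X]mulr1.
  exact: bdR s0 (@bd1 _ _ _).
have [H [Hp HH Hc]] := positive_sqrt (positive_sqr ws).
have Hs := positive_star Hp.
have hH : bicomm h H by move=> U hU; apply: Hc; apply: (bicommM hw hw).
have HB : bd H (B + s).
  move=> x; rewrite (_ : nrm (H x) = nrm (w x)); first exact: wB.
  apply/eqP; rewrite -(eqrXn2 (ltn0Sn 1)) ?nrm_ge0//.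
  by rewrite -!nrm_inner !starP Hs ws -!lopME HH.
have Hw : H * w = w * H by exact: bicommC hH hw.
exists (H + w), (H - w), H; split; last first.
  by rewrite mulr_natl mulr2n; exact: bdB.
split.
- by split; rewrite ?starB ?starD ?Hs ?ws.
- by split=> //; [exact: bicommD|apply: bicommD => //; exact: bicommN].
- by rewrite mulrBr !mulrDl HH Hw [w * w + _]addrC subrr.
- by rewrite addrACA subrr addr0.
- by rewrite -wE opprB addrC addrA subrK.
Qed.

Lemma dbl_inj S T : S + S = T + T -> S = T.
Proof. by move=> E; rewrite -[S]half2 E half2. Qed.

Section ThresholdTheory.
Variables (h p q H : lop X) (s : R).
Hypothesis th : threshold h s p q H.

Lemma threshold_qp : q * p = 0.
Proof. by case: th => _ [cp cq _] <- _ _; exact: bicommC cq cp. Qed.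

Lemma threshold_pp : p * p = p * H + p * H.
Proof.
case: th => _ _ pq pqH _; rewrite -mulrDr -pqH mulrDr pq addr0//.
Qed.

Lemma threshold_qq : q * q = q * H + q * H.
Proof.
case: th => _ _ _ pqH _; rewrite -mulrDr -pqH mulrDr threshold_qp add0r//.
Qed.

Lemma threshold_ppp : positive (p * p * p).
Proof.
have [[ps _ Hp] _ _ _ _] := th.
rewrite threshold_pp mulrDl -{1 3}ps.
by apply: positiveD; exact: positive_conj.
Qed.

Lemma threshold_qqq : positive (q * q * q).
Proof.
have [[_ qs Hp] _ _ _ _] := th.
rewrite threshold_qq mulrDl -{1 3}qs.
by apply: positiveD; exact: positive_conj.
Qed.

Lemma threshold_hp : (h - s%:C *: (1 : lop X)) * p = H * p.
Proof.
have [_ _ pq pqH pqw] := th; apply: dbl_inj.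
by rewrite -!mulrDl -pqw -pqH mulrBl mulrDl threshold_qp subr0 addr0.
Qed.

(* That is, [2 h q + q^2 = 2 s q]. *)
Lemma threshold_hq : (s%:C *: q - h * q) + (s%:C *: q - h * q) = q * q.
Proof.
have [_ _ pq pqH pqw] := th.
have := congr1 (fun T => - (T * q)) pqw; rewrite mulrBl pq sub0r opprK => ->.
by rewrite mulrDl mulrBl lscalAl mul1r opprD opprB.
Qed.

(** By [threshold_hp], [h] acts on the range of [p] as [s + H], so [(s + H)^-1 h] is the identity
    there. This operator will witness compact containment. *)
Lemma threshold_inv : 0 < s -> exists G : lop X,
  [/\ star G = G, bicomm h G & G * h * p = p].
Proof.
move=> s0; have [[_ _ Hp] [_ _ cH] _ _ _] := th.
have [G [HG GH _ Gs _]] := positive_inv s0 Hp.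
exists G; split=> //.
  apply: bicomm_inv HG GH; apply: bicommD => //; exact/bicommZ/bicomm1.
have -> : G * h * p = G * (s%:C *: (1 : lop X) + H) * p.
  by rewrite -!mulrA; congr (_ * _); rewrite mulrDl -threshold_hp mulrBl lscalAl mul1r addrC subrK.
by rewrite GH mul1r.
Qed.

(* The negative part of [h - s] has size at most of order [s^(1/4)]. *)
Lemma threshold_q_small B e : 0 < s -> 0 < B -> bd q B -> 0 < e ->
  2 * s * B ^+ 3 <= e ^+ 4 -> positive h -> bd q e.
Proof.
move=> s0 B0 qB e0 sB hp; have [[_ qs Hp] [_ cq _] pq pqH pqw] := th.
have q2B : bd (q * q) (B ^+ 2) by rewrite expr2; apply: bdM => //; exact: ltW.
have q2p : positive (q * q) by rewrite -{1}qs; exact: positive_starM.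
have [_ P] := pos_compl (exprn_gt0 2 B0) q2p q2B.
have sB2 : 0 <= 2 * s * B ^+ 2 by rewrite !mulr_ge0 ?ltW// exprn_ge0 ?ltW.
have q3 : bd (q * q * q) (2 * s * B ^+ 2).
  apply: positive_mono => //; first exact: threshold_qqq.
  (* By [threshold_hq], [q^3 = 2 (s q^2 - q h q)], which is at most [2 s q^2] because [q h q] is
     positive. *)
  have E : q * q * q = (s%:C *: (q * q) - q * h * q) + (s%:C *: (q * q) - q * h * q).
    by rewrite -{1}threshold_hq mulrDl mulrBl lscalAl (cq h).
  have -> : (2 * s * B ^+ 2)%:C *: (1 : lop X) - q * q * q =
     (2 * s)%:C *: ((B ^+ 2)%:C *: (1 : lop X) - q * q) + (q * h * q + q * h * q).
    rewrite E addrACA -opprD opprB scalerBr realCM -[(2 * s)%:C *: (q * q)]realCM real2.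
    by rewrite [LHS]addrA [RHS]addrAC.
  apply: positiveD; first by apply: positiveZ; [rewrite mulr_ge0 ?ltW|exists (B ^+ 2)].
  by rewrite -{1 3}qs; apply: positiveD; exact: positive_conj.
have q4 : bd (q * q * q * q) (e ^+ 4).
  have E4 : 2 * s * B ^+ 3 = 2 * s * B ^+ 2 * B by ring.
  by apply: bd_le (bdM sB2 q3 qB); rewrite -E4.
(* Descending from [q^4] to [q^2], and then to [q], uses [nrm (T x) ^+ 2 = nrm <<x, T^2 x>>] for
   self-adjoint [T]. *)
have q2 : bd (q * q) (e ^+ 2).
  move=> x; rewrite -(ler_pXn2r (ltn0Sn 1)) ?nnegrE ?mulr_ge0 ?nrm_ge0 ?exprn_ge0 ?(ltW e0)//.
  rewrite -nrm_inner starP starM qs -lopME mulrA.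
  apply: le_trans (inner_cs _ _) _; rewrite exprMn -exprM.
  by have := q4 x; have := nrm_ge0 x; nra.
move=> x; rewrite -(ler_pXn2r (ltn0Sn 1)) ?nnegrE ?mulr_ge0 ?nrm_ge0 ?(ltW e0)//.
rewrite -nrm_inner starP qs -lopME exprMn.
apply: le_trans (inner_cs _ _) _.
by have := q2 x; have := nrm_ge0 x; nra.
Qed.

End ThresholdTheory.

(* [p q'] squares to a nonpositive operator. *)
Lemma threshold_nest h s s' p q H p' q' H' : s' < s ->
  threshold h s p q H -> threshold h s' p' q' H' -> p * q' = 0.
Proof.
move=> ss th th'.
have [[ps _ _] [cp _ cH] pq pqH pqw] := th.
have [[_ qs' _] [_ cq' cH'] pq' pqH' pqw'] := th'.
have pq'C : p * q' = q' * p by exact: bicommC cp cq'.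
pose d := s - s'; have d0 : 0 < d by rewrite subr_gt0.
have ms : star (p * q') = p * q' by rewrite starM ps qs' pq'C.
have p3 := positive_conj q' (threshold_ppp th).
have q3 := positive_conj p (threshold_qqq th').
have wp : (h - s%:C *: (1 : lop X)) * p + (h - s%:C *: (1 : lop X)) * p = p * p.
  by rewrite (threshold_hp th) (threshold_pp th) (bicommC cH cp).
(* As [p^2 = 2 (h - s) p] and [q'^2 = 2 (s' - h) q'], the terms in [h] cancel. Multiplying by [p q']
   leaves positive terms on one side and [- 2 d (p q')^2] on the other. *)
have E : p * p * q' + p * q' * q' = - ((2 * d)%:C *: (p * q')).
  rewrite -wp -[p * q' * q']mulrA -(threshold_hq th').
  have -> : p * (s'%:C *: q' - h * q' + (s'%:C *: q' - h * q')) =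
      (s'%:C *: (p * q') - h * (p * q')) + (s'%:C *: (p * q') - h * (p * q')).
    by rewrite mulrDr mulrBr lscalAr !mulrA (cp h).
  rewrite mulrDl mulrBl lscalAl mul1r mulrBl lscalAl -[h * p * q']mulrA.
  rewrite addrACA [X in X + X](_ : _ = - (d%:C *: (p * q'))).
    by rewrite -opprD -real2 realCM.
  by rewrite addrC subrKA /d rmorphB scalerBl opprB.
have mm : (2 * d)%:C *: (p * q' * (p * q')) = 0.
  apply: positive_anti.
    apply: positiveZ; first by rewrite mulr_ge0 ?ltW.
    by rewrite -{1}ms; exact: positive_starM.
  have -> : - ((2 * d)%:C *: (p * q' * (p * q'))) =
      star q' * (p * p * p) * q' + star p * (q' * q' * q') * p.
    rewrite -lscalAl -mulNr -E mulrDl qs' ps; congr (_ + _).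
      have -> : p * p * q' = q' * (p * p) by rewrite -mulrA pq'C mulrA pq'C -mulrA.
      by rewrite !mulrA.
    have -> : p * q' * q' * (p * q') = p * q' * q' * (q' * p) by rewrite -pq'C.
    by rewrite !mulrA.
  exact: positiveD.
apply: star_starM0; rewrite ms; move/eqP: mm; rewrite scaler_eq0 => /orP[|/eqP//].
by rewrite eq_complex/= mulf_eq0 pnatr_eq0/= gt_eqF.
Qed.

(** Since [q' p = 0], [p' p = 2 (h - s') p = 2 (d + H) p] with [d = s - s'], and [d + H] is
    invertible. The factorization is exact, so the closures of the ranges are nested. *)
Lemma threshold_range h s s' p q H p' q' H' : s' < s ->
  threshold h s p q H -> threshold h s' p' q' H' -> exists T, p = p' * T.
Proof.
move=> ss th th'; have pq' := threshold_nest ss th th'.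
have [[ps _ Hp] [cp _ cH] pq pqH pqw] := th.
have [_ [cp' cq' _] _ _ pqw'] := th'.
pose d := s - s'; have d0 : 0 < d by rewrite subr_gt0.
have [G [HG GH _ _ _]] := positive_inv d0 Hp.
have E : (d%:C *: (1 : lop X) + H) * p + (d%:C *: (1 : lop X) + H) * p = p' * p.
  have -> : (d%:C *: (1 : lop X) + H) * p = (h - s'%:C *: (1 : lop X)) * p.
    rewrite mulrDl -(threshold_hp th) -mulrDl; congr (_ * _).
    by rewrite rmorphB scalerBl addrC addrA subrK.
  by rewrite -mulrDl -pqw' mulrBl (bicommC cq' cp) pq' subr0.
exists ((2^-1 : R)%:C *: (G * p)).
have cG : bicomm h G.
  by apply: bicomm_inv HG GH; apply: bicommD => //; exact/bicommZ/bicomm1.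
apply: dbl_inj; rewrite !lscalAr -scalerDr half2 mulrA -(bicommC cG cp') -mulrA -E.
by rewrite mulrDr mulrA GH mul1r.
Qed.

End Threshold.

Lemma inv_nat_small (R : realType) (c : R) : 0 < c -> exists n, n.+1%:R^-1 <= c.
Proof.
move=> c0; have := archi_boundP (ltW (divr_gt0 ltr01 c0)).
set n := Num.bound _ => H; exists n.
rewrite -[c]invrK lef_pV2 ?posrE ?invr_gt0 ?ltr0n//.
by move: H; rewrite mul1r => /ltW /le_trans; apply; rewrite ler_nat.
Qed.

Section Exhaustion.
Variables (R : realType) (A : cstarAlgType R) (X : hilbertModType A).
Implicit Types (x y : X) (S T U : lop X) (D : set X).

Definition generates (g : nat -> X) :=
  forall D, closed_submodule D -> (forall n, D (g n)) -> forall x, D x.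

Lemma cg_generates : cg_module X -> exists g : nat -> X, generates g.
Proof. by move=> [g _ Hg]; exists g => D cD Dg x; exact: (Hg D cD Dg). Qed.

Lemma ltends_star (F : nat -> lop X) U : ltends F U -> ltends (fun n => star (F n)) (star U).
Proof.
move=> FU e e0; have [N HN] := FU e e0; exists N => n Nn.
by rewrite -starB; apply: bd_star; [exact: ltW|exact: HN].
Qed.

Lemma ltends_pos (F : nat -> lop X) U t N : ltends F U ->
  (forall n, (N <= n)%N -> pos t (F n)) -> pos t U.
Proof.
move=> FU Ft; have [_ t0 _] := Ft N (leqnn N).
have FN : ltends (fun n => F (n + N)%N) U.
  move=> e /FU[M HM]; exists M => n Mn; apply: HM; exact: leq_trans (leq_addr _ _).
split=> //.
  apply: ltends_uniq (ltends_star FN) _.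
  rewrite (_ : (fun n => _) = (fun n => F (n + N)%N))//; apply/funext => n.
  by have [] := Ft (n + N)%N (leq_addl _ _).
have FN' : ltends (fun n => t%:C *: (1 : lop X) + (-1) *: F (n + N)%N) (t%:C *: (1 : lop X) - U).
  have -> : t%:C *: (1 : lop X) - U = t%:C *: (1 : lop X) + (-1) *: U by rewrite scaleN1r.
  exact: ltendsD (ltends_cst _) (ltendsZ _ FN).
apply: ltends_bd FN' _ => n; rewrite scaleN1r.
by have [] := Ft (n + N)%N (leq_addl _ _).
Qed.

Lemma generates_scale (g : nat -> X) (s : nat -> R) : (forall n, 0 < s n) ->
  generates g -> generates (fun n => (s n)%:C *: g n).
Proof.
move=> s0 gg D cD Dg; apply: gg => // n.
have [_ _ DZ _ _] := cD; have := DZ (s n)^-1%:C _ (Dg n).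
by rewrite realCM mulVf ?gt_eqF// real1.
Qed.

(** [h] is the sum of all [theta (g i) (g i)]. Positivity of what remains after removing one term is
    the input of [approx_unit], which then puts [g i] in the closure of the range of [h]. *)
Lemma strictly_positive (g : nat -> X) :
  (forall n, nrm (g n) <= (2^-1) ^+ n.+1) -> exists h : lop X,
  [/\ positive h, forall i, exists2 h' : lop X, positive h' & h = theta (g i) (g i) + h' &
      ltends (fun n => \sum_(j < n) theta (g j) (g j)) h].
Proof.
move=> gn.
pose F n : lop X := \sum_(j < n) theta (g j) (g j).
have FS n : F n.+1 = F n + theta (g n) (g n) by rewrite /F big_ord_recr.
pose r n : R := - (2^-1) ^+ n.
have rS n : r n.+1 - r n = (2^-1) ^+ n.+1 by rewrite /r exprS; field.
have p0 n : 0 < (2^-1 : R) ^+ n by rewrite exprn_gt0// invr_gt0.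
have p1 n : (2^-1 : R) ^+ n <= 1 by rewrite exprn_ile1 ?invr_ge0// invf_le1// ler1n.
have g2 n : nrm (g n) * nrm (g n) <= (2^-1) ^+ n.+1.
  by have := gn n; have := nrm_ge0 (g n); have := p1 n.+1; nra.
have th_pos n : pos ((2^-1) ^+ n.+1) (theta (g n) (g n)).
  by apply: theta_pos; rewrite ?expr2.
have Fstar n : star (F n) = F n.
  by rewrite /F star_sum; apply: eq_bigr => i _; rewrite star_theta.
have step n : bd (F n.+1 - F n) (r n.+1 - r n).
  rewrite FS rS addrC addKr; apply: bd_le (theta_bd _ _); exact: g2.
have [||||h [Fh _]] := @lop_lim _ _ _ F r 0.
- by move=> n; rewrite -subr_ge0 rS ltW.
- by move=> n; rewrite oppr_le0 ltW.
- exact: step.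
- by move=> n; rewrite !Fstar; exact: step.
(* The constants in [pos] add up: 1 for the empty sum and [2^-(n+1)] for each term, so they stay
   below 2 and pass to the limit. *)
have t0 n : 0 < 2 + r n by rewrite /r; have := p1 n; lra.
have tS n : 2 + r n + (2^-1) ^+ n.+1 = 2 + r n.+1 by have := rS n; lra.
have posF n : pos (2 + r n) (F n).
  elim: n => [|n IH]; last by rewrite FS -tS; exact: posD.
  rewrite /F big_ord0; apply: (@pos_le _ _ _ 1); last exact: pos0.
  by rewrite /r expr0; lra.
exists h; split=> //.
  exists 2; apply: (ltends_pos Fh (N := 0)) => n _.
  by apply: pos_le (posF n); rewrite gerDl oppr_le0 ltW.
move=> i; exists (h - theta (g i) (g i)); last by rewrite addrC subrK.
have pos' n : (i < n)%N -> pos (2 + r n) (F n - theta (g i) (g i)).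
  elim: n => // n IH; rewrite ltnS leq_eqVlt => /orP[/eqP <-|/IH H].
    by rewrite FS addrK; apply: pos_le (posF i); rewrite -tS lerDl ltW.
  by rewrite FS [F n + _ - _]addrAC -tS; exact: posD.
exists 2; apply: (@ltends_pos (fun n => F n - theta (g i) (g i)) _ _ i.+1).
  by apply: ltendsD Fh _; exact: ltends_cst.
by move=> n /pos'; apply: pos_le; rewrite gerDl oppr_le0 ltW.
Qed.

Definition clrange P : set X := [set x | forall e : R, 0 < e -> exists y, nrm (x - lfun P y) < e].

Lemma clrange_in (P : lop X) x : clrange P (P x).
Proof. by move=> e e0; exists x; rewrite subrr nrm0. Qed.

Lemma clrange_closed (P : lop X) : closed_submodule (clrange P).
Proof.
split.
- by move=> e e0; exists 0; rewrite lop0x subrr nrm0.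
- move=> x y Px Py e e0; have e2 : 0 < e / 2 by lra.
  have [u xu] := Px _ e2; have [v yv] := Py _ e2.
  exists (u + v); rewrite lopD opprD addrACA [e]splitr.
  exact: le_lt_trans (nrmD _ _) (ltrD xu yv).
- move=> k x Px e e0.
  have k0 : 0 <= complex.Re `|k| by rewrite -ler0c RRe_real// ger0_real.
  have [|u xu] := Px (e / (complex.Re `|k| + 1)); first by rewrite divr_gt0//; lra.
  exists (k *: u); rewrite lopZ -scalerBr nrmZc.
  by move: xu; rewrite ltr_pdivlMr; have := nrm_ge0 (x - P u); nra.
- move=> x a Px e e0; have a0 := nrm_ge0 a.
  have [|u xu] := Px (e / (nrm a + 1)); first by rewrite divr_gt0//; lra.
  exists (hact u a); rewrite lop_hact -hactBl; apply: le_lt_trans (nrm_hact _ _) _.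
  by move: xu; rewrite ltr_pdivlMr; have := nrm_ge0 (x - P u); nra.
- apply/closed_nrm => x H e e0; have e2 : 0 < e / 2 by lra.
  have [s Ps xs] := H _ e2; have [y sy] := Ps _ e2.
  by exists y; have := nrm_tri x s (P y); lra.
Qed.

Lemma clrange_sub (P : lop X) D : closed_submodule D -> (forall x, D (P x)) ->
  clrange P `<=` D.
Proof.
move=> [_ _ _ _ /closed_nrm cD] DP x Px; apply: cD => e e0.
by have [y xy] := Px e e0; exists (P y).
Qed.

Lemma preim_closed (P : lop X) D : closed_submodule D -> closed_submodule [set x | D (P x)].
Proof.
move=> [D0 DD DZ Da cD]; split=> /=.
- by rewrite lop0x.
- by move=> x y; rewrite lopD; exact: DD.
- by move=> k x; rewrite lopZ; exact: DZ.
- by move=> x a; rewrite lop_hact; exact: Da.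
- apply/closed_nrm => x H; move/closed_nrm: cD; apply=> e e0.
  have [M M0 PM] := lop_bd P.
  have [|s Ds xs] := H (e / (M + 1)); first by rewrite divr_gt0//; lra.
  exists (P s) => //; rewrite -lopB; apply: le_lt_trans (PM _) _.
  by move: xs; rewrite ltr_pdivlMr; have := nrm_ge0 (x - s); nra.
Qed.

Lemma clrange_cg (g : nat -> X) (P : lop X) : generates g -> countably_generated (clrange P).
Proof.
move=> gg; exists (fun n => P (g n)); first by move=> n; exact: clrange_in.
move=> D cD DPg; apply: clrange_sub => //.
by apply: (gg [set x | D (P x)]) => //; exact: preim_closed.
Qed.

Lemma clrange_fix (P T : lop X) : T * P = P -> forall x, clrange P x -> T x = x.
Proof.
move=> TP x Px; apply/eqP; rewrite -subr_eq0; apply/eqP/nrm_eps => e e0.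
have [M M0 TM] := lop_bd T.
have [|y xy] := Px (e / (M + 1)); first by rewrite divr_gt0//; lra.
have E : T x - x = T (x - P y) - (x - P y).
  by rewrite lopB -lopME TP opprB addrA subrK.
rewrite E; apply: le_trans (nrmB _ _) _.
by move: xy; rewrite ltr_pdivlMr; have := TM (x - P y); lra.
Qed.

Lemma lop_module_endo T : module_endomorphism T.
Proof.
split; [exact: lopD|move=> k x; exact: lopZ|move=> x a; exact: lop_hact].
Qed.

Lemma exhaustion : cg_module X -> exists S : nat -> set X,
  [/\ forall n, compactly_contained (S n), forall n, S n `<=` S n.+1 &
      forall D, closed_submodule D -> (forall n, S n `<=` D) -> forall x, D x].
Proof.
move=> /cg_generates[g0 gg0].
(* Scaling makes the sum of rank one operators converge; the [+ 1] allows for zero generators. *)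
pose s n : R := (2^-1) ^+ n.+1 / (nrm (g0 n) + 1).
have p0 n : 0 < (2^-1 : R) ^+ n by rewrite exprn_gt0// invr_gt0.
have s0 n : 0 < s n by rewrite divr_gt0//; have := nrm_ge0 (g0 n); lra.
pose g n := (s n)%:C *: g0 n.
have gg : generates g by exact: generates_scale.
have gn n : nrm (g n) <= (2^-1) ^+ n.+1.
  rewrite nrmZp ?(ltW (s0 n))// /s mulrAC ler_pdivrMr.
    by rewrite ler_pM2l//; lra.
  by have := nrm_ge0 (g0 n); lra.
have [h [hp hg hlim]] := strictly_positive gn.
have hs := positive_star hp.
have [B B0 hB] := lop_bdp h.
pose t n : R := n.+1%:R^-1.
have t0 n : 0 < t n by rewrite invr_gt0 ltr0n.
have t1 n : t n <= 1 by rewrite invf_le1// ler1n.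
have tS n : t n.+1 < t n by rewrite ltf_pV2 ?posrE ?ltr0n// ltr_nat.
have thr n : exists f : lop X * lop X * lop X,
    threshold h (t n) f.1.1 f.1.2 f.2 /\ bd f.1.2 (2 * (B + 1)).
  have [p [q [H [th qb]]]] := threshold_ex (ltW (t0 n)) (ltW B0) hs hB.
  exists (p, q, H); split=> //; apply: bd_le qb.
  by rewrite ler_pM2l// lerD2l.
have [f Hf] := choice thr.
pose P n := (f n).1.1; pose Q n := (f n).1.2.
have th n : threshold h (t n) (P n) (Q n) (f n).2 by case: (Hf n).
have Qb n : bd (Q n) (2 * (B + 1)) by case: (Hf n).
exists (fun n => clrange (P n)); split.
- move=> n; split; first by split; [exact: clrange_closed|exact: clrange_cg gg].
  have [G [Gs Gc GhP]] := threshold_inv (th n) (t0 n).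
  have Gh : G * h = h * G by apply/esym/Gc.
  (* [G] commutes with [h], so [G h] is self-adjoint. It is the norm limit of the sums of
     [theta (G (g j)) (g j)], hence compact. *)
  exists (G * h : lop X); split; last exact: clrange_fix GhP.
    split; first exact: lop_module_endo.
    move=> e e0; have [M M0 GM] := lop_bdp G.
    have [|N HN] := hlim (e / M); first by rewrite divr_gt0.
    exists N, (fun=> 1), (fun i => G (g i)), (fun i => g i) => x.
    have -> : \sum_(i < N) 1 *: rank_one (G (g i)) (g i) x =
        G ((\sum_(j < N) theta (g j) (g j) : lop X) x).
      rewrite lop_sumE (big_morph G (lopD G) (lop0x G)); apply: eq_bigr => i _.
      by rewrite scale1r thetaE lop_hact.
    rewrite -!nrmE -rmorphM lecR lopME -lopB -lopBE.
    apply: le_trans (GM _) _; rewrite mulrC -ler_pdivlMr//.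
    by rewrite mulrAC; exact: (bdC (HN N (leqnn N))).
  by move=> x y; rewrite starP starM hs Gs -Gh.
- move=> n; apply: clrange_sub; first exact: clrange_closed.
  have [T PT] := threshold_range (tS n) (th n) (th n.+1).
  by move=> x; rewrite PT; exact: clrange_in.
- move=> D cD SD; apply: gg => // i.
  have [_ DD DZ _ /closed_nrm Dcl] := cD.
  (* [h - P n / 2 = t n - Q n / 2], where both terms tend to 0, so [h x] is a limit of vectors of
     the [S n]. *)
  have Dh x : D (h x).
    apply: Dcl => e e0.
    have nx := nrm_ge0 x.
    pose e' := e / (2 * (nrm x + 1)).
    have e'0 : 0 < e' by rewrite divr_gt0//; lra.
    pose B' := 2 * (B + 1); have B'0 : 0 < B' by rewrite /B'; lra.
    have [n Hn] : exists n, 2 * t n * B' ^+ 3 <= e' ^+ 4 /\ t n <= e'.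
      have B3 : 0 < B' ^+ 3 by exact: exprn_gt0.
      have [|n] := @inv_nat_small _ (Num.min e' (e' ^+ 4 / (2 * B' ^+ 3))).
        by rewrite lt_min e'0 divr_gt0 ?exprn_gt0// pmulr_rgt0.
      rewrite le_min => /andP[H1 H2]; exists n; split=> //.
      have B23 : 0 < 2 * B' ^+ 3 by rewrite pmulr_rgt0.
      by move: H2; rewrite ler_pdivlMr// -/(t n) [t n * _]mulrA (mulrC (t n)).
    have Qe := threshold_q_small (th n) (t0 n) B'0 (Qb n) e'0 Hn.1 hp.
    exists ((2^-1 : R)%:C *: P n x).
      by apply: DZ; apply: (SD n); exact: clrange_in.
    have -> : h x - (2^-1 : R)%:C *: P n x = (t n)%:C *: x - (2^-1 : R)%:C *: Q n x.
      have [_ _ _ _ pqw] := th n.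
      have := congr1 (fun T : lop X => ((2^-1 : R)%:C *: T) x) pqw.
      rewrite half2 scalerBr !lopE => E.
      have -> : h x = (2^-1 : R)%:C *: P n x - (2^-1 : R)%:C *: Q n x + (t n)%:C *: x.
        by rewrite E subrK.
      by rewrite addrAC [_ - _ - _]addrAC subrr add0r addrC.
    apply: le_lt_trans (nrmB _ _) _; rewrite !nrmZp ?invr_ge0 ?(ltW (t0 n))//.
    have := Qe x; have : t n * nrm x <= e' * nrm x by rewrite ler_wpM2r// Hn.2.
    have : e' * (2 * (nrm x + 1)) = e by rewrite /e' divfK//; rewrite gt_eqF//; lra.
    by nra.
  apply: Dcl => e e0.
  have [h' h'p hE] := hg i.
  have e20 : 0 < (e / 2) ^+ 2 by rewrite exprn_gt0//; lra.
  have [G [hG _ _ _ _]] := positive_inv e20 hp.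
  exists (h (G (g i))) => //.
  have := approx_unit e20 h'p hE hG; rewrite ler_pXn2r ?nnegrE ?nrm_ge0//; last by lra.
  by rewrite lopME; lra.
Qed.

End Exhaustion.

(** * Intertwining *)

Section LimitIsometry.
Variables (R : realType) (A : cstarAlgType R) (X Y : hilbertModType A).
Variables (S : nat -> set X) (Phi : nat -> X -> Y).
Hypothesis cS : forall n, closed_submodule (S n).
Hypothesis PhiS : forall n, isom_on (S n) (Phi n).
Implicit Types (x s : X) (y : Y).

(* The graph of the limit isometry: its domain is seen to be a closed submodule
   before it is known to be everything. *)
Definition limrel x y := forall e : R, 0 < e -> exists N, forall n, (N <= n)%N ->
  exists s, [/\ S n s, nrm (x - s) <= e & nrm (y - Phi n s) <= e].

Lemma nrm_innerB (Z : hilbertModType A) (x x' y y' : Z) :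
  nrm (<< x, y >> - << x', y' >> : A) <= nrm (x - x') * nrm y + nrm x' * nrm (y - y').
Proof.
have -> : << x, y >> - << x', y' >> = << x - x', y >> + << x', y - y' >> :> A.
  by rewrite innerBl innerBr addrA subrK.
apply: le_trans (nrmD _ _) _; apply: lerD; exact: inner_cs.
Qed.

Lemma limrelD x x' y y' : limrel x y -> limrel x' y' -> limrel (x + x') (y + y').
Proof.
move=> H H' e e0; have e2 : 0 < e / 2 by lra.
have [N HN] := H _ e2; have [M HM] := H' _ e2.
exists (maxn N M) => n; rewrite geq_max => /andP[/HN [s [Ss xs ys]] /HM [s' [Ss' xs' ys']]].
have [_ SD _ _ _] := cS n; have [fD _ _ _] := PhiS n.
exists (s + s'); split; first exact: SD.
  by rewrite opprD addrACA; have := nrmD (x - s) (x' - s'); lra.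
by rewrite fD// opprD addrACA; have := nrmD (y - Phi n s) (y' - Phi n s'); lra.
Qed.

Lemma limrelZ (k : R[i]) x y : limrel x y -> limrel (k *: x) (k *: y).
Proof.
move=> H e e0.
have k0 : 0 <= complex.Re `|k| by rewrite -ler0c RRe_real// ger0_real.
have [|N HN] := H (e / (complex.Re `|k| + 1)); first by rewrite divr_gt0//; lra.
exists N => n /HN[s [Ss xs ys]]; have [_ _ SZ _ _] := cS n; have [_ fZ _ _] := PhiS n.
exists (k *: s); split; first exact: SZ.
  rewrite -scalerBr nrmZc; move: xs; rewrite ler_pdivlMr; last by lra.
  by have := nrm_ge0 (x - s); nra.
rewrite fZ// -scalerBr nrmZc; move: ys; rewrite ler_pdivlMr; last by lra.
by have := nrm_ge0 (y - Phi n s); nra.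
Qed.

Lemma limrel_hact x y a : limrel x y -> limrel (hact x a) (hact y a).
Proof.
move=> H e e0; have a0 := nrm_ge0 a.
have [|N HN] := H (e / (nrm a + 1)); first by rewrite divr_gt0//; lra.
exists N => n /HN[s [Ss xs ys]]; have [_ _ _ Sa _] := cS n; have [_ _ fa _] := PhiS n.
exists (hact s a); split; first exact: Sa.
  rewrite -hactBl; apply: le_trans (nrm_hact _ _) _.
  move: xs; rewrite ler_pdivlMr; last by lra.
  by have := nrm_ge0 (x - s); nra.
rewrite fa// -hactBl; apply: le_trans (nrm_hact _ _) _.
move: ys; rewrite ler_pdivlMr; last by lra.
by have := nrm_ge0 (y - Phi n s); nra.
Qed.

Lemma limrelB x x' y y' : limrel x y -> limrel x' y' -> limrel (x - x') (y - y').
Proof. by move=> H /(limrelZ (-1)); rewrite !scaleN1r; exact: limrelD. Qed.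

Lemma limrel_inner x x' y y' : limrel x y -> limrel x' y' ->
  << y, y' >> = << x, x' >> :> A.
Proof.
move=> H H'; apply/eqP; rewrite -subr_eq0; apply/eqP/nrm_eps => e e0.
have nx := nrm_ge0 x; have nx' := nrm_ge0 x'; have ny := nrm_ge0 y; have ny' := nrm_ge0 y'.
(* The total coefficient of [d] in the error terms [C1] to [C4], given [d <= 1]. *)
pose c := 2 + nrm x + nrm x' + nrm y + nrm y'.
have c0 : 0 < c by rewrite /c; lra.
pose d := Num.min 1 (e / c).
have d0 : 0 < d by rewrite lt_min ltr01 divr_gt0.
have d1 : d <= 1 by rewrite ge_min lexx.
have dc : d * c <= e by rewrite -ler_pdivlMr// ge_min lexx orbT.
have [N HN] := H d d0; have [M HM] := H' d d0.
have [s [Ss xs ys]] := HN _ (leq_maxl N M).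
have [s' [Ss' xs' ys']] := HM _ (leq_maxr N M).
set n := maxn N M in Ss ys Ss' ys'.
have [_ _ _ fi] := PhiS n.
have -> : << y, y' >> - << x, x' >> =
   (<< y, y' >> - << Phi n s, Phi n s' >>) - (<< x, x' >> - << s, s' >>) :> A.
  by rewrite fi// opprB addrA subrK.
apply: le_trans (nrmB _ _) _; apply: le_trans dc.
apply: le_trans (lerD (nrm_innerB _ _ _ _) (nrm_innerB _ _ _ _)) _.
have B1 : nrm (Phi n s) <= nrm y + d.
  by have := nrm_tri (Phi n s) y 0; rewrite !subr0 nrmC; lra.
have B2 : nrm s <= nrm x + d.
  by have := nrm_tri s x 0; rewrite !subr0 nrmC; lra.
have C1 : nrm (y - Phi n s) * nrm y' <= d * nrm y' by rewrite ler_wpM2r.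
have C2 : nrm (x - s) * nrm x' <= d * nrm x' by rewrite ler_wpM2r.
have C3 : nrm (Phi n s) * nrm (y' - Phi n s') <= (nrm y + 1) * d.
  by apply: ler_pM; rewrite ?nrm_ge0//; lra.
have C4 : nrm s * nrm (x' - s') <= (nrm x + 1) * d.
  by apply: ler_pM; rewrite ?nrm_ge0//; lra.
by rewrite /c; nra.
Qed.

Lemma limrel_nrm x y : limrel x y -> nrm y = nrm x.
Proof.
move=> H; apply/eqP; rewrite -(eqrXn2 (ltn0Sn 1)) ?nrm_ge0//.
by rewrite -!nrm_inner (limrel_inner H H).
Qed.

Lemma limrel_uniq x y y' : limrel x y -> limrel x y' -> y = y'.
Proof.
move=> H H'; apply/eqP; rewrite -subr_eq0; apply/eqP/nrm_le0.
by rewrite (limrel_nrm (limrelB H H')) subrr nrm0.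
Qed.

Lemma limrel0 : limrel 0 0.
Proof.
move=> e e0; exists 0%N => n _; have [S0 _ _ _ _] := cS n; have [_ fZ _ _] := PhiS n.
exists 0; have := fZ 0 0 S0; rewrite !scale0r => ->.
by rewrite !subr0 !nrm0; split=> //; exact: ltW.
Qed.

Lemma limrel_closed : closed_submodule [set x | exists y, limrel x y].
Proof.
split=> /=.
- by exists 0; exact: limrel0.
- by move=> x x' [y xy] [y' xy']; exists (y + y'); exact: limrelD.
- by move=> k x [y xy]; exists (k *: y); exact: limrelZ.
- by move=> x a [y xy]; exists (hact y a); exact: limrel_hact.
apply/closed_nrm => x H.
have t0 n : 0 < (n.+1%:R : R)^-1 by rewrite invr_gt0 ltr0n.
have /choice[u Hu] : forall n, exists p : X * Y, limrel p.1 p.2 /\ nrm (x - p.1) < n.+1%:R^-1.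
  by move=> n; have [s [y sy] xs] := H _ (t0 n); exists (s, y).
have mono n m : (n <= m)%N -> (m.+1%:R : R)^-1 <= n.+1%:R^-1.
  by move=> nm; rewrite lef_pV2 ?posrE ?ltr0n// ler_nat ltnS.
have [y uy] : exists y, tends (fun n => (u n).2) y.
  apply: tends_cauchy => e e0.
  have [|N HN] := @inv_nat_small _ (e / 2); first by lra.
  exists N => m n Nm Nn.
  have [[Lm xm] [Ln xn]] := (Hu m, Hu n).
  rewrite (limrel_nrm (limrelB Lm Ln)).
  have := nrm_tri (u m).1 x (u n).1; rewrite (nrmC (u m).1 x).
  have := lt_le_trans xm (le_trans (mono _ _ Nm) HN).
  by have := lt_le_trans xn (le_trans (mono _ _ Nn) HN); lra.
exists y => e e0; have e3 : 0 < e / 3 by lra.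
have [N HN] := uy _ e3; have [M HM] := inv_nat_small e3.
set k := maxn N M.
have yk := HN k (leq_maxl N M).
have [Lk xk0] := Hu k; have xk := lt_le_trans xk0 (le_trans (mono _ _ (leq_maxr N M)) HM).
have [K HK] := Lk _ e3.
exists K => n /HK[s [Ss xs ys]]; exists s; split=> //.
  by have := nrm_tri x (u k).1 s; lra.
by have := nrm_tri y (u k).2 (Phi n s); rewrite (nrmC y (u k).2); lra.
Qed.

Hypothesis nestS : forall n, S n `<=` S n.+1.

(** Convergence on a generating set is enough, because the domain of the limit relation is a closed
    submodule. *)
Lemma limit_isometry (D : set X) :
  (forall T, closed_submodule T -> D `<=` T -> forall x, T x) ->
  (forall x, D x -> exists N y, S N x /\ tends (fun n => Phi n x) y) ->
  exists f : X -> Y, isom_on setT f /\ forall x, D x -> tends (fun n => Phi n x) (f x).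
Proof.
move=> genD DS.
have nest N n x : (N <= n)%N -> S N x -> S n x.
  by move=> /subnK <-; elim: (n - N)%N => // k IH /IH; exact: nestS.
have Dlim x N y : S N x -> tends (fun n => Phi n x) y -> limrel x y.
  move=> SN xy e /[dup] e0 /xy[M HM]; exists (maxn N M) => n.
  rewrite geq_max => /andP[Nn /HM Mn]; exists x; split; first exact: nest Nn SN.
    by rewrite subrr nrm0 ltW.
  by rewrite nrmC.
have total : forall x, exists y, limrel x y.
  apply: (genD _ limrel_closed) => x /DS[N [y [SN xy]]].
  by exists y; exact: (Dlim _ _ _ SN xy).
have [f Hf] := choice total.
exists f; split; last first.
  move=> x /DS[N [y [SN xy]]].
  by rewrite (limrel_uniq (Hf x) (Dlim _ _ _ SN xy)).
split=> [x y _ _|k x _|x a _|x y _ _].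
- exact: limrel_uniq (Hf _) (limrelD (Hf x) (Hf y)).
- exact: limrel_uniq (Hf _) (limrelZ k (Hf x)).
- exact: limrel_uniq (Hf _) (limrel_hact a (Hf x)).
- exact: (limrel_inner (Hf x) (Hf y)).
Qed.

End LimitIsometry.

Section Geometric.
Variables (R : realType) (V : completeNormedModType R[i]).

Lemma half_pow_gt0 n : 0 < (2^-1 : R) ^+ n.
Proof. by rewrite exprn_gt0// invr_gt0. Qed.

Lemma half_pow_small (e : R) : 0 < e -> exists n, forall m, (n <= m)%N -> (2^-1 : R) ^+ m <= e.
Proof.
move=> /inv_nat_small[n Hn]; exists n => m nm; apply: le_trans Hn.
rewrite exprVn lef_pV2 ?posrE ?exprn_gt0 ?ltr0n// -natrX ler_nat.
exact: leq_ltn_trans nm (ltn_expl _ _).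
Qed.

Lemma geom_tends (v : nat -> V) N :
  (forall n, (N <= n)%N -> nrm (v n.+1 - v n) <= (2^-1) ^+ n) ->
  exists2 l, tends v l & nrm (l - v N) <= 2 * (2^-1) ^+ N.
Proof.
move=> Hv.
have key m n : (N <= m)%N -> (m <= n)%N -> nrm (v n - v m) <= 2 * (2^-1) ^+ m.
  move=> Nm /subnK <-; set k := (n - m)%N.
  suff : nrm (v (k + m)%N - v m) <= 2 * (2^-1) ^+ m - 2 * (2^-1) ^+ (k + m)%N.
    by have := half_pow_gt0 (k + m)%N; lra.
  elim: k => [|k IH]; first by rewrite add0n !subrr nrm0.
  have := nrm_tri (v (k.+1 + m)%N) (v (k + m)%N) (v m).
  have := Hv (k + m)%N (leq_trans Nm (leq_addl _ _)).
  by rewrite !addSn exprS; lra.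
have [l vl] : exists l, tends v l.
  apply: tends_cauchy => e e0; have [|M HM] := @half_pow_small (e / 2); first by lra.
  exists (maxn N M) => m n; rewrite !geq_max => /andP[Nm Mm] /andP[Nn Mn].
  have [mn|/ltnW nm] := leqP m n.
    by rewrite nrmC; apply: le_trans (key _ _ Nm mn) _; have := HM m Mm; lra.
  by apply: le_trans (key _ _ Nn nm) _; have := HM n Mn; lra.
exists l => //.
have H : tends (fun n => v n - v N) (l - v N) by apply: tendsD vl _; exact: tends_cst.
by apply: (tends_le H (N := N)) => n; exact: key.
Qed.

End Geometric.

Section Intertwining.
Variables (R : realType) (A : cstarAlgType R) (X Y : hilbertModType A).
Hypothesis sr1 : stable_rank_one A.

Lemma unitary_isom (Z W : hilbertModType A) (S : set Z) (f : Z -> W) (u : lop W) :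
  unitary u -> isom_on S f -> isom_on S (fun x => u (f x)).
Proof.
move=> [uu _] [fD fZ fa fi]; split.
- by move=> x y Sx Sy; rewrite fD// lopD.
- by move=> k x Sx; rewrite fZ// lopZ.
- by move=> x a Sx; rewrite fa// lop_hact.
- by move=> x y Sx Sy; rewrite starP -lopME uu lop1E fi.
Qed.

Lemma isom_on_sub (Z W : hilbertModType A) (S T : set Z) (f : Z -> W) :
  S `<=` T -> isom_on T f -> isom_on S f.
Proof.
move=> ST [fD fZ fa fi]; split=> [x y /ST Sx /ST|k x /ST|x a /ST|x y /ST Sx /ST].
- exact: fD.
- exact: fZ.
- exact: fa.
- exact: fi.
Qed.

Lemma isom_comp (Z W V : hilbertModType A) (f : Z -> W) (g : W -> V) :
  isom_on setT f -> isom_on setT g -> isom_on setT (fun x => g (f x)).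
Proof.
move=> [fD fZ fa fi] [gD gZ ga gi]; split=> *.
- by rewrite fD// gD.
- by rewrite fZ// gZ.
- by rewrite fa// ga.
- by rewrite gi// fi.
Qed.

Lemma isom_id (Z : hilbertModType A) : isom_on [set: Z] id.
Proof. by []. Qed.

Lemma closed_submoduleT (Z : hilbertModType A) : closed_submodule [set: Z].
Proof. by split=> //; exact: closedT. Qed.

Lemma isom_inj (Z W : hilbertModType A) (S : set Z) (f : Z -> W) x y :
  closed_submodule S -> isom_on S f -> S x -> S y -> f x = f y -> x = y.
Proof.
move=> cS fS Sx Sy fxy; apply/eqP; rewrite -subr_eq0; apply/eqP/nrm_le0.
rewrite -(isom_nrm fS); last exact: closed_submoduleB.
by rewrite (isomB cS fS)// fxy subrr nrm0.
Qed.

Lemma isom_image_closed (Z W : hilbertModType A) (S : set Z) (f : Z -> W) :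
  closed_submodule S -> isom_on S f -> closed_submodule (f @` S).
Proof.
move=> cS fS; have [S0 SD SZ Sa Scl] := cS; have [fD fZ fa fi] := fS.
split.
- by exists 0 => //; have := fZ 0 0 S0; rewrite !scale0r.
- by move=> _ _ [x Sx <-] [y Sy <-]; exists (x + y); [exact: SD|exact: fD].
- by move=> k _ [x Sx <-]; exists (k *: x); [exact: SZ|exact: fZ].
- by move=> _ a [x Sx <-]; exists (hact x a); [exact: Sa|exact: fa].
apply/closed_nrm => w H.
have t0 n : 0 < (n.+1%:R : R)^-1 by rewrite invr_gt0 ltr0n.
have /choice[u Hu] : forall n, exists x, S x /\ nrm (w - f x) < n.+1%:R^-1.
  by move=> n; have [_ [x Sx <-] wx] := H _ (t0 n); exists x.
have mono n m : (n <= m)%N -> (m.+1%:R : R)^-1 <= n.+1%:R^-1.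
  by move=> nm; rewrite lef_pV2 ?posrE ?ltr0n// ler_nat ltnS.
have [x ux] : exists x, tends u x.
  apply: tends_cauchy => e e0.
  have [|N HN] := @inv_nat_small _ (e / 2); first by lra.
  exists N => m n Nm Nn.
  have [[Sm wm] [Sn wn]] := (Hu m, Hu n).
  rewrite -(isom_nrm fS); last exact: closed_submoduleB.
  rewrite (isomB cS fS)//.
  have := nrm_tri (f (u m)) w (f (u n)); rewrite (nrmC (f (u m)) w).
  have := lt_le_trans wm (le_trans (mono _ _ Nm) HN).
  by have := lt_le_trans wn (le_trans (mono _ _ Nn) HN); lra.
have Sx : S x by apply: closed_tends Scl _ ux => n; case: (Hu n).
exists x => //; apply/eqP; rewrite -subr_eq0; apply/eqP/nrm_eps => e e0.
have e2 : 0 < e / 2 by lra.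
have [N HN] := ux _ e2; have [M HM] := inv_nat_small e2.
set k := maxn N M.
have [Sk wk0] := Hu k; have wk := lt_le_trans wk0 (le_trans (mono _ _ (leq_maxr N M)) HM).
have xk := HN k (leq_maxl N M).
rewrite -(isom_nrm fS) in xk; last exact: closed_submoduleB.
rewrite (isomB cS fS)// in xk.
by have := nrm_tri (f x) (f (u k)) w; rewrite (nrmC (f x) (f (u k))) (nrmC (f (u k)) w); lra.
Qed.

Lemma isom_image_cg (Z W : hilbertModType A) (S : set Z) (f : Z -> W) :
  closed_submodule S -> isom_on S f -> countably_generated S ->
  countably_generated (f @` S).
Proof.
move=> cS fS [g Sg gS]; exists (fun n => f (g n)); first by move=> n; exists (g n).
move=> D cD Dfg _ [x Sx <-].
have [S0 SD SZ Sa Scl] := cS; have [fD fZ fa fi] := fS.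
have [D0 DD DZ Da Dcl] := cD.
suff H : [set x | S x /\ D (f x)] x by case: H.
apply: gS Sx; last by move=> n /=.
split=> /=.
- by split=> //; have := fZ 0 0 S0; rewrite !scale0r => ->.
- by move=> u v [Su Du] [Sv Dv]; split; [exact: SD|rewrite fD//; exact: DD].
- by move=> k u [Su Du]; split; [exact: SZ|rewrite fZ//; exact: DZ].
- by move=> u a [Su Du]; split; [exact: Sa|rewrite fa//; exact: Da].
apply/closed_nrm => u H.
have Su : S u.
  by move/closed_nrm: Scl; apply=> e /H[s [Ss _] us]; exists s.
split=> //; move/closed_nrm: Dcl; apply=> e /H[s [Ss Ds] us]; exists (f s) => //.
by rewrite -(isomB cS fS)// (isom_nrm fS)//; exact: closed_submoduleB.
Qed.

End Intertwining.

Section Embedding.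
Variables (R : realType) (A : cstarAlgType R).
Hypothesis sr1 : stable_rank_one A.
Implicit Types X Y : hilbertModType A.

Lemma sub_isomorphic_isom X Y (S : set X) (T : set Y) :
  sub_isomorphic S T <-> exists2 f : X -> Y, isom_on S f & set_bij S T f.
Proof.
split=> [[f [bf fD fZ fa fi]]|[f [fD fZ fa fi] bf]]; exists f => //.
Qed.

Lemma isom_sub_isomorphic X Y (S : set X) (f : X -> Y) :
  closed_submodule S -> isom_on S f -> sub_isomorphic S (f @` S).
Proof.
move=> cS fS; apply/sub_isomorphic_isom; exists f => //; split.
- by move=> x Sx; exists x.
- by move=> x y /set_mem Sx /set_mem Sy; exact: (isom_inj cS fS).
- by move=> _ [x Sx <-]; exists x.
Qed.

Lemma embedding X Y : cg_module X -> cuntz_le X Y ->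
  exists f : X -> Y, isom_on setT f.
Proof.
move=> cgX XY; have [S [Scc nestS gS]] := exhaustion cgX.
have cS n : closed_submodule (S n) by case: (Scc n) => [[]].
have /choice[phi phiS] : forall n, exists f : X -> Y, isom_on (S n) f.
  move=> n; have [T _ /sub_isomorphic_isom[f fS _]] := XY _ (Scc n).
  by exists f.
have /choice[g Hg] : forall n, exists g : nat -> X, (forall k, S n (g k)) /\
    forall D, closed_submodule D -> (forall k, D (g k)) -> S n `<=` D.
  by move=> n; have [[_ [g Sg Hg]] _] := Scc n; exists g.
have nest m n x : (m <= n)%N -> S m x -> S n x.
  by move=> /subnK <-; elim: (n - m)%N => // k IH /IH; exact: nestS.
(* Finite subsets of the [S n], increasing, that exhaust the generators of all the [S m]. *)
pose F n : seq X := [seq g m i | m <- iota 0 n.+1, i <- iota 0 n.+1].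
have FS n x : x \in F n -> S n x.
  move=> /allpairsP[[m i] [mn _ ->]]; apply: (nest m).
    by move: mn; rewrite mem_iota add0n ltnS.
  by have [] := Hg m.
have /choice[u Hu] : forall n, exists u : lop Y, unitary u /\
    forall x, x \in F n -> nrm (u (phi n.+1 x) - phi n x) <= (2^-1) ^+ n.
  move=> n; have [u uu Hu] := isom_conj sr1 (cS n)
    (isom_on_sub (@nestS n) (phiS n.+1)) (phiS n) (FS n) (half_pow_gt0 R n).
  by exists u.
(* The product of [u 0] to [u n.-1]. It is isometric, so [Phi n.+1] is as close to [Phi n] as [u n]
   composed with [phi n.+1] is to [phi n]. The second component only counts the steps. *)
pose U n := iter n (fun p : lop Y * nat => (p.1 * u p.2, p.2.+1)) (1, 0%N).
have U2 n : (U n).2 = n by elim: n => //= n ->.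
have US n : (U n.+1).1 = (U n).1 * u n by rewrite /= -/(U n) U2.
have Uu n : unitary (U n).1.
  elim: n => [|n IH]; first exact: unitary1.
  by rewrite US; apply: unitaryM => //; case: (Hu n).
pose Phi n x := (U n).1 (phi n x).
have PhiS n : isom_on (S n) (Phi n) by exact: unitary_isom.
have step n x : x \in F n -> nrm (Phi n.+1 x - Phi n x) <= (2^-1) ^+ n.
  move=> xF; rewrite /Phi US lopME -lopB (nrm_isom (Uu n).1).
  by have [_] := Hu n; apply.
have [||f [fS _]] := limit_isometry cS PhiS nestS (D := [set x | exists m i, x = g m i]).
- move=> T cT gT x; apply: gS => // n; have [_] := Hg n; apply => // k.
  by apply: gT; exists n, k.
- move=> _ [m [i ->]].
  have gF n : (maxn m i <= n)%N -> g m i \in F n.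
    rewrite geq_max => /andP[mn i_n]; apply/allpairsP; exists (m, i).
    by rewrite !mem_iota !add0n !ltnS mn i_n.
  have [l gl _] := @geom_tends _ _ (fun n => Phi n (g m i)) (maxn m i) (fun n H => step n _ (gF n H)).
  exists m, l; split=> //; by have [] := Hg m.
by exists f.
Qed.

(* With unitaries [v], [w] such that [v beta alpha] is close to the identity on
   [F] and [w alpha (v beta)] is close to it on [K] and [alpha F], take
   [alpha' = w alpha]. *)
Lemma isom_perturb X Y (alpha : X -> Y) (beta : Y -> X) (F : seq X) (K : seq Y) (e : R) :
  isom_on setT alpha -> isom_on setT beta -> 0 < e ->
  exists alpha' : X -> Y, [/\ isom_on setT alpha',
    forall x, x \in F -> nrm (alpha' x - alpha x) <= e &
    forall y, y \in K -> exists x, nrm (alpha' x - y) <= e].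
Proof.
move=> aI bI e0; have e2 : 0 < e / 2 by lra.
have cX : closed_submodule [set: X] by exact: closed_submoduleT.
have cY : closed_submodule [set: Y] by exact: closed_submoduleT.
have [v vu Hv] := isom_conj sr1 cX (isom_comp aI bI) (isom_id X) (fun x (_ : x \in F) => I) e2.
have b'I : isom_on setT (fun y => v (beta y)) by exact: unitary_isom.
have [w wu Hw] := isom_conj sr1 cY (isom_comp b'I aI) (isom_id Y)
  (fun y (_ : y \in K ++ map alpha F) => I) e2.
have a'I : isom_on setT (fun x => w (alpha x)) by exact: unitary_isom.
exists (fun x => w (alpha x)); split=> //.
  move=> x xF.
  have H1 := Hv x xF.
  have H2 : nrm (w (alpha (v (beta (alpha x)))) - alpha x) <= e / 2.
    by apply: Hw; rewrite mem_cat map_f ?orbT.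
  have H3 : nrm (w (alpha x) - w (alpha (v (beta (alpha x))))) <= e / 2.
    by rewrite -(isomB cX a'I)// (isom_nrm a'I)// nrmC.
  by have := nrm_tri (w (alpha x)) (w (alpha (v (beta (alpha x))))) (alpha x); lra.
move=> y yK; exists (v (beta y)); have := Hw y; rewrite mem_cat yK => /(_ isT); lra.
Qed.

(** [alpha] is corrected repeatedly, each time almost unchanged on a finite set to which
    near-preimages of the generators [k i] are then added. Later corrections barely move these, so
    the closed range of the limit contains every [k i]. *)
Lemma isomorphic_embeddings X Y : cg_module X -> cg_module Y ->
  (exists f : X -> Y, isom_on setT f) -> (exists f : Y -> X, isom_on setT f) ->
  isomorphic X Y.
Proof.
move=> /cg_generates[g gg] /cg_generates[k gk] [alpha aI] [beta bI].
have step (p : nat * ((X -> Y) * seq X)) : exists q : (X -> Y) * seq X,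
   isom_on setT p.2.1 -> [/\ isom_on setT q.1,
     forall x, x \in p.2.2 -> nrm (q.1 x - p.2.1 x) <= (2^-1) ^+ p.1,
     {subset p.2.2 <= q.2}, g p.1 \in q.2 &
     forall i, (i <= p.1)%N -> exists2 x, x \in q.2 & nrm (q.1 x - k i) <= (2^-1) ^+ p.1].
  case: p => n [f F] /=.
  (* Choice requires a next state for every state; when [f] is not an isometry it is arbitrary. *)
  have [fI|nfI] := pselect (isom_on setT f); last by exists (f, F).
  have [L HL] : exists L : seq nat, forall i, (i <= n)%N -> i \in L.
    by exists (iota 0 n.+1) => i i_n; rewrite mem_iota add0n ltnS.
  have [f' [f'I H1 H2]] := isom_perturb F [seq k i | i <- L] fI bI (half_pow_gt0 R n).
  have /choice[x' Hx'] : forall i, exists x, (i <= n)%N -> nrm (f' x - k i) <= (2^-1) ^+ n.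
    move=> i; have [i_n|ni] := leqP i n; last by exists 0.
    have [|x Hx] := H2 (k i); last by exists x.
    by apply/map_f/HL.
  exists (f', F ++ g n :: [seq x' i | i <- L]) => _; split=> //=.
  - by move=> x xF; rewrite mem_cat xF.
  - by rewrite mem_cat inE eqxx orbT.
  - move=> i i_n; exists (x' i); last exact: Hx'.
    by rewrite mem_cat inE map_f ?orbT// HL.
have [st Hst] := choice step.
pose sq n := iter n (fun p : nat * ((X -> Y) * seq X) => (p.1.+1, st p)) (0%N, (alpha, [::])).
have sq1 n : (sq n).1 = n by elim: n => //= n ->.
pose a n := (sq n).2.1; pose F n := (sq n).2.2.
have aI' n : isom_on setT (a n).
  elim: n => [//|n IH]; have [] := Hst (sq n) IH; by [].
have H n : [/\ forall x, x \in F n -> nrm (a n.+1 x - a n x) <= (2^-1) ^+ n,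
     {subset F n <= F n.+1}, g n \in F n.+1 &
     forall i, (i <= n)%N -> exists2 x, x \in F n.+1 & nrm (a n.+1 x - k i) <= (2^-1) ^+ n].
  by have [_] := Hst (sq n) (aI' n); rewrite sq1.
have Fmono m n x : (m <= n)%N -> x \in F m -> x \in F n.
  by move=> /subnK <-; elim: (n - m)%N => // j IH /IH; have [_ + _ _] := H (j + m)%N; apply.
have lim m x : x \in F m -> exists2 l, tends (fun n => a n x) l &
    nrm (l - a m x) <= 2 * (2^-1) ^+ m.
  move=> xF; apply: geom_tends => n mn; have [+ _ _ _] := H n; apply.
  exact: Fmono mn xF.
have [||||f [fI Hf]] := @limit_isometry _ _ X Y (fun=> setT) a _ aI' _ [set x | exists m, x \in F m].
- by move=> n; exact: closed_submoduleT.
- by [].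
- move=> T cT FT; apply: gg => // n; apply: FT; exists n.+1; by have [] := H n.
- by move=> x [m xF]; have [l xl _] := lim m x xF; exists 0%N, l.
apply/sub_isomorphic_isom; exists f => //.
have cX : closed_submodule [set: X] by exact: closed_submoduleT.
split=> //; first by move=> x y _ _; exact: (isom_inj cX fI).
move=> y _; have cI := isom_image_closed cX fI.
apply: (gk _ cI) => i; have [_ _ _ _ /closed_nrm icl] := cI; apply: icl => e e0.
(* Two errors of size [2^-n]: one for the near-preimage, one for passing from [a n.+1] to the
   limit. *)
have [|N HN] := @half_pow_small R (e / 3); first by lra.
set n := maxn N i; have [_ _ _ /(_ i (leq_maxr N i))[x xF xk]] := H n.
have [l xl lx] := lim _ _ xF.
have fl : f x = l by apply: tends_uniq xl; apply: Hf; exists n.+1.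
exists (f x); first by exists x.
have := HN n (leq_maxl N i); rewrite exprS -fl in lx.
have := nrm_tri (k i) (a n.+1 x) (f x); rewrite (nrmC (k i) (a _ _)) (nrmC (a _ _) (f x)).
lra.
Qed.

End Embedding.

(** * Compact operators and isometries *)

Section FiniteRank.
Variables (R : realType) (A : cstarAlgType R).
Implicit Types X Y Z : hilbertModType A.

(** Kept as a list of coefficients and vectors because transport along an isometry acts on such a
    presentation, not directly on the operator. *)
Definition finrank X (s : seq (R[i] * (X * X))) : lop X :=
  \sum_(p <- s) p.1 *: theta p.2.1 p.2.2.

Lemma finrank_cat X (s t : seq (R[i] * (X * X))) :
  finrank (s ++ t) = finrank s + finrank t.
Proof. by rewrite /finrank big_cat. Qed.

Definition opp_rank X (p : R[i] * (X * X)) := (- p.1, p.2).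
Definition adj_rank X (p : R[i] * (X * X)) := ((p.1^*)%R, (p.2.2, p.2.1)).
Definition map_rank X Y (f : X -> Y) (p : R[i] * (X * X)) := (p.1, (f p.2.1, f p.2.2)).

Lemma finrank_opp X (s : seq (R[i] * (X * X))) : finrank (map (@opp_rank X) s) = - finrank s.
Proof.
rewrite /finrank big_map -sumrN; apply: eq_bigr => p _ /=.
by rewrite scaleNr.
Qed.

Lemma finrank_adj X (s : seq (R[i] * (X * X))) : finrank (map (@adj_rank X) s) = star (finrank s).
Proof.
rewrite /finrank big_map star_sum; apply: eq_bigr => p _ /=.
by rewrite starZ star_theta.
Qed.

Lemma finrankE X (s : seq (R[i] * (X * X))) x :
  finrank s x = \sum_(p <- s) p.1 *: hact p.2.1 (<< p.2.2, x >> : A).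
Proof. by rewrite /finrank lop_sumE; apply: eq_bigr => p _; rewrite lopZE thetaE. Qed.

Lemma finrank_compact X (t : X -> X) : module_endomorphism t ->
  (compact_endomorphism t <-> forall e : R, 0 < e ->
     exists s : seq (R[i] * (X * X)), bdf (fun x => t x - finrank s x) e).
Proof.
move=> te; split=> [[_ tc] e e0|tc].
  have [n [k [eta [zeta H]]]] := tc e e0.
  exists [seq (k i, (eta i, zeta i)) | i <- index_enum 'I_n] => x.
  by move: (H x); rewrite -!nrmE -rmorphM lecR finrankE big_map.
split=> // e e0; have [s Hs] := tc e e0.
pose d : R[i] * (X * X) := (0, (0, 0)).
exists (size s), (fun i => (nth d s i).1), (fun i => (nth d s i).2.1), (fun i => (nth d s i).2.2).
move=> x; rewrite -!nrmE -rmorphM lecR; move: (Hs x).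
by rewrite finrankE (big_nth d) big_mkord.
Qed.

Section Transport.
Variables (X Y : hilbertModType A) (f : X -> Y).
Hypothesis fI : isom_on setT f.

Local Notation fr s := (finrank (map (map_rank f) s)).

Lemma finrank_map s x : fr s (f x) = f (finrank s x).
Proof.
have [fD fZ fa fi] := fI; rewrite !finrankE big_map.
elim: s => [|p s IH]; first by rewrite !big_nil; have := fZ 0 0 I; rewrite !scale0r.
by rewrite !big_cons fD// fZ// fa// IH /= fi.
Qed.

Lemma finrank_range s y : exists x, fr s y = f x.
Proof.
have [fD fZ fa fi] := fI.
exists (\sum_(p <- s) p.1 *: hact p.2.1 (<< f p.2.2, y >> : A)).
rewrite !finrankE big_map.
elim: s => [|p s IH]; first by rewrite !big_nil; have := fZ 0 0 I; rewrite !scale0r.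
by rewrite !big_cons fD// fZ// fa// IH.
Qed.

Lemma finrank_map_adj s : map (map_rank f) (map (@adj_rank X) s) = map (@adj_rank Y) (map (map_rank f) s).
Proof. by rewrite -!map_comp. Qed.

Lemma finrank_map_opp s : map (map_rank f) (map (@opp_rank X) s) = map (@opp_rank Y) (map (map_rank f) s).
Proof. by rewrite -!map_comp. Qed.

(** A vector [fr s y] is of the form [f x], and the adjoint of [fr s] at [f x] is
    [f (star (finrank s) x)], of norm at most [M * nrm x = M * nrm (fr s y)]. So the square of
    [nrm (fr s y)] is at most [nrm y * M * nrm (fr s y)], with no projection onto the range of
    [f]. *)
Lemma finrank_map_bd s M : 0 <= M -> bd (finrank s) M -> bd (fr s) M.
Proof.
move=> M0 sM y; have [x yx] := finrank_range s y.
have := nrm_ge0 (fr s y); rewrite le_eqVlt => /orP[/eqP <-|p0].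
  by rewrite mulr_ge0 ?nrm_ge0.
rewrite -(ler_pM2r p0) -expr2 -nrm_inner starP yx -finrank_adj -finrank_map_adj.
rewrite finrank_map finrank_adj (isom_nrm fI)//.
apply: le_trans (inner_cs _ _) _; rewrite (isom_nrm fI)//.
by have := bd_star M0 sM x; have := nrm_ge0 y; nra.
Qed.

Lemma finrank_map_sub_bd s t M : 0 <= M -> bd (finrank s - finrank t) M -> bd (fr s - fr t) M.
Proof.
move=> M0; rewrite -!finrank_opp -!finrank_cat -finrank_map_opp -map_cat.
exact: finrank_map_bd.
Qed.

(* A compact operator of [X] is transported to [Y] along an isometry [f] whose
   range need not be complemented: finite rank operators keep their norm. *)
Lemma compact_transport (t : X -> X) : compact_endomorphism t -> self_adjoint t ->
  exists u : Y -> Y, [/\ compact_endomorphism u, self_adjoint u & forall x, u (f x) = f (t x)].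
Proof.
move=> tc tsa; have te : module_endomorphism t by case: tc.
have /choice[s Hs] : forall n, exists s, bdf (fun x => t x - finrank s x) ((2^-1) ^+ n).
  move=> n; have /(finrank_compact te) H := tc; exact: H (half_pow_gt0 R n).
have [T TE] : exists T : lop X, T = t :> (X -> X).
  have [M M0 sM] := lop_bd (finrank (s 0%N)).
  have tb : bdf t (M + 1).
    move=> x; have := nrm_tri (t x) (finrank (s 0%N) x) 0; rewrite !subr0.
    by have := Hs 0%N x; have := sM x; rewrite expr0; lra.
  by apply: (mk_lop _ tb tb) => x y; exact: tsa.
have Ts : star T = T by apply: star_uniq => x y; rewrite TE; exact: tsa.
have HT n : bd (T - finrank (s n)) ((2^-1) ^+ n) by move=> x; rewrite lopBE TE; exact: Hs.
have p0 := @half_pow_gt0 R.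
pose K n := fr (s n).
have step n : bd (K n.+1 - K n) (2 * (2^-1) ^+ n).
  apply: finrank_map_sub_bd; first by rewrite mulr_ge0// ltW.
  rewrite -[X in bd (X - _)](subrK T) -addrA.
  apply: bd_le (bdD (bdC (HT n.+1)) (HT n)).
  by rewrite exprS; have := p0 n; lra.
(* Its increments are exactly the bounds [2 * 2^-n] of [step]. *)
pose r n : R := - (4 * (2^-1) ^+ n).
have rS n : r n.+1 - r n = 2 * (2^-1) ^+ n by rewrite /r exprS; field.
have [||||U [KU KU']] := @lop_lim _ _ _ K r 0.
- by move=> n; rewrite -subr_ge0 rS mulr_ge0// ltW.
- by move=> n; rewrite oppr_le0 mulr_ge0// ltW.
- by move=> n; rewrite rS; exact: step.
- move=> n; rewrite rS -starB; apply: bd_star (step n).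
  by rewrite mulr_ge0// ltW.
(* The approximants [s n] may fail to be self-adjoint, but [T] is, so each [finrank (s n)] is within
   [2 * 2^-n] of its adjoint, and [finrank_map_sub_bd] transports this estimate. *)
have Us : star U = U.
  apply: ltends_uniq KU' _ => e e0.
  have [N HN] := KU _ (divr_gt0 e0 (ltr0n R 2)).
  have e4 : 0 < e / 4 by lra.
  have [M HM] := half_pow_small e4.
  exists (maxn N M) => n; rewrite geq_max => /andP[/HN H /HM H'].
  have H2 : bd (star (K n) - K n) (2 * (2^-1) ^+ n).
    rewrite -finrank_adj -finrank_map_adj.
    apply: finrank_map_sub_bd; first by rewrite mulr_ge0// ltW.
    have -> : finrank (map (@adj_rank X) (s n)) - finrank (s n) =
        (T - finrank (s n)) - star (T - finrank (s n)).
      by rewrite finrank_adj starB Ts opprB [RHS]addrC subrKA.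
    by rewrite mulr_natl mulr2n; apply: bdB (HT n) _; apply: bd_star (HT n); exact: ltW.
  rewrite -(subrKA (K n)); apply: bd_le (bdD H2 H).
  lra.
have Uf x : U (f x) = f (t x).
  apply: tends_uniq (ltends_pt (f x) KU) _ => e e0.
  have [N HN] := @half_pow_small R (e / (nrm x + 1)) (divr_gt0 e0 (ltr_wpDl (nrm_ge0 x) ltr01)).
  exists N => n Nn; rewrite /K finrank_map -(isomB (closed_submoduleT X) fI)// (isom_nrm fI)// nrmC.
  apply: le_trans (Hs n x) _; have := HN n Nn; have nx := nrm_ge0 x.
  by rewrite ler_pdivlMr; have := p0 n; nra.
exists U; split=> //; last by move=> x y; rewrite starP Us.
apply/finrank_compact; first exact: lop_module_endo.
move=> e e0; have [N HN] := KU e e0; exists (map (map_rank f) (s N)) => x.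
by rewrite nrmC; exact: HN N (leqnn N) x.
Qed.

Lemma embedding_cuntz_le : cuntz_le X Y.
Proof.
move=> S [[cS cg] [t [tc tsa tS]]].
have fS : isom_on S f by apply: isom_on_sub fI.
exists (f @` S); last exact: isom_sub_isomorphic.
split; first by split; [exact: isom_image_closed|exact: isom_image_cg].
have [u [uc usa uf]] := compact_transport tc tsa.
by exists u; split=> // _ [x Sx <-]; rewrite uf tS.
Qed.

End Transport.
End FiniteRank.

(** * Direct sums and the Cuntz semigroup *)

(** A new name for the product, to give it the norm of the inner product instead of the usual
    product norm. *)
Definition dsum (R : realType) (A : cstarAlgType R) (X Y : hilbertModType A) : Type :=
  (X * Y)%type.

Lemma addr_four (V : zmodType) (s u v w s' u' v' w' : V) :
  (s - u - (v - w)) + (s' - u' - (v' - w')) = (s + s' - (u + u')) - (v + v' - (w + w')).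
Proof. by rewrite addrACA [s - u + _]addrACA -!opprD [v - w + _]addrACA -opprD. Qed.

Section DirectSum.
Variables (R : realType) (A : cstarAlgType R) (X Y : hilbertModType A).

HB.instance Definition _ := GRing.Lmodule.copy (dsum X Y) (X * Y)%type.

Implicit Types p q : dsum X Y.

Definition dinner p q : A := << p.1, q.1 >> + << p.2, q.2 >>.
Definition dact p (a : A) : dsum X Y := (hact p.1 a, hact p.2 a).

Lemma dinnerDr p q r : dinner p (q + r) = dinner p q + dinner p r.
Proof. by rewrite /dinner /= !innerDr addrACA. Qed.

Lemma dinnerZr (k : R[i]) p q : dinner p (k *: q) = k *: dinner p q.
Proof. by rewrite /dinner /= !innerZr scalerDr. Qed.

Lemma dinner_act p q a : dinner p (dact q a) = cmul (dinner p q) a.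
Proof. by rewrite /dinner /= !inner_hact cmulDl. Qed.

Lemma dinner_star p q : cstar (dinner p q) = dinner q p.
Proof. by rewrite /dinner cstarD !inner_star. Qed.

Lemma dinner_ge0 p : cpositive (dinner p p).
Proof. by apply: cpositiveD; exact: inner_ge0. Qed.

Lemma dinnerDl p q r : dinner (p + q) r = dinner p r + dinner q r.
Proof. by rewrite -dinner_star dinnerDr cstarD !dinner_star. Qed.

Definition dnrm p : R := Num.sqrt (nrm (dinner p p)).

Lemma dnrm_ge0 p : 0 <= dnrm p.
Proof. exact: sqrtr_ge0. Qed.

Lemma dnrm_sqr p : dnrm p ^+ 2 = nrm (dinner p p).
Proof. by rewrite sqr_sqrtr ?nrm_ge0. Qed.

Lemma nrm_le_dnrm p : nrm p.1 <= dnrm p /\ nrm p.2 <= dnrm p.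
Proof.
by split; rewrite -(ler_pXn2r (ltn0Sn 1)) ?nnegrE ?nrm_ge0 ?dnrm_ge0// dnrm_sqr -nrm_inner;
  [|rewrite /dinner addrC]; apply: nrm_cpositive_mono; exact: inner_ge0.
Qed.

Lemma dnrm_le p : dnrm p <= nrm p.1 + nrm p.2.
Proof.
have n1 := nrm_ge0 p.1; have n2 := nrm_ge0 p.2.
rewrite -(ler_pXn2r (ltn0Sn 1)) ?nnegrE ?addr_ge0 ?dnrm_ge0// dnrm_sqr.
by apply: le_trans (nrmD _ _) _; rewrite !nrm_inner; nra.
Qed.

Lemma dnrm0_eq0 p : dnrm p = 0 -> p = 0.
Proof.
move=> p0; have [H1 H2] := nrm_le_dnrm p; rewrite p0 in H1 H2.
by case: p H1 H2 {p0} => x y /= /nrm_le0 -> /nrm_le0 ->.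
Qed.

(** [inner_cs] applies only to Hilbert modules, and the triangle inequality that makes the sum one
    depends on this bound. Hence the direct use of [complete_square]. *)
Lemma dinner_cs p q : nrm (dinner p q) <= dnrm p * dnrm q.
Proof.
have := dnrm_ge0 p; rewrite le_eqVlt => /orP[/eqP p0|p0].
  rewrite -p0 mul0r (@dnrm0_eq0 p)// /dinner /= !inner0l addr0 nrm0//.
have t0 : 0 < dnrm p ^+ 2 by exact: exprn_gt0.
pose v : dsum X Y := (dnrm p ^+ 2)%:C *: q - dact p (dinner p q).
have pt : nrm (dinner p p) <= dnrm p ^+ 2 by rewrite dnrm_sqr.
have vE : dinner v v = (((dnrm p ^+ 2) ^+ 2)%:C *: dinner q q -
      (dnrm p ^+ 2)%:C *: cmul (cstar (dinner p q)) (dinner p q)) -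
      ((dnrm p ^+ 2)%:C *: cmul (cstar (dinner p q)) (dinner p q) -
       cmul (cstar (dinner p q)) (cmul (dinner p p) (dinner p q))).
  rewrite [LHS]/dinner /v /= !inner_comb; set a := dinner p q.
  have e1 : cmul (cstar a) a = cmul << q.1, p.1 >> a + cmul << q.2, p.2 >> a.
    by rewrite dinner_star -cmulDl.
  have e2 : cmul (cstar a) a = cmul (cstar a) << p.1, q.1 >> + cmul (cstar a) << p.2, q.2 >>.
    by rewrite -cmulDr.
  have e3 : cmul (cstar a) (cmul (dinner p p) a) =
      cmul (cstar a) (cmul << p.1, p.1 >> a) + cmul (cstar a) (cmul << p.2, p.2 >> a).
    by rewrite -cmulDr -cmulDl.
  rewrite e3 {1}e1 e2 !scalerDr; exact: addr_four.
have [H _] := complete_square t0 (dinner_ge0 p) pt (dinner_ge0 v) vE.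
by move: H; rewrite -dnrm_sqr -exprMn ler_pXn2r// nnegrE ?mulr_ge0 ?nrm_ge0 ?dnrm_ge0.
Qed.

Definition dnorm p : R[i] := (dnrm p)%:C.

Fact dnormD p q : dnorm (p + q) <= dnorm p + dnorm q.
Proof.
rewrite /dnorm -rmorphD lecR -(ler_pXn2r (ltn0Sn 1)) ?nnegrE ?addr_ge0 ?dnrm_ge0//.
rewrite dnrm_sqr dinnerDl !dinnerDr.
apply: le_trans (nrmD _ _) _; apply: le_trans (lerD (nrmD _ _) (nrmD _ _)) _.
rewrite -!dnrm_sqr; have := dinner_cs p q; have := dinner_cs q p; nra.
Qed.

Fact dnormZ (k : R[i]) p : dnorm (k *: p) = `|k| * dnorm p.
Proof.
have k0 : 0 <= complex.Re `|k| by rewrite -ler0c RRe_real// ger0_real.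
rewrite /dnorm -[`|k|]RRe_real ?ger0_real// -rmorphM; congr real_complex_def.
apply/eqP; rewrite -(eqrXn2 (ltn0Sn 1)) ?mulr_ge0 ?dnrm_ge0//.
rewrite exprMn !dnrm_sqr dinnerZr -dinner_star dinnerZr cstarZ dinner_star scalerA.
rewrite nrmZc normrM norm_conjC; apply/eqP; congr (_ * _).
by rewrite -[`|k|]RRe_real ?ger0_real// -rmorphM /= expr2.
Qed.

Fact dnorm0_eq0 p : dnorm p = 0 -> p = 0.
Proof. by move=> /complexI; exact: dnrm0_eq0. Qed.

HB.instance Definition _ := Lmodule_isNormed.Build R[i] (dsum X Y) dnormD dnormZ dnorm0_eq0.

Fact dsum_complete (F : set_system (dsum X Y)) : ProperFilter F -> cauchy F -> cvg F.
Proof.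
move=> FF /cauchyP Fc.
have ballE p (e : R) q : ball p e%:C q = (dnrm (p - q) < e) :> Prop.
  by rewrite -ball_normE /ball_ /= -ltcR.
have realE (e : R[i]) : 0 < e -> exists2 r : R, 0 < r & e = r%:C.
  move=> e0; have eE : (complex.Re e)%:C = e by rewrite RRe_real// gtr0_real.
  by exists (complex.Re e); rewrite -?ltcR eE.
have lim (Z : hilbertModType A) (f : dsum X Y -> Z) :
    (forall p q, f (p - q) = f p - f q) -> (forall p, nrm (f p) <= dnrm p) ->
    exists l, forall e : R, 0 < e -> F [set q | nrm (l - f q) < e].
  move=> fB fn; have : cvg (f @ F).
    apply: cauchy_cvg; apply: cauchy_exP => _ /realE[e e0 ->].
    have [|p Fp] := Fc e%:C; first by rewrite ltcR.
    exists (f p); suff : F [set q | ball (f p) e%:C (f q)] by [].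
    apply: filterS Fp => q; change (ball p e%:C q -> ball (f p) e%:C (f q)).
    by rewrite ballE ball_nrm -fB; exact: le_lt_trans.
  move=> /cvg_ex[l fl]; exists l => e e0.
  have /fl : nbhs l (ball l e%:C) by apply: nbhsx_ballx; rewrite ltcR.
  move=> H; have {}H : F [set q | ball l e%:C (f q)] by [].
  by apply: filterS H => q; rewrite /mkset ball_nrm.
have [l1 H1] := lim X fst (fun p q => erefl) (fun p => (nrm_le_dnrm p).1).
have [l2 H2] := lim Y snd (fun p q => erefl) (fun p => (nrm_le_dnrm p).2).
apply/cvg_ex; exists ((l1, l2) : dsum X Y) => B /nbhs_ballP[_ /realE[e e0 ->] eB].
have e2 : 0 < e / 2 by lra.
apply: filterS (filterI (H1 _ e2) (H2 _ e2)) => q [/= q1 q2].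
apply: eB; rewrite ballE; apply: le_lt_trans (dnrm_le _) _ => /=; lra.
Qed.

HB.instance Definition _ := Uniform_isComplete.Build (dsum X Y) dsum_complete.

Fact dactDl p q a : dact (p + q) a = dact p a + dact q a.
Proof. by rewrite /dact /= !hactDl. Qed.
Fact dactDr p a b : dact p (a + b) = dact p a + dact p b.
Proof. by rewrite /dact /= !hactDr. Qed.
Fact dactZl (k : R[i]) p a : dact (k *: p) a = k *: dact p a.
Proof. by rewrite /dact /= !hactZl. Qed.
Fact dactZr (k : R[i]) p a : dact p (k *: a) = k *: dact p a.
Proof. by rewrite /dact /= !hactZr. Qed.
Fact dactM p a b : dact p (cmul a b) = dact (dact p a) b.
Proof. by rewrite /dact /= !hactM. Qed.
Fact dnormE p : `|p| ^+ 2 = `|dinner p p|.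
Proof.
have -> : `|p| = (dnrm p)%:C by [].
by rewrite -[RHS]nrmE -dnrm_sqr rmorphXn.
Qed.

HB.instance Definition _ := CompleteNormedModule_isHilbertModule.Build R A (dsum X Y)
  dactDl dactDr dactZl dactZr dactM dinnerDr dinnerZr dinner_act dinner_star dinner_ge0 dnormE.

Lemma direct_sum_dsum : direct_sum X Y (dsum X Y).
Proof.
by exists id; split=> //; split=> // p _; exists p.
Qed.

End DirectSum.

(** * Isomorphisms and sums of modules *)

Section Isomorphisms.
Variables (R : realType) (A : cstarAlgType R).
Implicit Types X Y Z W : hilbertModType A.

(** The defect of linearity, such as [f (x + y) - f x - f y], is orthogonal to the range of [f] and
    is also a combination of vectors of that range, so it vanishes. *)
Lemma inner_isom X Y (f : X -> Y) :
  (forall x y, << f x, f y >> = << x, y >> :> A) -> isom_on setT f.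
Proof.
move=> fi.
(* The separate term [hact (f w) a] serves compatibility with the action; for addition and scalars
   it is taken to be 0. *)
have zero (z : Y) (s : seq (R[i] * X)) a (w : X) :
    (forall x, << z, f x >> = 0 :> A) -> z = hact (f w) a + \sum_(p <- s) p.1 *: f p.2 -> z = 0.
  move=> zf zE; apply: nrm_eq0; apply/eqP; rewrite -sqrf_eq0 -nrm_inner {2}zE.
  rewrite innerDr inner_hact zf cmul0l add0r.
  rewrite (_ : << z, _ >> = 0 :> A) ?nrm0//; elim: s {zE} => [|p s IH].
    by rewrite big_nil inner0r.
  by rewrite big_cons innerDr innerZr zf scaler0 add0r.
split=> [x y _ _|k x _|x a _|x y _ _]; last exact: fi.
- apply/eqP; rewrite -subr_eq0; apply/eqP.
  apply: (@zero _ [:: (1, x + y); (-1, x); (-1, y)] 0 0).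
    by move=> z; rewrite innerBl innerDl !fi innerDl subrr.
  by rewrite hact0r add0r !big_cons big_nil addr0 /= !scaleN1r scale1r opprD.
- apply/eqP; rewrite -subr_eq0; apply/eqP.
  apply: (@zero _ [:: (1, k *: x); (-k, x)] 0 0).
    by move=> z; rewrite innerBl innerZl !fi innerZl subrr.
  by rewrite hact0r add0r !big_cons big_nil addr0 /= scale1r scaleNr.
- apply/eqP; rewrite -subr_eq0; apply/eqP.
  apply: (@zero _ [:: (1, hact x a)] (- a) x).
    by move=> z; rewrite innerBl inner_hactl !fi inner_hactl subrr.
  by rewrite hactNr big_cons big_nil addr0 /= scale1r addrC.
Qed.

Lemma isomorphicP X Y : isomorphic X Y <-> exists f : X -> Y,
  (forall x y, << f x, f y >> = << x, y >> :> A) /\ forall y, exists x, f x = y.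
Proof.
split=> [/sub_isomorphic_isom[f [_ _ _ fi] [_ _ fs]]|[f [fi fs]]].
  by exists f; split=> [x y|y]; [exact: fi|have [x _ <-] := fs y I; exists x].
have fI := inner_isom fi.
apply/sub_isomorphic_isom; exists f => //; split=> // [x y _ _|y _].
  by apply: isom_inj fI _ _ => //; exact: closed_submoduleT.
by have [x <-] := fs y; exists x.
Qed.

Lemma isomorphic_refl X : isomorphic X X.
Proof. by apply/isomorphicP; exists id; split=> // y; exists y. Qed.

Lemma isomorphic_sym X Y : isomorphic X Y -> isomorphic Y X.
Proof.
move=> /isomorphicP[f [fi fs]]; have [g gK] := choice fs.
apply/isomorphicP; exists g; split=> [x y|x]; first by rewrite -fi !gK.
exists (f x); exact: (isom_inj (closed_submoduleT X) (inner_isom fi)).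
Qed.

Lemma isomorphic_trans X Y Z : isomorphic X Y -> isomorphic Y Z -> isomorphic X Z.
Proof.
move=> /isomorphicP[f [fi fs]] /isomorphicP[g [gi gs]]; apply/isomorphicP.
exists (fun x => g (f x)); split=> [x y|z]; first by rewrite gi fi.
by have [y <-] := gs z; have [x <-] := fs y; exists x.
Qed.

Lemma isomorphic_direct_sum X Y W X' Y' W' : isomorphic X X' -> isomorphic Y Y' ->
  direct_sum X Y W -> direct_sum X' Y' W' -> isomorphic W W'.
Proof.
move=> /isomorphicP[a [ai as_]] /isomorphicP[b [bi bs]].
move=> [f [[_ finj fs] _ _ _ fi]] [f' [[_ _ fs'] _ _ _ fi']].
have /choice[g gK] : forall w, exists p, f p = w.
  by move=> w; have [p _ <-] := fs w I; exists p.
apply/isomorphicP; exists (fun w => f' (a (g w).1, b (g w).2)); split.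
  by move=> u v; rewrite fi' /= ai bi -fi !gK.
move=> w'; have [[x' y'] _ <-] := fs' w' I.
have [x <-] := as_ x'; have [y <-] := bs y'.
exists (f (x, y)); suff -> : g (f (x, y)) = (x, y) by [].
by apply: finj; rewrite ?inE// gK.
Qed.

Lemma isom_preim_closed X W (f : X -> W) (D : set W) : isom_on setT f ->
  closed_submodule D -> closed_submodule [set x | D (f x)].
Proof.
move=> fI [D0 DD DZ Da /closed_nrm Dcl]; have [fD fZ fa _] := fI; split=> /=.
- by have := fZ 0 0 I; rewrite !scale0r => ->.
- by move=> x y Dx Dy; rewrite fD//; exact: DD.
- by move=> k x Dx; rewrite fZ//; exact: DZ.
- by move=> x a Dx; rewrite fa//; exact: Da.
apply/closed_nrm => x H; apply: Dcl => e /H[s Ds xs]; exists (f s) => //.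
by rewrite -(isomB (closed_submoduleT X) fI)// (isom_nrm fI).
Qed.

Lemma cg_direct_sum X Y W : cg_module X -> cg_module Y -> direct_sum X Y W -> cg_module W.
Proof.
move=> /cg_generates[g gg] /cg_generates[k gk] [f [[_ _ fs] fD _ _ fi]].
have f1 : isom_on setT (fun x : X => f (x, 0)).
  by apply: inner_isom => x y; rewrite fi /= inner0l addr0.
have f2 : isom_on setT (fun y : Y => f (0, y)).
  by apply: inner_isom => x y; rewrite fi /= inner0l add0r.
exists (fun n => if odd n then f (g n./2, 0) else f (0, k n./2)) => //.
move=> D cD Dgk w _; have [[x y] _ <-] := fs w I.
have -> : (x, y) = (x, 0) + (0, y) :> X * Y.
  by rewrite -[RHS]/(x + 0, 0 + y) addr0 add0r.
rewrite fD; have [_ DD _ _ _] := cD; apply: DD.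
  apply: (gg _ (isom_preim_closed f1 cD)) => n /=.
  by have := Dgk n.*2.+1; rewrite /= odd_double/= uphalf_double.
apply: (gk _ (isom_preim_closed f2 cD)) => n /=.
by have := Dgk n.*2; rewrite odd_double doubleK.
Qed.

End Isomorphisms.

(** * Cuntz classes are isomorphism classes *)

Section Main.
Variables (R : realType) (A : cstarAlgType R).
Hypothesis sr1 : stable_rank_one A.
Implicit Types X Y Z W : hilbertModType A.

Lemma cuntz_equiv_isomorphic X Y : cg_module X -> cg_module Y ->
  (cuntz_equiv X Y <-> isomorphic X Y).
Proof.
move=> cX cY; split=> [[XY YX]|XY].
  by apply: isomorphic_embeddings => //; exact: embedding.
have le X' Y' : isomorphic X' Y' -> cuntz_le X' Y'.
  by move=> /isomorphicP[f [/inner_isom fI _]]; exact: embedding_cuntz_le fI.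
by split; apply: le => //; exact: isomorphic_sym.
Qed.

Lemma cuntz_le_subobject X Y : cg_module X ->
  (cuntz_le X Y <-> exists2 S : set Y, subobject S & sub_isomorphic [set: X] S).
Proof.
move=> cX; split=> [/(embedding sr1 cX)[f fI]|[S _ /sub_isomorphic_isom[f fI _]]].
  have cT := closed_submoduleT X.
  exists (f @` setT); last exact: isom_sub_isomorphic.
  by split; [exact: isom_image_closed|exact: isom_image_cg].
exact: embedding_cuntz_le fI.
Qed.

Lemma module_class_cuntz X : cg_module X ->
  module_class (@cuntz_equiv R A) X = module_class (@isomorphic R A) X.
Proof.
move=> cX; apply/funext => Y; apply/propext; split=> [] [cY].
  by move=> /(cuntz_equiv_isomorphic cX cY).
by move=> /(cuntz_equiv_isomorphic cX cY).
Qed.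

Lemma Cu_iso_classes : Cu A = iso_classes A.
Proof.
apply/funext => c; apply/propext; split=> [] [X cX ->]; exists X => //.
  exact: module_class_cuntz.
exact/esym/module_class_cuntz.
Qed.

Lemma Cu_add_iso c d : Cu A c -> Cu A d -> Cu_add c d = iso_add c d.
Proof.
move=> [X0 _ ->] [Y0 _ ->]; apply/funext => Z; apply/propext.
split=> [] [X [Y [W [cX dY XYW WZ]]]]; exists X, Y, W; split=> //;
  have cW := cg_direct_sum cX.1 dY.1 XYW.
  by rewrite -module_class_cuntz.
by rewrite module_class_cuntz.
Qed.

(** The sum is shown to be a class on the side of isomorphism, where independence of representatives
    is [isomorphic_direct_sum] and [dsum X0 Y0] is a representative. *)
Lemma Cu_add_Cu c d : Cu A c -> Cu A d -> Cu A (Cu_add c d).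
Proof.
move=> Cc Cd; rewrite (Cu_add_iso Cc Cd); move: Cc Cd; rewrite Cu_iso_classes.
move=> [X0 cX0 ->] [Y0 cY0 ->].
have S0 := direct_sum_dsum X0 Y0.
exists (dsum X0 Y0); first exact: cg_direct_sum cX0 cY0 S0.
apply/funext => Z; apply/propext; split.
  move=> [X [Y [W [[cX X0X] [cY Y0Y] XYW [cZ WZ]]]]]; split=> //.
  apply: isomorphic_trans WZ; exact: isomorphic_direct_sum X0X Y0Y S0 XYW.
move=> [cZ WZ]; exists X0, Y0, (dsum X0 Y0); split=> //; split=> //; exact: isomorphic_refl.
Qed.

End Main.

Theorem theorem3 (R : realType) (A : cstarAlgType R)
    (sr1 : stable_rank_one A) :
  (forall X Y : hilbertModType A, cg_module X -> cg_module Y ->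
     (cuntz_equiv X Y <-> isomorphic X Y)) /\
  (Cu A = iso_classes A /\
   forall c d, Cu A c -> Cu A d ->
     Cu A (Cu_add c d) /\ Cu_add c d = iso_add c d) /\
  (forall X Y : hilbertModType A, cg_module X -> cg_module Y ->
     (cuntz_le X Y <->
      exists2 S : set Y, subobject S & sub_isomorphic [set: X] S)).
Proof.
split; first exact: cuntz_equiv_isomorphic sr1.
split; last by move=> X Y cX _; exact: cuntz_le_subobject sr1 X Y cX.
split; first exact: Cu_iso_classes sr1.
by move=> c d Cc Cd; split; [exact: Cu_add_Cu|exact: Cu_add_iso].
Qed.
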